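(* Let $\Theta:\mathcal{S}(\mathbb{R}^d)\to\mathcal{S}(\mathbb{R}^d)$ be a multiplier with real-valued symbol $m\in C^\infty(\mathbb{R}^d)$. Let $\{T_k\}_{k\in\mathbb{Z}}$ be a doubly infinite sequence of tempered distributions on $\mathbb{R}^d$. Suppose that for all $k\in\mathbb{Z}$, $\Theta T_k=AT_{k+1}$ for a non-zero constant $A\in\mathbb{C}$ and $|\langle T_k,\psi\rangle|\le M\gamma(\psi)$ for all $\psi\in\mathcal{S}(\mathbb{R}^d)$, for a fixed seminorm $\gamma$ of $\mathcal{S}(\mathbb{R}^d)$ and a constant $M>0$ (with $A,\gamma,M$ independent of $k$). Let $m(\mathbb{R}^d)=\{m(\xi):\xi\in\mathbb{R}^d\}$. Then: (a) If $|A|\in m(\mathbb{R}^d)$ but $-|A|\notin m(\mathbb{R}^d)$, then $\Theta T_0=|A|T_0$. (b) If $-|A|\in m(\mathbb{R}^d)$ but $|A|\notin m(\mathbb{R}^d)$, then $\Theta T_0=-|A|T_0$. (c) If both $|A|$ and $-|A|$ belong to $m(\mathbb{R}^d)$, then $T_0$ can be uniquely written as $T_0=T_++T_-$, where $T_+,T_-\in\mathcal{S}(\mathbb{R}^d)'$ satisfy $\Theta T_+=|A|T_+$ and $\Theta T_-=-|A|T_-$. (d) If neither $|A|$ nor $-|A|$ is in $m(\mathbb{R}^d)$, then $T_0=0$.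
   Context: $\mathcal{S}(\mathbb{R}^d)$ is the Schwartz space, $\mathcal{S}(\mathbb{R}^d)'$ the space of tempered distributions; a seminorm of $\mathcal{S}(\mathbb{R}^d)$ means a continuous seminorm for its Fréchet topology. The Fourier transform is $\hat f(\xi)=\int_{\mathbb{R}^d}f(x)e^{-ix\cdot\xi}\,dx$. A multiplier on $\mathcal{S}(\mathbb{R}^d)$ with symbol $m\in C^\infty(\mathbb{R}^d)$ is a continuous linear operator $\Theta:\mathcal{S}(\mathbb{R}^d)\to\mathcal{S}(\mathbb{R}^d)$ with $\widehat{\Theta f}(\xi)=m(\xi)\hat f(\xi)$ for all $f\in\mathcal{S}(\mathbb{R}^d)$, $\xi\in\mathbb{R}^d$. It extends to $T\in\mathcal{S}(\mathbb{R}^d)'$ by $\langle\Theta T,f\rangle=\langle T,\Theta^*f\rangle$ for $f\in\mathcal{S}(\mathbb{R}^d)$, where $\Theta^*$ is the multiplier with symbol $m(-\xi)$. *)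

(* Defs.v *)
From HB Require Import structures.
From mathcomp Require Import all_boot all_order all_algebra.
From mathcomp Require Import complex.
From mathcomp Require Import all_classical all_reals all_analysis.

Set Implicit Arguments.
Unset Strict Implicit.
Unset Printing Implicit Defensive.

Import Order.TTheory GRing.Theory Num.Theory.
Import numFieldNormedType.Exports.
Import Normc.

Local Open Scope classical_set_scope.
Local Open Scope ring_scope.
Local Open Scope complex_scope.

(* Complex-valued functions take values in R[i]^o, which is R[i] seen as a
   normed module over itself; this is where its topology lives.  The real
   modulus is [normc : R[i] -> R], while [`|z|] is an element of R[i]. *)

Section Smooth.
Context {R : realType} {d : nat}.
Implicit Types (f g : 'rV[R]_d -> R) (s : seq 'I_d).

(* A partial derivative of any order is indexed by the list of the successive
   directions of differentiation: [:: i1; ...; ik] is d_i1 (... (d_ik f)). *)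
Definition partial s f : 'rV[R]_d -> R :=
  foldr (fun i g x => 'D_(delta_mx 0 i) g x) f s.

Definition smooth f : Prop :=
  forall s, continuous (partial s f) /\
    forall (i : 'I_d) (x : 'rV[R]_d),
      derivable (partial s f) x (delta_mx 0 i).

Let lin (a b : R) f g : 'rV[R]_d -> R := fun x => a * f x + b * g x.

Let derivable_lin (a b : R) f g (x v : 'rV[R]_d) :
  derivable f x v -> derivable g x v -> derivable (lin a b f g) x v.
Proof.
move=> df dg.
have af := @derivableZ R 'rV[R]_d R^o f a x v df.
have bg := @derivableZ R 'rV[R]_d R^o g b x v dg.
exact: (@derivableD R 'rV[R]_d R^o _ _ x v af bg).
Qed.

Let derive_lin (a b : R) f g (x v : 'rV[R]_d) :
  derivable f x v -> derivable g x v ->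
  'D_v (lin a b f g) x = a * 'D_v f x + b * 'D_v g x.
Proof.
move=> df dg.
have af := @derivableZ R 'rV[R]_d R^o f a x v df.
have bg := @derivableZ R 'rV[R]_d R^o g b x v dg.
have eD := @deriveD R 'rV[R]_d R^o _ _ x v af bg.
apply: (etrans eD); congr (_ + _).
  exact: (@deriveZ R 'rV[R]_d R^o f a x v df).
exact: (@deriveZ R 'rV[R]_d R^o g b x v dg).
Qed.

Lemma partial_lin s (a b : R) f g : smooth f -> smooth g ->
  partial s (fun x => a * f x + b * g x)
  = (fun x => a * partial s f x + b * partial s g x).
Proof.
move=> sf sg; elim: s => [//|i s IH] /=; apply/funext => x; rewrite IH.
exact: (derive_lin a b ((sf s).2 i x) ((sg s).2 i x)).
Qed.

Lemma smooth_lin (a b : R) f g : smooth f -> smooth g ->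
  smooth (fun x => a * f x + b * g x).
Proof.
move=> sf sg s; rewrite partial_lin //; split => [x|i x].
  have cf := (sf s).1 x; have cg := (sg s).1 x.
  pose proof (@cvgMl_tmp R _ (nbhs x) _ _ a _ cf) as af.
  pose proof (@cvgMl_tmp R _ (nbhs x) _ _ b _ cg) as bg.
  exact: (cvgD af bg).
exact: (derivable_lin ((sf s).2 i x) ((sg s).2 i x)).
Qed.

End Smooth.

Section ComplexSmooth.
Context {R : realType} {d : nat}.
Implicit Types (f g : 'rV[R]_d -> R[i]^o) (s : seq 'I_d).

Definition csmooth f : Prop :=
  smooth (fun x => complex.Re (f x)) /\ smooth (fun x => complex.Im (f x)).

Definition cpartial s f : 'rV[R]_d -> R[i]^o := fun x =>
  partial s (fun y => complex.Re (f y)) x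
  +i* partial s (fun y => complex.Im (f y)) x.

Let lin (a b : R) (f g : 'rV[R]_d -> R) : 'rV[R]_d -> R :=
  fun x => a * f x + b * g x.

Let Re_lin (a b : R) f g :
  (fun x => complex.Re (((a +i* b : R[i]) *: f + g) x)) =
  lin 1 1 (lin a (- b) (fun x => complex.Re (f x)) (fun x => complex.Im (f x)))
    (fun x => complex.Re (g x)).
Proof.
apply/funext => x; rewrite /lin /GRing.add /GRing.scale /= /GRing.scale /=.
by case: (f x) (g x) => [u v] [w z] /=; rewrite !mul1r mulNr.
Qed.

Let Im_lin (a b : R) f g :
  (fun x => complex.Im (((a +i* b : R[i]) *: f + g) x)) =
  lin 1 1 (lin a b (fun x => complex.Im (f x)) (fun x => complex.Re (f x)))
    (fun x => complex.Im (g x)).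
Proof.
apply/funext => x; rewrite /lin /GRing.add /GRing.scale /= /GRing.scale /=.
by case: (f x) (g x) => [u v] [w z] /=; rewrite !mul1r.
Qed.

Lemma csmooth_lin (a : R[i]) f g : csmooth f -> csmooth g ->
  csmooth (a *: f + g).
Proof.
case: a => a b [fr fi] [gr gi]; rewrite /csmooth Re_lin Im_lin; split.
  exact: (smooth_lin 1 1 (smooth_lin a (- b) fr fi) gr).
exact: (smooth_lin 1 1 (smooth_lin a b fi fr) gi).
Qed.

Lemma cpartial_lin s (a : R[i]) f g : csmooth f -> csmooth g ->
  cpartial s (a *: f + g) = a *: cpartial s f + cpartial s g.
Proof.
case: a => a b [fr fi] [gr gi]; rewrite /cpartial Re_lin Im_lin /lin.
rewrite (partial_lin s 1 1 (smooth_lin a (- b) fr fi) gr).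
rewrite (partial_lin s 1 1 (smooth_lin a b fi fr) gi).
rewrite (partial_lin s a (- b) fr fi) (partial_lin s a b fi fr).
apply/funext => x.
by rewrite [RHS]/GRing.add /GRing.scale /= /GRing.scale /= !mul1r mulNr.
Qed.

End ComplexSmooth.

Section Schwartz.
Variables (R : realType) (d : nat).

(* The function whose supremum is the Schwartz seminorm p_(N, s). *)
Definition weighted (N : nat) (s : seq 'I_d) (f : 'rV[R]_d -> R[i]^o)
    (x : 'rV[R]_d) : R :=
  (1 + `|x|) ^+ N * normc (cpartial s f x).

Definition is_schwartz (f : 'rV[R]_d -> R[i]^o) : Prop :=
  csmooth f /\
  forall N s, exists B : R, forall x, weighted N s f x <= B.

Definition schwartz_pred : {pred 'rV[R]_d -> R[i]^o} :=
  mem [set f | is_schwartz f].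

Lemma weighted_ge0 N s f x : 0 <= weighted N s f x.
Proof.
by rewrite mulr_ge0 ?exprn_ge0 ?addr_ge0 //; case: (cpartial _ _ _) => u v;
  exact: sqrtr_ge0.
Qed.

Lemma weighted_lin N s (a : R[i]) f g x : csmooth f -> csmooth g ->
  weighted N s (a *: f + g) x <= normc a * weighted N s f x + weighted N s g x.
Proof.
move=> sf sg; rewrite /weighted cpartial_lin //.
rewrite mulrCA -mulrDr ler_wpM2l ?exprn_ge0 ?addr_ge0 //.
by rewrite -normcM; exact: le_normcD.
Qed.

Lemma schwartz_submod_closed : submod_closed schwartz_pred.
Proof.
have p0 s : @partial R d s (fun=> 0) = (fun=> 0).
  elim: s => [//|i s IH] /=; apply/funext => x.
  by rewrite IH; exact: derive_cst.
have s0 : @smooth R d (fun=> 0).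
  move=> s; rewrite p0; split; first exact: cst_continuous.
  by move=> i x; exact: derivable_cst.
split.
  rewrite inE; split; first by split; exact: s0.
  move=> N s; exists 0 => x.
  have -> : weighted N s 0 x = (1 + `|x|) ^+ N *
      normc (partial s (fun=> 0) x +i* partial s (fun=> 0) x) by [].
  by rewrite !p0 normc0 mulr0.
move=> a f g; rewrite !inE => -[sf bf] [sg bg].
split; first exact: csmooth_lin.
move=> N s; have [B hB] := bf N s; have [C hC] := bg N s.
exists (normc a * B + C) => x.
apply: (le_trans (weighted_lin _ _ _ _ sf sg)); apply: lerD => //.
by apply: ler_wpM2l => //; case: (a) => u v; exact: sqrtr_ge0.
Qed.

HB.instance Definition _ := GRing.isSubmodClosed.Build _ _ schwartz_pred
  schwartz_submod_closed.

Record schwartz := Schwartz {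
  schwartz_fun :> 'rV[R]_d -> R[i]^o;
  _ : schwartz_fun \in schwartz_pred }.

HB.instance Definition _ := [isSub for schwartz_fun].
HB.instance Definition _ := [Choice of schwartz by <:].
HB.instance Definition _ := [SubChoice_isSubLmodule of schwartz by <:].

Definition seminorm (N : nat) (s : seq 'I_d) (f : schwartz) : R :=
  sup (range (weighted N s f)).

(* As p_(N, s) is nondecreasing in N, these sets form a basis of
   neighbourhoods of f for the Frechet topology given by all the p_(N, s). *)
Definition schwartz_ball (f : schwartz) (N : nat) (e : R) : set schwartz :=
  [set g | forall s : seq 'I_d, (size s <= N)%N -> seminorm N s (g - f) < e].

Definition schwartz_nbhs (f : schwartz) : set_system schwartz :=
  [set A | exists N e, 0 < e /\ schwartz_ball f N e `<=` A].

Lemma seminorm_ub N s (f : schwartz) x : weighted N s f x <= seminorm N s f.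
Proof.
apply: ub_le_sup; last by exists x.
have [_ h] : is_schwartz f by have := valP f; rewrite inE.
by have [B hB] := h N s; exists B => _ [y _ <-].
Qed.

Lemma seminorm_le N s (f : schwartz) B : (forall x, weighted N s f x <= B) ->
  seminorm N s f <= B.
Proof.
move=> h; apply: ge_sup; first by exists (weighted N s f 0); exists 0.
by move=> _ [y _ <-].
Qed.

Lemma seminormD N s (f g : schwartz) :
  seminorm N s (f + g) <= seminorm N s f + seminorm N s g.
Proof.
have [sf _] : is_schwartz f by have := valP f; rewrite inE.
have [sg _] : is_schwartz g by have := valP g; rewrite inE.
apply: seminorm_le => x.
have := @weighted_lin N s 1 f g x sf sg.
rewrite scale1r normc1 mul1r => /le_trans; apply.
by apply: lerD; exact: seminorm_ub.
Qed.

Lemma seminorm0 N s : seminorm N s 0 = 0.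
Proof.
have e0 : (0 : schwartz) = 0 *: (0 : schwartz) + 0 by rewrite scaler0 addr0.
have s0 : is_schwartz (0 : schwartz).
  by have := valP (0 : schwartz); rewrite inE.
have h x : cpartial s (0 : schwartz) x = 0.
  have := @cpartial_lin R d s (-1) (0 : schwartz) (0 : schwartz) s0.1 s0.1.
  rewrite scaleN1r addNr.
  move=> ->; rewrite scaleN1r.
  by rewrite [LHS]/GRing.add /= addNr.
apply/eqP; rewrite eq_le; apply/andP; split.
  by apply: seminorm_le => x; rewrite /weighted h normc0 mulr0.
exact: le_trans (weighted_ge0 _ _ _ 0) (seminorm_ub _ _ _ 0).
Qed.

Lemma seminorm_mono N N' s (f : schwartz) :
  (N <= N')%N -> seminorm N s f <= seminorm N' s f.
Proof.
move=> NN; apply: seminorm_le => x; apply: (le_trans _ (seminorm_ub N' s f x)).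
rewrite /weighted; apply: ler_wpM2r.
  by case: (cpartial _ _ _) => u v; exact: sqrtr_ge0.
by apply: ler_weXn2l => //; rewrite lerDl.
Qed.

Lemma schwartz_nbhs_filter f : ProperFilter (schwartz_nbhs f).
Proof.
have ctr N e : 0 < e -> schwartz_ball f N e f.
  by move=> e0 s _; rewrite subrr seminorm0.
apply: Build_ProperFilter_ex.
  by move=> A [N [e [e0 sA]]]; exists f; apply: sA; exact: ctr.
split.
- by exists 0%N, 1.
- move=> A B [N [e [e0 sA]]] [N' [e' [e'0 sB]]].
  exists (maxn N N'), (Num.min e e'); split; first by rewrite lt_min e0.
  move=> g hg; split; [apply: sA|apply: sB] => s ls.
  + apply: le_lt_trans (seminorm_mono _ _ (leq_maxl N N')) _.
    by apply: lt_le_trans (hg s (leq_trans ls (leq_maxl _ _))) _;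
      rewrite ge_min lexx.
  + apply: le_lt_trans (seminorm_mono _ _ (leq_maxr N N')) _.
    by apply: lt_le_trans (hg s (leq_trans ls (leq_maxr _ _))) _;
      rewrite ge_min lexx orbT.
- by move=> A B AB [N [e [e0 sA]]]; exists N, e; split => //;
    exact: subset_trans AB.
Qed.

Lemma schwartz_nbhs_singleton f A : schwartz_nbhs f A -> A f.
Proof.
by move=> [N [e [e0 sA]]]; apply: sA => s _; rewrite subrr seminorm0.
Qed.

Lemma schwartz_nbhs_nbhs f A :
  schwartz_nbhs f A -> schwartz_nbhs f (schwartz_nbhs^~ A).
Proof.
move=> [N [e [e0 sA]]]; exists N, (e / 2); split; first by rewrite divr_gt0.
move=> g hg; exists N, (e / 2); split; first by rewrite divr_gt0.
move=> h hh; apply: sA => s ls.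
rewrite -[h](subrK g) -addrA (splitr e).
by apply: (le_lt_trans (seminormD _ _ _ _)); apply: ltrD; [exact: hh|exact: hg].
Qed.

HB.instance Definition _ := hasNbhs.Build schwartz schwartz_nbhs.
HB.instance Definition _ := Nbhs_isNbhsTopological.Build schwartz
  schwartz_nbhs_filter schwartz_nbhs_singleton schwartz_nbhs_nbhs.

Definition continuous_seminorm (gamma : schwartz -> R) : Prop :=
  [/\ forall f g, gamma (f + g) <= gamma f + gamma g,
      forall (c : R[i]) f, gamma (c *: f) = normc c * gamma f
    & continuous gamma].

Definition tempered (T : schwartz -> R[i]^o) : Prop :=
  linear T /\ continuous T.

End Schwartz.

Section Fourier.
Context {R : realType}.

(* Iterated Lebesgue integral: by Fubini's theorem, it is the integral over
   R^d for integrable continuous functions such as x |-> f x e^(-i x.xi), f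
   Schwartz. *)
Fixpoint integral_rV (d : nat) : ('rV[R]_d -> R) -> R :=
  match d with
  | 0 => fun f => f 0
  | d'.+1 => fun f => \int[lebesgue_measure]_t
      integral_rV (fun y : 'rV[R]_d' => f (row_mx (@const_mx R 1 1 t) y))
  end.

Definition cintegral_rV (d : nat) (f : 'rV[R]_d -> R[i]^o) : R[i]^o :=
  integral_rV (fun x => complex.Re (f x))
  +i* integral_rV (fun x => complex.Im (f x)).

Definition expi (t : R) : R[i] := cos t +i* sin t.

Definition fourier (d : nat) (f : 'rV[R]_d -> R[i]^o) : 'rV[R]_d -> R[i]^o :=
  fun xi => cintegral_rV (fun x => f x * expi (- \sum_(j < d) x 0 j * xi 0 j)).

End Fourier.

Section Multiplier.
Context {R : realType} {d : nat}.
Local Notation S := (schwartz R d).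

Definition multiplier (m : 'rV[R]_d -> R[i]^o) (Theta : S -> S) : Prop :=
  [/\ csmooth m, linear Theta, continuous Theta
    & forall (f : S) xi, fourier (Theta f) xi = m xi * fourier f xi].

(* The multiplier with symbol m.  It is unique if it exists, since a Schwartz
   function is determined by its Fourier transform. *)
Definition multiplier_of (m : 'rV[R]_d -> R[i]^o) : S -> S :=
  if pselect (exists Theta, multiplier m Theta) is left h then sval (cid h)
  else id.

(* The extension to S' of the multiplier with symbol m.  Whenever the latter
   exists, so does Theta^* := multiplier_of (fun xi => m (- xi)): conjugate
   Theta by f |-> f (- _). *)
Definition multiplier_ext (m : 'rV[R]_d -> R[i]^o) (T : S -> R[i]^o) :
    S -> R[i]^o :=
  fun f => T (multiplier_of (fun xi => m (- xi)) f).

End Multiplier.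

(* Main.v *)
Require Import Defs.
From mathcomp Require Import all_boot all_order all_algebra.
From mathcomp Require Import complex.
From mathcomp Require Import all_classical all_reals all_analysis.
From mathcomp Require Import measurable_realfun zify ring lra.

Set Implicit Arguments.
Unset Strict Implicit.
Unset Printing Implicit Defensive.

Import Order.TTheory GRing.Theory Num.Theory.
Import numFieldNormedType.Exports.
Import Normc.

Local Open Scope classical_set_scope.
Local Open Scope ring_scope.
Local Open Scope complex_scope.

(* On the Fourier side, Theta^* is multiplication by m(- xi).  After dividing by
   powers of A and |A|, the T_k become uniformly bounded functionals tau_k with
   tau_k (p g) = tau_(k+1) g, where p (xi) = m (- xi) / |A|.  Put
   c = 4 p^2 / (1 + p^2)^2, so that 0 <= c <= 1.  Since 4 p^2 = c (1 + p^2)^2, the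
   sequence y_n (k) = tau_(2k) (c^n g) satisfies, E being the shift,
   E y_n = ((1 + E) / 2)^2 y_(n+1).  Hence y_0 is an average of length 2n of y_n,
   and y_n grows only polynomially in n because the derivatives of c^n do.  High
   order differences of such averages decay faster, so a difference of y_0 of some
   order vanishes; being bounded, y_0 is constant.  This gives
   A^2 T_2 = |A|^2 T_0, and T_+- = (T_0 +- (A / |A|) T_1) / 2 are eigenvectors of
   Theta for +-|A|.  If m omits the value |A| or -|A|, one can divide compactly
   supported functions by m (- xi) -+ |A| on the Fourier side, so the
   corresponding eigenvector is zero.

   Fourier inversion is proved one variable at a time: the transform composed with
   its inverse commutes with multiplication by the variable, so by Hadamard's
   lemma it is multiplication by a function, computed on the Gaussian. *)

(** * Directional derivatives and smooth functions *)

Section Lines.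
Context {R : realType}.

(** The function p may be unbounded and may vanish, so the powers of p give no uniform estimate in
    either direction. The function c is bounded by 1, with equality exactly where |m (- xi)| = |A|,
    so c^n g remains under control. It depends on p^2 alone and treats p = 1 and p = -1 alike; this
    is why period two is what comes out, and why two eigenvalues appear. If the bounding seminorm
    involves D derivatives, y_n grows like n^D. One difference of a 2n-fold average gains only
    n^(-1/2), the size of C(2n,n) / 4^n, so 2 (D + 1) differences are taken. The symbol is only
    known to be smooth. That multiplication by m (- xi) preserves Schwartz functions is read off
    from Theta through Fourier inversion; for 1 / (1 + p^2), and hence c, it follows from the
    product rule. Inversion also constructs Theta^*, which its definition merely selects among
    existing operators. Averages and differences are estimated for real sequences, so the
    functionals are replaced by the real and imaginary parts of their values on real functions of
    the frequency. *)

Lemma derive_lineE (V : normedModType R) (f : V -> R) (x v : V) (s : R) :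
  (fun h : R => h^-1 *: (((fun s : R => f (x + s *: v)) \o shift s) (h *: (1 : R)) -
      f (x + s *: v)))
  = (fun h => h^-1 *: ((f \o shift (x + s *: v)) (h *: v) - f (x + s *: v))).
Proof.
by apply/funext => h /=; rewrite [h *: 1]mulr1 scalerDl addrCA.
Qed.

(** The difference quotients of [f] along [v] and of its restriction to the line are the same
    function, so derivability and value transfer together. Directional derivatives are thereby
    reduced to calculus in one real variable. *)
Lemma is_derive_line (V : normedModType R) (f : V -> R) (x v : V) (s l : R) :
  is_derive (x + s *: v) v f l <->
  is_derive s (1 : R) (fun s : R => f (x + s *: v)) l.
Proof.
have e1 : derivable (fun s : R => f (x + s *: v)) s (1 : R) =
  derivable f (x + s *: v) v.
  exact: (congr1 (fun u => cvg (u @ 0^')) (derive_lineE f x v s)).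
have e2 : 'D_(1 : R) (fun s : R => f (x + s *: v)) s = 'D_v f (x + s *: v).
  exact: (congr1 (fun u => lim (u @ 0^')) (derive_lineE f x v s)).
split=> -[df <-]; split.
- by rewrite e1.
- exact: e2.
- by rewrite -e1.
- exact: esym e2.
Qed.

Lemma is_derive_line0 (V : normedModType R) (f : V -> R) (x v : V) (l : R) :
  is_derive x v f l <-> is_derive (0 : R) (1 : R) (fun s : R => f (x + s *: v)) l.
Proof. by rewrite -is_derive_line scale0r addr0. Qed.

Lemma lipschitz_continuousf (V W : normedModType R) (f : V -> W) (C : R) :
  (forall x y, `|f y - f x| <= C * `|y - x|) -> continuous f.
Proof.
move=> lip x; apply/cvgrPdist_lt => e e0.
have C0 : 0 < `|C| + 1 by rewrite ltr_wpDl.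
near=> y.
rewrite distrC; apply: le_lt_trans (lip x y) _.
apply: (@le_lt_trans _ _ ((`|C| + 1) * `|y - x|)).
  by apply: ler_wpM2r => //; apply: le_trans (ler_norm _) _; rewrite lerDl.
rewrite mulrC -ltr_pdivlMr // distrC.
near: y; apply/nbhs_normP.
by exists (e / (`|C| + 1)) => //=; exact: divr_gt0.
Unshelve. all: by end_near. Qed.

Lemma line_lipschitz (f df : R -> R) (B : R) (a b : R) :
  (forall s, is_derive s (1 : R) f (df s)) -> (forall s, `|df s| <= B) ->
  `|f b - f a| <= B * `|b - a|.
Proof.
move=> fD dfB.
have cf : continuous f.
  by move=> s; apply/differentiable_continuous/derivable1_diffP; case: (fD s).
wlog ab : a b / a <= b.
  move=> h; case: (leP a b) => [|/ltW] /h //.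
  by rewrite distrC (distrC a b).
have [c _ ->] := MVT_segment ab (fun s _ => fD s) (continuous_subspaceT cf).
by rewrite normrM ler_wpM2r.
Qed.

Lemma is_deriveMf (V : normedModType R) (f g : V -> R) (x v : V) (a b : R) :
  is_derive x v f a -> is_derive x v g b ->
  is_derive x v (fun x => f x * g x) (a * g x + f x * b).
Proof.
move=> hf hg; have := @is_deriveM _ _ f g x v a b hf hg.
rewrite (_ : f * g = fun x => f x * g x) // => h.
by apply: is_derive_eq; rewrite addrC /GRing.scale /= (mulrC a).
Qed.

Lemma is_deriveDf (V : normedModType R) (f g : V -> R) (x v : V) (a b : R) :
  is_derive x v f a -> is_derive x v g b ->
  is_derive x v (fun x => f x + g x) (a + b).
Proof. exact: is_deriveD. Qed.

Lemma is_deriveVf (V : normedModType R) (f : V -> R) (x v : V) (a : R) :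
  f x != 0 -> is_derive x v f a ->
  is_derive x v (fun x => (f x)^-1) (- a * (f x)^-1 ^+ 2).
Proof.
move=> f0 hf; have [df da] := hf.
split; first exact: derivableV.
have := @deriveV R V f x v f0 df; rewrite da => ->.
by rewrite /GRing.scale /= exprVn mulrC mulrN mulNr.
Qed.

Lemma is_derive_lin (V : normedModType R) (f g : V -> R) (x v : V) (a b r s : R) :
  is_derive x v f a -> is_derive x v g b ->
  is_derive x v (fun x => r * f x + s * g x) (r * a + s * b).
Proof.
move=> hf hg.
exact: (is_deriveDf (is_deriveZ (r : R) hf) (is_deriveZ (s : R) hg)).
Qed.

End Lines.

Section Coordinates.
Context {R : realType} {d : nat}.
Implicit Types (f g : 'rV[R]_d -> R) (x y : 'rV[R]_d) (i j : 'I_d).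

Definition evec i : 'rV[R]_d := delta_mx 0 i.

Definition pd i f : 'rV[R]_d -> R := fun x => 'D_(evec i) f x.

Definition upd x j (t : R) : 'rV[R]_d := \row_k (if k == j then t else x 0 k).

Lemma upd_line x j t s : upd x j t + s *: evec j = upd x j (t + s).
Proof.
apply/rowP => k; rewrite !mxE eqxx /=; case: eqP => _; rewrite ?mulr1 //.
by rewrite mulr0 addr0.
Qed.

Lemma upd_add x i j t s : i != j ->
  upd (x + s *: evec i) j t = upd x j t + s *: evec i.
Proof.
move=> ij; apply/rowP => k; rewrite !mxE eqxx /=.
by case: eqP => // ->; rewrite eq_sym (negbTE ij) mulr0 addr0.
Qed.

Lemma upd_add_same x j t s : upd (x + s *: evec j) j t = upd x j t.
Proof.
apply/rowP => k; rewrite !mxE eqxx /=; case: eqP => // _.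
by rewrite mulr0 addr0.
Qed.

Lemma upd_id x j : upd x j (x 0 j) = x.
Proof. by apply/rowP => k; rewrite !mxE; case: eqP => // ->. Qed.

Lemma updE x j t : upd x j t 0 j = t.
Proof. by rewrite mxE eqxx. Qed.

Lemma upd_upd x j t s : upd (upd x j t) j s = upd x j s.
Proof. by apply/rowP => k; rewrite !mxE; case: eqP. Qed.

Lemma coord_le x i : `|x 0 i| <= `|x|.
Proof. by rewrite {2}/Num.Def.normr /= mx_normrE (le_bigmax _ _ (0, i)). Qed.

Lemma norm_le_coord x (B : R) : 0 <= B -> (forall i, `|x 0 i| <= B) -> `|x| <= B.
Proof.
move=> B0 xB; rewrite {1}/Num.Def.normr /= mx_normrE.
by apply: bigmax_le => // -[i j] _ /=; rewrite (ord1 i).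
Qed.

Lemma norm_coord x : `|x| = 0 \/ exists i, `|x| = `|x 0 i|.
Proof.
have [->|x0] := eqVneq x 0; first by left; rewrite normr0.
right; apply/not_existsP => h.
suff : `|x| < `|x| by rewrite ltxx.
rewrite {1}/Num.Def.normr /= mx_normrE; apply: bigmax_lt.
  by rewrite normr_gt0.
move=> [i j] _ /=; rewrite (ord1 i) lt_neqAle coord_le andbT.
by apply/eqP => e; exact: (h j).
Qed.

Lemma partial_rcons s i f : partial (rcons s i) f = partial s (pd i f).
Proof. by rewrite /partial foldr_rcons. Qed.

Lemma partial_cons s i f : partial (i :: s) f = pd i (partial s f).
Proof. by []. Qed.

Lemma partial_cat s t f : partial (s ++ t) f = partial s (partial t f).
Proof. by rewrite /partial foldr_cat. Qed.

Lemma is_derive_upd f x i s l : is_derive (upd x i s) (evec i) f l ->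
  is_derive s (1 : R) (fun s => f (upd x i s)) l.
Proof.
have e u : upd x i 0 + u *: evec i = upd x i u by rewrite upd_line add0r.
have := (is_derive_line f (upd x i 0) (evec i) s l).1.
by rewrite e (funext (fun u => congr1 f (e u))).
Qed.

Definition pderivable f := forall i x, derivable f x (evec i).

(** The coordinates of [x] are changed into those of [y] one at a time, each change being a
    one-variable mean value estimate. This is the source of continuity, which [smooth] demands
    besides the existence of partial derivatives. *)
Lemma bounded_pd_lipschitz f (B : R) : pderivable f ->
  (forall i x, `|pd i f x| <= B) ->
  forall x y, `|f y - f x| <= (d%:R * B) * `|y - x|.
Proof.
move=> df dB.
have step x i t : `|f (upd x i t) - f x| <= B * `|t - x 0 i|.
  rewrite -{2}(upd_id x i).
  have h s : is_derive s (1 : R) (fun s => f (upd x i s)) (pd i f (upd x i s)).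
    by apply: is_derive_upd; apply: DeriveDef => //; exact: df.
  exact: (line_lipschitz _ _ h).
move=> x y.
(* The path from [x] to [y]: the first [k] coordinates are already those of [y]. *)
pose z k : 'rV[R]_d := \row_i (if (i < k)%N then y 0 i else x 0 i).
have z0 : z 0%N = x by apply/rowP => i; rewrite mxE ltn0.
have zd : z d = y by apply/rowP => i; rewrite mxE ltn_ord.
have main k : (k <= d)%N -> `|f (z k) - f x| <= (k%:R * B) * `|y - x|.
  elim: k => [_|k IH kd]; first by rewrite z0 subrr normr0 !mul0r.
  have -> : z k.+1 = upd (z k) (Ordinal kd) (y 0 (Ordinal kd)).
    apply/rowP => i; rewrite !mxE -val_eqE /= ltnS leq_eqVlt.
    case: eqP => //= ik.
    by congr (y 0 _); apply/val_inj.
  rewrite -(subrK (f (z k)) (f (upd _ _ _))) -addrA.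
  apply: (le_trans (ler_normD _ _)).
  rewrite -natr1 !mulrDl mul1r [leRHS]addrC.
  apply: lerD; last exact: IH (ltnW kd).
  apply: (le_trans (step _ _ _)).
  have B0 : 0 <= B by exact: le_trans (normr_ge0 _) (dB (Ordinal kd) x).
  apply: ler_wpM2l => //.
  by have := coord_le (y - x) (Ordinal kd); rewrite !mxE ltnn.
by have := main d (leqnn d); rewrite zd.
Qed.

Lemma bounded_pd_continuous f (B : R) : pderivable f ->
  (forall i x, `|pd i f x| <= B) -> continuous f.
Proof.
by move=> df dB; apply: lipschitz_continuousf; exact: bounded_pd_lipschitz dB.
Qed.

(** A coinduction principle: smoothness of a function is proved by exhibiting a class that contains
    it and is stable under partial derivatives, without a formula for the iterated derivatives. *)
Definition iter_closed (Q : ('rV[R]_d -> R) -> Prop) :=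
  forall f, Q f -> [/\ continuous f, pderivable f & forall i, Q (pd i f)].

Lemma smooth_coind Q f : iter_closed Q -> Q f -> smooth f.
Proof.
move=> Qc Qf.
have Qs s : Q (partial s f).
  by elim: s => [//|i s IH]; have [_ _ h] := Qc _ IH; exact: h.
by move=> s; case: (Qc _ (Qs s)) => cf df _; split => // i x; exact: df.
Qed.

Lemma smooth_pd f i : smooth f -> smooth (pd i f).
Proof. by move=> sf s; rewrite -partial_rcons; exact: sf. Qed.

Lemma smooth_partial f s : smooth f -> smooth (partial s f).
Proof. by move=> sf t; rewrite -partial_cat; exact: sf. Qed.

Lemma smooth_continuous f : smooth f -> continuous f.
Proof. by move=> /(_ [::]) []. Qed.

Lemma smooth_derivable f : smooth f -> pderivable f.
Proof. by move=> /(_ [::]) [_ h] i x; exact: h. Qed.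

Lemma smooth_closed : iter_closed (@smooth R d).
Proof.
move=> f sf; split; first exact: smooth_continuous.
  exact: smooth_derivable.
by move=> i; exact: smooth_pd.
Qed.

Lemma is_derive_pd f i x : pderivable f -> is_derive x (evec i) f (pd i f x).
Proof. by move=> df; apply: DeriveDef => //; exact: df. Qed.

Lemma pdE f i (df : 'rV[R]_d -> R) :
  (forall x, is_derive x (evec i) f (df x)) -> pd i f = df.
Proof. by move=> h; apply/funext => x; case: (h x). Qed.

End Coordinates.

Lemma continuous_mul {R : realType} (T : topologicalType) (f g : T -> R) :
  continuous f -> continuous g -> continuous (fun x => f x * g x).
Proof. by move=> cf cg x; exact: (cvgM (cf x) (cg x)). Qed.

Lemma is_derive_exp {R : realType} (V : normedModType R) (f : V -> R)
    (x v : V) (a : R) n :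
  is_derive x v f a ->
  is_derive x v (fun x => f x ^+ n) (n%:R * f x ^+ n.-1 * a).
Proof.
move=> hf; elim: n => [|n IH].
  rewrite (_ : (fun x => f x ^+ 0) = cst 1) // !mul0r; exact: is_derive_cst.
rewrite (_ : (fun x => f x ^+ n.+1) = (fun x => f x * f x ^+ n)); last first.
  by apply/funext => y; rewrite exprS.
have h := is_deriveMf hf IH.
apply: is_derive_eq; case: n {IH h} => [|n] /=; first by rewrite !expr0; ring.
by rewrite -(natr1 n.+1) exprS; ring.
Qed.

Section SmoothAlgebra.
Context {R : realType} {d : nat}.
Implicit Types (f g h : 'rV[R]_d -> R) (x : 'rV[R]_d) (i j : 'I_d).

Lemma pd_mul i f g : pderivable f -> pderivable g ->
  pd i (fun x => f x * g x) = (fun x => pd i f x * g x + f x * pd i g x).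
Proof.
move=> df dg; apply: pdE => x.
exact: is_deriveMf (is_derive_pd i x df) (is_derive_pd i x dg).
Qed.

Lemma pd_lin i (a b : R) f g : pderivable f -> pderivable g ->
  pd i (fun x => a * f x + b * g x) = (fun x => a * pd i f x + b * pd i g x).
Proof.
move=> df dg; apply: pdE => x.
exact: is_derive_lin (is_derive_pd i x df) (is_derive_pd i x dg).
Qed.

Lemma partial_add s f g : smooth f -> smooth g ->
  partial s (fun x => f x + g x) = (fun x => partial s f x + partial s g x).
Proof.
move=> sf sg; have := partial_lin s 1 1 sf sg.
by rewrite (_ : (fun x => 1 * f x + 1 * g x) = (fun x => f x + g x));
  [move=> ->|]; apply/funext => x; rewrite !mul1r.
Qed.

Lemma smooth_add f g : smooth f -> smooth g -> smooth (fun x => f x + g x).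
Proof.
move=> sf sg; have := smooth_lin 1 1 sf sg.
by congr smooth; apply/funext => x; rewrite !mul1r.
Qed.

Lemma pderivable_mul f g : pderivable f -> pderivable g ->
  pderivable (fun x => f x * g x).
Proof.
move=> df dg i x.
by case: (is_deriveMf (is_derive_pd i x df) (is_derive_pd i x dg)).
Qed.

(** The least class containing the products and absorbing the two terms of the product rule. *)
Inductive prodspan : ('rV[R]_d -> R) -> Prop :=
| Prodspan1 f g : smooth f -> smooth g -> prodspan (fun x => f x * g x)
| ProdspanD f g : prodspan f -> prodspan g -> prodspan (fun x => f x + g x).

Lemma prodspan_closed : iter_closed prodspan.
Proof.
move=> f; elim=> {f} [f g sf sg|f g _ [cf df pf] _ [cg dg pg]].
- have [cf df _] := smooth_closed sf; have [cg dg _] := smooth_closed sg.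
  split; [exact: continuous_mul|exact: pderivable_mul|move=> i].
  rewrite pd_mul //;
  exact: (ProdspanD (Prodspan1 (smooth_pd i sf) sg) (Prodspan1 sf (smooth_pd i sg))).
- split.
  + by move=> x; exact: (cvgD (cf x) (cg x)).
  + by move=> i x; apply: derivableD; [exact: df|exact: dg].
  + move=> i.
    have -> : pd i (fun x => f x + g x) = (fun x => pd i f x + pd i g x).
      apply: pdE => x.
      exact: is_deriveDf (is_derive_pd i x df) (is_derive_pd i x dg).
    exact: ProdspanD.
Qed.

Lemma smooth_mul f g : smooth f -> smooth g -> smooth (fun x => f x * g x).
Proof.
by move=> sf sg; apply: (smooth_coind prodspan_closed); exact: Prodspan1.
Qed.

Lemma pd_cst i (c : R) : pd i (fun _ : 'rV[R]_d => c) = (fun=> 0).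
Proof. by apply: pdE => x; exact: is_derive_cst. Qed.

Lemma smooth_cst (c : R) : smooth (fun _ : 'rV[R]_d => c).
Proof.
apply: (@smooth_coind _ _ (fun f => exists c, f = fun=> c)); last by exists c.
move=> _ [{}c ->]; split; first exact: cst_continuous.
  by move=> i x; exact: derivable_cst.
by move=> i; rewrite pd_cst; exists 0.
Qed.

Lemma smooth_scale (c : R) f : smooth f -> smooth (fun x => c * f x).
Proof. by move=> sf; exact: (smooth_mul (smooth_cst c) sf). Qed.

Lemma partial_scale s (c : R) f : smooth f ->
  partial s (fun x => c * f x) = (fun x => c * partial s f x).
Proof.
move=> sf; have := partial_lin s c 0 sf sf.
rewrite (_ : (fun x => c * f x + 0 * f x) = (fun x => c * f x)).
  by move=> ->; apply/funext => x; rewrite mul0r addr0.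
by apply/funext => x; rewrite mul0r addr0.
Qed.

Lemma smooth_exp f n : smooth f -> smooth (fun x => f x ^+ n).
Proof.
move=> sf; elim: n => [|n IH]; first exact: smooth_cst.
rewrite (_ : (fun x => f x ^+ n.+1) = (fun x => f x * f x ^+ n)).
  exact: smooth_mul.
by apply/funext => x; rewrite exprS.
Qed.

Lemma smooth_sum (I : Type) (r : seq I) (F : I -> 'rV[R]_d -> R) :
  (forall k, smooth (F k)) -> smooth (fun x => \sum_(i <- r) F i x).
Proof.
move=> sF; elim: r => [|i r IH].
  by under eq_fun do rewrite big_nil; exact: smooth_cst.
by under eq_fun do rewrite big_cons; exact: (smooth_add (sF i) IH).
Qed.

Lemma smooth_prod (I : Type) (r : seq I) (F : I -> 'rV[R]_d -> R) :
  (forall k, smooth (F k)) -> smooth (fun x => \prod_(i <- r) F i x).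
Proof.
move=> sF; elim: r => [|i r IH].
  by under eq_fun do rewrite big_nil; exact: smooth_cst.
by under eq_fun do rewrite big_cons; exact: (smooth_mul (sF i) IH).
Qed.

(** The quotients of a smooth [g] by powers of [h] form a class stable under partial derivatives:
    the derivative of [g / h ^ k] has numerator [g' h - k g h'] over [h ^ (k + 1)]. *)
Lemma smooth_inv h : smooth h -> (forall x, h x != 0) ->
  smooth (fun x => (h x)^-1).
Proof.
move=> sh h0.
apply: (@smooth_coind _ _ (fun u => exists g k,
    smooth g /\ u = fun x => g x * (h x)^-1 ^+ k)); last first.
  exists (fun=> 1), 1%N; split; first exact: smooth_cst.
  by apply/funext => x; rewrite mul1r expr1.
move=> _ [g [k [sg ->]]].
have [ch dh _] := smooth_closed sh; have [cg dg _] := smooth_closed sg.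
have Dk i x : is_derive x (evec i) (fun x => g x * (h x)^-1 ^+ k)
    (pd i g x * (h x)^-1 ^+ k +
     g x * (k%:R * (h x)^-1 ^+ k.-1 * (- pd i h x * (h x)^-1 ^+ 2))).
  apply: is_deriveMf; first exact: is_derive_pd.
  by apply: is_derive_exp; apply: is_deriveVf => //; exact: is_derive_pd.
split.
- have cV : continuous (fun x => (h x)^-1) by move=> x; exact: (cvgV (h0 x) (ch x)).
  have cX : continuous (fun x => (h x)^-1 ^+ k).
    elim: k {Dk} => [|k IH]; first exact: cst_continuous.
    rewrite (_ : (fun x => (h x)^-1 ^+ k.+1) = (fun x => (h x)^-1 * (h x)^-1 ^+ k)).
      exact: continuous_mul.
    by apply/funext => x; rewrite exprS.
  exact: continuous_mul.
- by move=> i x; case: (Dk i x).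
- move=> i; rewrite (pdE (Dk i)).
  exists (fun x => pd i g x * h x + (- k%:R) * (g x * pd i h x)), k.+1; split.
    have sgi := smooth_pd i sg; have shi := smooth_pd i sh.
    by apply: smooth_add; [exact: smooth_mul|
      apply: smooth_scale; exact: smooth_mul].
  apply/funext => x; case: k {Dk} => [|k] /=.
    by field; exact: h0.
  have hx := h0 x; rewrite !exprS.
  by field; exact: hx.
Qed.

(** [Phi n] plays the n-th derivative of a function of one variable and [l] is affine with slopes
    [a i], so each partial derivative only advances the index and multiplies by a constant. *)
Lemma smooth_comp1 (Phi : nat -> R -> R) (l : 'rV[R]_d -> R) (a : 'I_d -> R) n :
  (forall n t, is_derive t (1 : R) (Phi n) (Phi n.+1 t)) ->
  (forall x i s, l (x + s *: evec i) = l x + s * a i) -> continuous l ->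
  smooth (Phi n \o l) /\
  forall s, exists c, partial s (Phi n \o l) = fun x => c * Phi (n + size s)%N (l x).
Proof.
move=> PhiD ll cl.
have Dn n' i x : is_derive x (evec i) (Phi n' \o l) (a i * Phi n'.+1 (l x)).
  apply/is_derive_line0.
  have -> : (fun s => (Phi n' \o l) (x + s *: evec i)) =
      Phi n' \o (fun s => l x + s * a i).
    by apply/funext => s /=; rewrite ll.
  have h1 : is_derive (0 : R) (1 : R) (fun s => l x + s * a i) (a i).
    have h := is_deriveD (is_derive_cst (l x) (0:R) (1:R))
      (is_deriveM (is_derive_id (0:R) (1:R)) (is_derive_cst (a i) (0:R) (1:R))).
    apply: is_derive_eq; rewrite scaler0 !add0r.
    by rewrite [_ *: _]mulr1.
  have h2 : is_derive (l x + 0 * a i) (1 : R) (Phi n') (Phi n'.+1 (l x)).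
    by rewrite mul0r addr0.
  have h := @is_derive1_comp R (Phi n') (fun s => l x + s * a i) 0 _ _ h2 h1.
  by apply: is_derive_eq; rewrite mulrC.
have cP n' : continuous (Phi n').
  by move=> t; apply/differentiable_continuous/derivable1_diffP;
    case: (PhiD n' t).
have cc n' : continuous (Phi n' \o l).
  by move=> x; apply: continuous_comp; [exact: cl|exact: cP].
have sm n' : smooth (Phi n' \o l).
  apply: (@smooth_coind _ _ (fun u => exists c n', u = fun x => c * Phi n' (l x)));
    last by exists 1, n'; apply/funext => x; rewrite mul1r.
  move=> _ [c [m ->]].
  have Dc i x : is_derive x (evec i) (fun x => c * Phi m (l x))
      (c * (a i * Phi m.+1 (l x))).
    exact: (is_deriveZ (c : R) (Dn m i x)).
  split.
  - by apply: continuous_mul; [exact: cst_continuous|exact: cc].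
  - by move=> i x; case: (Dc i x).
  - move=> i; exists (c * a i), m.+1; rewrite (pdE (Dc i)).
    by apply/funext => x; rewrite mulrA.
split => // s; elim: s => [|i s [c IH]].
  by exists 1; apply/funext => x; rewrite mul1r addn0.
exists (c * a i); rewrite partial_cons IH /=.
have Dc x : is_derive x (evec i) (fun x => c * Phi (n + size s)%N (l x))
    (c * (a i * Phi (n + size s).+1 (l x))).
  exact: (is_deriveZ (c : R) (Dn _ i x)).
by rewrite (pdE Dc) addnS; apply/funext => x; rewrite mulrA.
Qed.

End SmoothAlgebra.

Section Affine.
Context {R : realType} {d D : nat}.

(* Slices, reflections and dilations are all instances of such maps. *)
Definition coord_affine (iota : 'rV[R]_d -> 'rV[R]_D) (sg : 'I_d -> 'I_D)
    (e : R) :=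
  forall x i s, iota (x + s *: evec i) = iota x + (e * s) *: evec (sg i).

Lemma coord_affine_pd iota sg e (f : 'rV[R]_D -> R) i :
  coord_affine iota sg e -> pderivable f ->
  forall x, is_derive x (evec i) (f \o iota) (e * pd (sg i) f (iota x)).
Proof.
move=> ai df x; apply/is_derive_line0.
have -> : (fun s => (f \o iota) (x + s *: evec i)) =
    (fun u => f (iota x + u *: evec (sg i))) \o (fun s => e * s).
  by apply/funext => s /=; rewrite ai.
have h1 : is_derive (0 : R) (1 : R) (fun s : R => e * s) e.
  have h := is_deriveM (is_derive_cst e (0:R) (1:R)) (is_derive_id (0:R) (1:R)).
  by apply: is_derive_eq; rewrite scaler0 addr0 [_ *: _]mulr1.
have h2 : is_derive (e * 0) (1 : R) (fun u => f (iota x + u *: evec (sg i)))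
    (pd (sg i) f (iota x)).
  rewrite mulr0.
  exact: ((is_derive_line0 f (iota x) (evec (sg i)) _).1 (is_derive_pd _ _ df)).
have h := @is_derive1_comp R (fun u => f (iota x + u *: evec (sg i)))
  (fun s => e * s) 0 _ _ h2 h1.
by apply: is_derive_eq; rewrite mulrC.
Qed.

Lemma coord_affine_continuous iota sg e :
  coord_affine iota sg e -> continuous iota.
Proof.
move=> ai.
have sumE x (s : 'I_d -> R) (r : seq 'I_d) :
    iota (x + \sum_(i <- r) s i *: evec i) =
    iota x + \sum_(i <- r) (e * s i) *: evec (sg i).
  elim: r => [|i r IH]; first by rewrite !big_nil !addr0.
  by rewrite !big_cons addrCA addrC ai IH addrC addrCA.
apply: (@lipschitz_continuousf _ _ _ _ (d%:R * `|e|)) => x y.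
have -> : y = x + \sum_i (y - x) 0 i *: evec i.
  by rewrite -row_sum_delta addrC subrK.
rewrite sumE [_ - iota x]addrAC subrr add0r [in leRHS]addrAC subrr add0r.
rewrite -row_sum_delta.
apply: (le_trans (ler_norm_sum _ _ _)).
have -> : d%:R * `|e| * `|y - x| = \sum_(i < d) (`|e| * `|y - x|).
  by rewrite sumr_const card_ord -mulrA mulr_natl.
apply: ler_sum => i _.
rewrite normrZ normrM -[leRHS]mulr1; apply: ler_pM => //.
  by apply: ler_wpM2l => //; exact: coord_le.
apply: norm_le_coord => // j; rewrite mxE /=.
by case: (_ == _); rewrite ?normr1 ?normr0.
Qed.

Lemma smooth_affine iota sg e (f : 'rV[R]_D -> R) :
  coord_affine iota sg e -> smooth f ->
  smooth (f \o iota) /\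
  forall s, partial s (f \o iota) =
    fun x => e ^+ size s * partial (map sg s) f (iota x).
Proof.
move=> ai sf.
have ci := coord_affine_continuous ai.
pose Q (u : 'rV[R]_d -> R) := exists c g, smooth g /\ u = fun x => c * g (iota x).
have Dg c g i : smooth g -> forall x, is_derive x (evec i)
    (fun x => c * g (iota x)) (c * (e * pd (sg i) g (iota x))).
  move=> sg' x.
  exact: (is_deriveZ (c : R) (coord_affine_pd i ai (smooth_derivable sg') x)).
split.
  apply: (@smooth_coind _ _ Q); last first.
    by exists 1, f; split => //; apply/funext => x; rewrite mul1r.
  move=> _ [c [g [sg' ->]]]; split.
  - apply: continuous_mul; first exact: cst_continuous.
    move=> x; apply: (@continuous_comp _ _ _ iota g); first exact: ci.
    exact: smooth_continuous.
  - by move=> i x; case: (Dg c g i sg' x).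
  - move=> i; exists (c * e), (pd (sg i) g); split; first exact: smooth_pd.
    by rewrite (pdE (Dg c g i sg')); apply/funext => x; rewrite mulrA.
elim=> [|i s IH]; first by apply/funext => x; rewrite mul1r.
rewrite partial_cons IH (pdE (Dg _ _ i (smooth_partial _ sf))).
by apply/funext => x; rewrite /= exprS mulrA [e * _]mulrC.
Qed.

End Affine.

(** * Real Schwartz functions *)

Section RealSchwartz.
Context {R : realType} {d : nat}.
Implicit Types (f g h : 'rV[R]_d -> R) (x : 'rV[R]_d) (i j : 'I_d).

Definition wt (N : nat) x : R := (1 + `|x|) ^+ N.

Lemma wt_ge1 N x : 1 <= wt N x.
Proof. by rewrite /wt exprn_ege1 // lerDl. Qed.

Lemma wt_gt0 N x : 0 < wt N x.
Proof. exact: lt_le_trans (wt_ge1 N x). Qed.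

Lemma wt_ge0 N x : 0 <= wt N x.
Proof. exact: ltW (wt_gt0 N x). Qed.

Lemma wtD N N' x : wt (N + N') x = wt N x * wt N' x.
Proof. by rewrite /wt exprD. Qed.

Lemma wt_le N N' x : (N <= N')%N -> wt N x <= wt N' x.
Proof. by move=> NN; apply: ler_weXn2l => //; rewrite lerDl. Qed.

Lemma wtS N x : wt N.+1 x = (1 + `|x|) * wt N x.
Proof. by rewrite /wt exprS. Qed.

(** Explicit bounds replace the seminorms given by suprema: they can be added, scaled and chained
    directly. *)
Definition bnd (n N : nat) (B : R) f :=
  forall s, (size s <= n)%N -> forall x, wt N x * `|partial s f x| <= B.

Definition rschwartz f := smooth f /\ forall n N, exists B, bnd n N B f.

Lemma bnd_ge0 n N B f : bnd n N B f -> 0 <= B.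
Proof.
by move=> /(_ [::] isT 0); apply: le_trans; rewrite mulr_ge0 // wt_ge0.
Qed.

Lemma bnd_mono n N B n' N' B' f : (n' <= n)%N -> (N' <= N)%N -> B <= B' ->
  bnd n N B f -> bnd n' N' B' f.
Proof.
move=> nn NN BB h s ss x.
apply: le_trans (le_trans (h s (leq_trans ss nn) x) BB).
by rewrite ler_wpM2r // wt_le.
Qed.

Lemma bnd_pd n N B f i : bnd n.+1 N B f -> bnd n N B (pd i f).
Proof. by move=> h s ss x; rewrite -partial_rcons; apply: h; rewrite size_rcons. Qed.

Lemma bnd0 N B f : (forall x, wt N x * `|f x| <= B) -> bnd 0 N B f.
Proof. by move=> h [|//] _ x; exact: h. Qed.

(** The list is peeled from its last entry, the derivative taken first, so that an induction on the
    order passes from [f] to [pd i f]. *)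
Lemma bndS n N B f : bnd 0 N B f -> (forall i, bnd n N B (pd i f)) ->
  bnd n.+1 N B f.
Proof.
move=> h0 hi s; case/lastP: s => [_|s i]; first exact: (h0 [::]).
by rewrite size_rcons ltnS partial_rcons => ss; exact: hi.
Qed.

Lemma bnd_unif n N (B : 'I_d -> R) B0 f : bnd 0 N B0 f ->
  (forall i, bnd n N (B i) (pd i f)) -> bnd n.+1 N (B0 + \sum_i B i) f.
Proof.
move=> h0 hi.
have Bi0 i : 0 <= B i by exact: bnd_ge0 (hi i).
have B00 := bnd_ge0 h0.
apply: bndS; first by apply: (bnd_mono _ _ _ h0) => //; rewrite lerDl sumr_ge0.
move=> i; apply: (bnd_mono _ _ _ (hi i)) => //.
by rewrite (bigD1 i) //= addrCA lerDl addr_ge0 // sumr_ge0.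
Qed.

Lemma bnd_add n N B B' f g : smooth f -> smooth g -> bnd n N B f ->
  bnd n N B' g -> bnd n N (B + B') (fun x => f x + g x).
Proof.
move=> sf sg hf hg s ss x; rewrite partial_add //.
apply: le_trans (lerD (hf s ss x) (hg s ss x)).
by rewrite -mulrDr; apply: ler_wpM2l; [exact: wt_ge0|exact: ler_normD].
Qed.

Lemma bnd_scale n N B (c : R) f : smooth f -> bnd n N B f ->
  bnd n N (`|c| * B) (fun x => c * f x).
Proof.
move=> sf hf s ss x; rewrite partial_scale // normrM mulrCA.
by apply: ler_wpM2l => //; exact: hf.
Qed.

Lemma rschwartzP f : smooth f ->
  (forall s N, exists B, forall x, wt N x * `|partial s f x| <= B) ->
  rschwartz f.
Proof.
move=> sf h; split => // n N.
elim: n f sf h => [|n IH] f sf h.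
  by have [B hB] := h [::] N; exists B; exact: bnd0.
have [B0 hB0] := h [::] N.
have /choice[B hB] : forall i, exists B, bnd n N B (pd i f).
  move=> i; apply: IH; first exact: smooth_pd.
  by move=> s M; rewrite -partial_rcons; exact: h.
have Bi0 i : 0 <= B i by exact: bnd_ge0 (hB i).
have B00 : 0 <= B0 by apply: le_trans (hB0 0); rewrite mulr_ge0 // wt_ge0.
exists (B0 + \sum_i B i); apply: bndS.
  apply: bnd0 => x; apply: (le_trans (hB0 x)).
  by rewrite lerDl sumr_ge0.
move=> i; apply: bnd_mono (hB i) => //.
by rewrite (bigD1 i) //= addrCA lerDl addr_ge0 // sumr_ge0.
Qed.

Lemma rschwartz_bnd f n N : rschwartz f -> exists B, bnd n N B f.
Proof. by move=> [_]; exact. Qed.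

Lemma rschwartz_pd i f : rschwartz f -> rschwartz (pd i f).
Proof.
move=> [sf hf]; split; first exact: smooth_pd.
by move=> n N; have [B hB] := hf n.+1 N; exists B; exact: bnd_pd.
Qed.

Lemma rschwartz_add f g : rschwartz f -> rschwartz g ->
  rschwartz (fun x => f x + g x).
Proof.
move=> [sf hf] [sg hg]; split; first exact: smooth_add.
move=> n N; have [B hB] := hf n N; have [C hC] := hg n N.
by exists (B + C); exact: bnd_add.
Qed.

Lemma rschwartz_scale (c : R) f : rschwartz f -> rschwartz (fun x => c * f x).
Proof.
move=> [sf hf]; split; first exact: smooth_scale.
by move=> n N; have [B hB] := hf n N; exists (`|c| * B); exact: bnd_scale.
Qed.

Lemma rschwartz0 : rschwartz (fun _ : 'rV[R]_d => 0).
Proof.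
have p0 s : @partial R d s (fun=> 0) = (fun=> 0).
  by elim: s => [//|i s IH]; rewrite partial_cons IH pd_cst.
apply: rschwartzP; first exact: smooth_cst.
by move=> s N; exists 0 => x; rewrite p0 normr0 mulr0.
Qed.

(** The slowly increasing smooth functions, classical multipliers of the Schwartz space. *)
Definition moderate h := smooth h /\
  forall s, exists M C, forall x, `|partial s h x| <= C * wt M x.

Lemma moderate_pd h i : moderate h -> moderate (pd i h).
Proof.
move=> [sh hh]; split; first exact: smooth_pd.
by move=> s; rewrite -partial_rcons; exact: hh.
Qed.

(** The orders and the constant are chosen before [f]: this is continuity of multiplication by [h],
    not only stability of the Schwartz space. *)
Lemma bnd_mul h : moderate h -> forall n N, exists n' N' C, 0 <= C /\
  forall f B, smooth f -> bnd n' N' B f -> bnd n N (C * B) (fun x => f x * h x).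
Proof.
move=> mh n; elim: n h mh => [|n IH] h mh N.
  have [M [C hC]] := mh.2 [::].
  exists 0%N, (N + M)%N, `|C|; split => // f B sf hf.
  apply: bnd0 => x; rewrite normrM mulrA.
  apply: (@le_trans _ _ (wt N x * `|f x| * (`|C| * wt M x))).
    apply: ler_wpM2l; first by rewrite mulr_ge0 // wt_ge0.
    apply: (le_trans (hC x)); apply: ler_wpM2r; first exact: wt_ge0.
    exact: ler_norm.
  rewrite mulrCA [_ * wt M x]mulrAC -wtD; apply: ler_wpM2l => //.
  exact: (hf [::]).
have sh := mh.1.
have [n1 [N1 [C1 [C10 h1]]]] := IH h mh N.
have /choice[D hD] : forall i, exists D : nat * nat * R, 0 <= D.2 /\
    forall f B, smooth f -> bnd D.1.1 D.1.2 B f ->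
      bnd n N (D.2 * B) (fun x => f x * pd i h x).
  move=> i; have [n' [N' [C h']]] := IH _ (moderate_pd i mh) N.
  by exists (n', N', C).
pose n2 := (\max_i (D i).1.1)%N; pose N2 := (\max_i (D i).1.2)%N.
pose C2 := \sum_i (D i).2.
exists (maxn n1.+1 n2), (maxn N1 N2), (C1 + C2).
have C20 : 0 <= C2 by apply: sumr_ge0 => i _; case: (hD i).
split; first exact: addr_ge0.
move=> f B sf hf; have B0 := bnd_ge0 hf.
have hf1 : bnd n1.+1 N1 B f by apply: bnd_mono hf; rewrite ?leq_maxl.
have hfi i : bnd (D i).1.1 (D i).1.2 B f.
  apply: bnd_mono hf => //; rewrite leq_max; apply/orP; right.
    exact: (@leq_bigmax _ (fun i => (D i).1.1) i).
  exact: (@leq_bigmax _ (fun i => (D i).1.2) i).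
apply: bndS.
  apply: (bnd_mono _ _ _ (h1 f B sf _)) => //.
    by apply: ler_wpM2r => //; rewrite lerDl.
  exact: bnd_mono hf1.
move=> i; rewrite pd_mul; [|exact: smooth_derivable..].
apply: (bnd_mono (n:=n) (N:=N) (B:=C1 * B + (D i).2 * B)) => //.
  rewrite -mulrDl; apply: ler_wpM2r => //; apply: lerD => //.
  rewrite /C2 (bigD1 i) //= lerDl; apply: sumr_ge0 => k _.
  by case: (hD k).
have spf := smooth_pd i sf; have sph := smooth_pd i sh.
apply: (bnd_add (smooth_mul spf sh) (smooth_mul sf sph)).
- exact: (h1 _ _ spf (bnd_pd i hf1)).
- exact: ((hD i).2 _ _ sf (hfi i)).
Qed.

Lemma rschwartz_mul f h : rschwartz f -> moderate h ->
  rschwartz (fun x => f x * h x).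
Proof.
move=> [sf hf] mh; split; first exact: (smooth_mul sf mh.1).
move=> n N; have [n' [N' [C [_ hC]]]] := bnd_mul mh n N.
by have [B hB] := hf n' N'; exists (C * B); exact: hC.
Qed.

Lemma is_derive_coord x i j :
  is_derive x (evec i) (fun x => x 0 j) ((i == j)%:R : R).
Proof.
apply/is_derive_line0.
have -> : (fun s : R => (x + s *: evec i) 0 j) = (fun s => x 0 j + s * (i == j)%:R).
  by apply/funext => s; rewrite !mxE eqxx /= eq_sym.
have h := is_deriveD (is_derive_cst (x 0 j) (0:R) (1:R))
  (is_deriveM (is_derive_id (0:R) (1:R)) (is_derive_cst ((i == j)%:R : R) (0:R) (1:R))).
by apply: is_derive_eq; rewrite scaler0 !add0r [_ *: _]mulr1.
Qed.

Lemma pd_coord i j : pd i (fun x => x 0 j) = (fun=> (i == j)%:R).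
Proof. by apply: pdE => x; exact: is_derive_coord. Qed.

Lemma coord_continuous_pt j : continuous (fun x : 'rV[R]_d => x 0 j).
Proof.
apply: (@bounded_pd_continuous _ _ _ 1).
  by move=> i x; case: (is_derive_coord x i j).
by move=> i x; rewrite pd_coord; case: eqP; rewrite ?normr1 ?normr0.
Qed.

Lemma smooth_coord j : smooth (fun x : 'rV[R]_d => x 0 j).
Proof.
apply: (@smooth_coind _ _ (fun f => f = (fun x => x 0 j) \/ smooth f));
  last by left.
move=> f [->|sf]; last first.
  have [cf df pf] := smooth_closed sf; split => // i.
  by right; exact: pf.
split; first exact: coord_continuous_pt.
  by move=> i x; case: (is_derive_coord x i j).
by move=> i; right; rewrite pd_coord; exact: smooth_cst.
Qed.

Lemma partial_cst0 s (c : R) : s != [::] ->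
  partial s (fun _ : 'rV[R]_d => c) = (fun=> 0).
Proof.
case/lastP: s => // s i _; rewrite partial_rcons pd_cst.
by elim: s => [//|k s IH]; rewrite partial_cons IH pd_cst.
Qed.

Lemma moderate_cst (c : R) : moderate (fun _ : 'rV[R]_d => c).
Proof.
split; first exact: smooth_cst.
move=> s; exists 0%N, `|c| => x; rewrite /wt expr0 mulr1.
by have [->//|s0] := eqVneq s [::]; rewrite partial_cst0 // normr0.
Qed.

Lemma moderate_coord j : moderate (fun x : 'rV[R]_d => x 0 j).
Proof.
split; first exact: smooth_coord.
case/lastP => [|s i].
  exists 1%N, 1 => x; rewrite /wt expr1 mul1r.
  by apply: (le_trans (coord_le x j)); rewrite lerDr.
by rewrite partial_rcons pd_coord; case: (moderate_cst (i == j)%:R).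
Qed.

Lemma rschwartz_coord f j : rschwartz f -> rschwartz (fun x => x 0 j * f x).
Proof.
move=> rf; have := rschwartz_mul rf (moderate_coord j).
by congr rschwartz; apply/funext => x; rewrite mulrC.
Qed.

Lemma moderate_add h h' : moderate h -> moderate h' ->
  moderate (fun x => h x + h' x).
Proof.
move=> [sh mh] [sh' mh']; split; first exact: smooth_add.
move=> s; have [M [C hC]] := mh s; have [M' [C' hC']] := mh' s.
exists (maxn M M'), (`|C| + `|C'|) => x; rewrite partial_add //.
apply: (le_trans (ler_normD _ _)); rewrite mulrDl; apply: lerD.
  apply: (le_trans (hC x)); apply: (@le_trans _ _ (`|C| * wt M x)).
    by apply: ler_wpM2r; [exact: wt_ge0|exact: ler_norm].
  by apply: ler_wpM2l => //; apply: wt_le; rewrite leq_maxl.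
apply: (le_trans (hC' x)); apply: (@le_trans _ _ (`|C'| * wt M' x)).
  by apply: ler_wpM2r; [exact: wt_ge0|exact: ler_norm].
by apply: ler_wpM2l => //; apply: wt_le; rewrite leq_maxr.
Qed.

Lemma moderate_mul h h' : moderate h -> moderate h' ->
  moderate (fun x => h x * h' x).
Proof.
move=> mh mh'; split; first exact: (smooth_mul mh.1 mh'.1).
move=> s; elim/last_ind: s h h' mh mh' => [|s i IH] h h' mh mh'.
  have [M [C hC]] := mh.2 [::]; have [M' [C' hC']] := mh'.2 [::].
  exists (M + M')%N, (C * C') => x.
  by rewrite normrM wtD mulrACA; apply: ler_pM; [| |exact: hC|exact: hC'].
have mhi := moderate_pd i mh; have mhi' := moderate_pd i mh'.
have [M [C hC]] := IH _ _ mhi mh'; have [M' [C' hC']] := IH _ _ mh mhi'.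
exists (maxn M M'), (`|C| + `|C'|) => x.
rewrite partial_rcons pd_mul; [|exact: smooth_derivable mh.1|exact: smooth_derivable mh'.1].
rewrite (partial_add _ (smooth_mul mhi.1 mh'.1) (smooth_mul mh.1 mhi'.1)).
apply: (le_trans (ler_normD _ _)); rewrite mulrDl; apply: lerD.
  apply: (le_trans (hC x)); apply: (@le_trans _ _ (`|C| * wt M x)).
    by apply: ler_wpM2r; [exact: wt_ge0|exact: ler_norm].
  by apply: ler_wpM2l => //; apply: wt_le; rewrite leq_maxl.
apply: (le_trans (hC' x)); apply: (@le_trans _ _ (`|C'| * wt M' x)).
  by apply: ler_wpM2r; [exact: wt_ge0|exact: ler_norm].
by apply: ler_wpM2l => //; apply: wt_le; rewrite leq_maxr.
Qed.

(** For the maximum norm the weight is controlled by 1 and the powers of single coordinates. Those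
    powers are what a partial Fourier transform converts into derivatives. *)
Lemma wt_coord N : exists C, forall x (a : R), 0 <= a -> forall B,
  a <= B -> (forall j, `|x 0 j| ^+ N * a <= B) -> wt N x * a <= C * B.
Proof.
(* The power comes from (1 + t)^N <= 2^N (1 + t^N), the last factor 2 from adding the two bounds by
   [B]. *)
exists (2 ^+ N * 2) => x a a0 B aB hB.
have B0 : 0 <= B by exact: le_trans aB.
have main : (1 + `|x|) ^+ N <= 2 ^+ N * (1 + `|x| ^+ N).
  have [x1|x1] := leP `|x| 1.
    apply: (@le_trans _ _ (2 ^+ N)).
      apply: lerXn2r; rewrite ?nnegrE ?addr_ge0 //.
      by lra.
    by rewrite ler_peMr ?exprn_ge0 // lerDl exprn_ge0.
  apply: (@le_trans _ _ ((2 * `|x|) ^+ N)).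
    apply: lerXn2r; rewrite ?nnegrE ?addr_ge0 ?mulr_ge0 //.
    by rewrite mulr_natl mulr2n lerD2r ltW.
  by rewrite exprMn; apply: ler_wpM2l; rewrite ?exprn_ge0 // lerDr.
apply: (@le_trans _ _ (2 ^+ N * (1 + `|x| ^+ N) * a)); first exact: ler_wpM2r.
rewrite -!mulrA; apply: ler_wpM2l; first exact: exprn_ge0.
rewrite mulrDl mul1r mulr_natl mulr2n; apply: lerD => //.
have [->|[j ->]] := norm_coord x; last exact: hB.
case: N {hB main} => [|N]; first by rewrite expr0 mul1r.
by rewrite exprS mul0r mul0r.
Qed.

End RealSchwartz.

Section Pullback.
Context {R : realType} {d D : nat}.

Lemma rschwartz_affine (iota : 'rV[R]_d -> 'rV[R]_D) sg e f :
  coord_affine iota sg e -> (forall x, `|x| <= `|iota x|) -> `|e| <= 1 ->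
  rschwartz f -> rschwartz (f \o iota) /\
  forall n N B, bnd n N B f -> bnd n N B (f \o iota).
Proof.
move=> ai ix e1 [sf hf]; have [si pi] := smooth_affine ai sf.
have main n N B : bnd n N B f -> bnd n N B (f \o iota).
  move=> h s ss x; rewrite pi normrM.
  apply: le_trans (h (map sg s) _ (iota x)); last by rewrite size_map.
  apply: ler_pM => //; first exact: wt_ge0.
    by apply: lerXn2r; rewrite ?nnegrE ?addr_ge0 // lerD2l.
  by rewrite ler_piMl // normrX exprn_ile1.
split => //; split => // n N.
by have [B hB] := hf n N; exists B; exact: main.
Qed.

End Pullback.

(** * Partial Fourier transforms *)

Section LineIntegrals.
Context {R : realType}.
Implicit Types (u v : R -> R).
Local Notation mu := (@lebesgue_measure R).

Lemma oneDsqr_pos (t : R) : 0 < oneDsqr t.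
Proof. exact: lt_le_trans ltr01 (oneDsqr_ge1 t). Qed.

Lemma oneDsqrV_ge0 (t : R) : 0 <= (oneDsqr t)^-1.
Proof. by rewrite invr_ge0 ltW // oneDsqr_pos. Qed.

Lemma oneDsqrV_integrable :
  mu.-integrable setT (EFin \o (fun t : R => (oneDsqr t)^-1)).
Proof.
have mf : measurable_fun setT (fun t : R => (oneDsqr t)^-1).
  by apply: continuous_measurable_fun; exact: continuous_oneDsqrV.
apply/integrableP; split; first exact/measurable_EFinP.
have -> : (\int[mu]_x `|(EFin \o (fun t : R => (oneDsqr t)^-1)%R) x| =
    \int[mu]_x ((oneDsqr x)^-1)%:E)%E.
  by apply: eq_integral => t _; rewrite /= ger0_norm ?oneDsqrV_ge0.
rewrite ge0_symfun_integralT.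
- have -> : [set x : R | 0 <= x] = `[0, +oo[%classic.
    by apply/seteqP; split => t /=; rewrite in_itv /= andbT.
  by rewrite integral0y_oneDsqr -EFinM ltry.
- by move=> t; rewrite oneDsqrV_ge0.
- exact: continuous_oneDsqrV.
- by move=> t /=; rewrite /oneDsqr sqrrN.
Qed.

Lemma oneDsqr_integrable (B : R) :
  mu.-integrable setT (EFin \o (fun t => B * (oneDsqr t)^-1)).
Proof. exact: (@integrableZl _ _ _ mu setT measurableT B _ oneDsqrV_integrable). Qed.

(** Continuity gives measurability, and the integrable majorant 1 / (1 + t^2) gives integrability;
    every integral defining a partial transform is justified in this way. *)
Definition decays (B : R) u := continuous u /\ forall t, `|u t| <= B * (oneDsqr t)^-1.

Lemma decays_integrable B u : decays B u -> mu.-integrable setT (EFin \o u).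
Proof.
move=> [cu hu]; apply: (le_integrable measurableT _ _ (oneDsqr_integrable B)).
  by apply/measurable_EFinP; exact: continuous_measurable_fun.
by move=> t _ /=; rewrite lee_fin (le_trans (hu t)) // ler_norm.
Qed.

Definition oneDsqr_mass : R := \int[mu]_t (oneDsqr t)^-1.

Lemma oneDsqr_mass_ge0 : 0 <= oneDsqr_mass.
Proof. by apply: Rintegral_ge0 => t _; rewrite oneDsqrV_ge0. Qed.

Lemma decays_bound B u : decays B u -> `|\int[mu]_t u t| <= oneDsqr_mass * B.
Proof.
move=> hu; have iu := decays_integrable hu.
apply: (le_trans (le_normr_Rintegral measurableT iu)).
apply: (@le_trans _ _ (\int[mu]_t (B * (oneDsqr t)^-1))).
  apply: le_Rintegral => //; [|exact: oneDsqr_integrable|by move=> t _; apply hu.2].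
  by have := integrable_norm iu.
by rewrite RintegralZl // 1?mulrC //; exact: oneDsqrV_integrable.
Qed.

Lemma decays_integral_lin B C (a b : R) u v : decays B u -> decays C v ->
  \int[mu]_t (a * u t + b * v t) = a * \int[mu]_t u t + b * \int[mu]_t v t.
Proof.
move=> hu hv; have iu := decays_integrable hu; have iv := decays_integrable hv.
rewrite RintegralD //.
- by rewrite !RintegralZl.
- exact: (@integrableZl _ _ _ mu setT measurableT a _ iu).
- exact: (@integrableZl _ _ _ mu setT measurableT b _ iv).
Qed.

Lemma oneDsqrV_cvg0 : (oneDsqr (n.+1%:R : R))^-1 @[n --> \oo] --> (0 : R).
Proof.
apply: (@squeeze_cvgr _ _ _ _ (fun=> 0) (fun n => (n.+1%:R)^-1)).
- near=> n; rewrite oneDsqrV_ge0 /=.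
  rewrite lef_pV2 ?posrE ?oneDsqr_pos // /oneDsqr.
  by have : (0 : R) <= n.+1%:R by []; nra.
- exact: cvg_cst.
- exact: cvg_harmonic.
Unshelve. all: by end_near. Qed.

(** The fundamental theorem of calculus on growing intervals, with dominated convergence for [g];
    the boundary values tend to 0 because [G] decays. This is integration by parts without boundary
    term. *)
Lemma decays_derive_integral0 B C G g :
  (forall t, is_derive t (1 : R) G (g t)) -> decays B G -> decays C g ->
  \int[mu]_t g t = 0.
Proof.
move=> DG hG hg; have ig := decays_integrable hg.
have cg := hg.1.
(* The successor keeps the interval nondegenerate for [n = 0], as the fundamental theorem
   requires. *)
pose A (n : nat) : set R := `[- n.+1%:R, n.+1%:R]%classic.
pose gn (n : nat) : R -> \bar R := (EFin \o g) \_ (A n).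
have FTC n : (\int[mu]_t gn n t = (G n.+1%:R)%:E - (G (- n.+1%:R))%:E)%E.
  rewrite -integral_mkcond; apply: continuous_FTC2.
  - by rewrite (@lt_trans _ _ 0) // oppr_lt0.
  - exact: continuous_subspaceT.
  - have cG : continuous G := hG.1.
    split.
    + by move=> t _; case: (DG t).
    + exact/cvg_at_right_filter/cG.
    + exact/cvg_at_left_filter/cG.
  - by move=> t _; rewrite derive1E; case: (DG t).
have mA n : measurable (A n) by exact: measurable_itv.
have mg : measurable_fun setT (EFin \o g).
  by apply/measurable_EFinP; exact: continuous_measurable_fun.
have gn_cvg : forall t, setT t -> gn ^~ t @ \oo --> (EFin \o g) t.
  move=> t _; apply: cvg_near_cst; near=> n.
  rewrite /gn patchE mem_set //= /A /= in_itv /= -ler_norml.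
  apply: (@le_trans _ _ n%:R); last by rewrite ler_nat.
  by near: n; apply: nbhs_infty_ger.
have gn_le : forall t (n : nat), setT t ->
    (`|gn n t| <= (EFin \o (fun t : R => C * (oneDsqr t)^-1)%R) t)%E.
  move=> t n _; rewrite /gn patchE; case: ifP => _ /=.
    by rewrite lee_fin hg.2.
  by rewrite normr0 lee_fin (le_trans _ (hg.2 t)).
have mgn n : measurable_fun setT (gn n).
  apply/(measurable_restrictT _ (mA n)); exact: measurable_funTS.
have [_ _ lim1] : [/\ mu.-integrable setT (EFin \o g),
    [sequence (\int[mu]_t `|gn n t - (EFin \o g) t|)%E]_n @ \oo --> (0 : \bar R) &
    [sequence (\int[mu]_t gn n t)%E]_n @ \oo --> (\int[mu]_t (EFin \o g) t)%E].
  apply: (@dominated_convergence _ _ _ mu setT measurableT gn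
    (EFin \o g) (EFin \o (fun t => C * (oneDsqr t)^-1)) mgn mg).
  - exact: aeW.
  - exact: oneDsqr_integrable.
  - exact: aeW.
have lim2 : [sequence (\int[mu]_t gn n t)%E]_n @ \oo --> (0 : \bar R).
  have -> : [sequence (\int[mu]_t gn n t)%E]_n =
      EFin \o (fun n => G n.+1%:R - G (- n.+1%:R)).
    by apply/funext => n; rewrite /= FTC EFinB.
  apply: cvg_EFin; first by near=> n.
  have B0 (e : R) : `|e| = 1 ->
      (fun n : nat => G (e * n.+1%:R)) @ \oo --> (0 : R).
    move=> e1; apply: norm_cvg0.
    apply: (@squeeze_cvgr _ _ _ _ (fun=> 0)
      (fun n => B * (oneDsqr (n.+1%:R : R))^-1)).
    - near=> n; rewrite normr_ge0 /=; apply: (le_trans (hG.2 _)).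
      by rewrite /oneDsqr exprMn -(real_normK (num_real e)) e1 expr1n mul1r.
    - exact: cvg_cst.
    - by rewrite -[X in _ --> X](mulr0 B); apply: cvgMl_tmp; exact: oneDsqrV_cvg0.
  have e1 : (fun n : nat => G n.+1%:R) @ \oo --> (0 : R).
    by have := B0 1 (normr1 _); under eq_fun do rewrite mul1r.
  have e2 : (fun n : nat => G (- n.+1%:R)) @ \oo --> (0 : R).
    by have := B0 (-1) (normrN1 _); under eq_fun do rewrite mulN1r.
  rewrite -[X in _ --> X](subr0 0); exact: (cvgB e1 e2).
by have := cvg_unique _ lim1 lim2; rewrite /Rintegral => ->.
Unshelve. all: by end_near. Qed.
End LineIntegrals.

Section ParametricIntegral.
Context {R : realType}.
Local Notation mu := (@lebesgue_measure R).

(** Restriction to the line through [x] leaves a single real parameter, for which differentiation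
    under the integral applies near 0. *)
Lemma is_derive_integral (V : normedModType R) (D : set R) (Phi Phi' : V -> R -> R)
    (G : R -> R) (x v : V) :
  measurable D ->
  (forall s, mu.-integrable D (EFin \o Phi (x + s *: v))) ->
  (forall s t, D t -> is_derive (x + s *: v) v (Phi ^~ t) (Phi' (x + s *: v) t)) ->
  (forall t, 0 <= G t) -> mu.-integrable D (EFin \o G) ->
  (forall s t, D t -> `|Phi' (x + s *: v) t| <= G t) ->
  is_derive x v (fun y => \int[mu]_(t in D) Phi y t) (\int[mu]_(t in D) Phi' x t).
Proof.
move=> mD iPhi DPhi G0 iG PhiG.
apply/is_derive_line0.
pose F (s t : R) := Phi (x + s *: v) t.
have DF s t : D t -> is_derive s (1 : R) (F ^~ t) (Phi' (x + s *: v) t).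
  move=> Dt; exact: ((is_derive_line (Phi ^~ t) x v s _).1 (DPhi s t Dt)).
have I0 : (`](-1), 1[%classic : set R) 0 by rewrite /= in_itv /= ltrN10 ltr01.
have p1 s t : D t -> partial1of2 F s t = Phi' (x + s *: v) t.
  by move=> Dt; rewrite partial1of2E; case: (DF s t Dt).
have dF : forall s t : R, (`](-1), 1[%classic : set R) s -> D t -> derivable (F ^~ t) s 1.
  by move=> s t _ Dt; case: (DF s t Dt).
have FG : forall s t : R, (`](-1), 1[%classic : set R) s -> D t ->
    `|partial1of2 F s t| <= G t.
  by move=> s t _ Dt; rewrite p1 //; exact: PhiG.
have iF : forall s : R, (`](-1), 1[%classic : set R) s -> mu.-integrable D (EFin \o F s).
  by move=> s _; exact: iPhi.
split.
  have := @derivable_under_integral R _ _ mu F D mD 0 (-1) 1 I0 iF dF G G0 iG FG.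
  exact.
have := @differentiation_under_integral R _ _ mu F D mD 0 (-1) 1 I0 iF dF G G0 iG FG.
rewrite derive1E => ->.
by apply: eq_Rintegral => t /set_mem Dt; rewrite p1 // scale0r addr0.
Qed.

End ParametricIntegral.

Section PartialFourier.
Context {R : realType} {d : nat}.
Implicit Types (f g h : 'rV[R]_d -> R) (x : 'rV[R]_d) (i j : 'I_d) (th : R).
Local Notation mu := (@lebesgue_measure R).

(* With th = 0 and th = pi / 2 these are the real and imaginary parts of the
   partial Fourier transform in the [j]-th variable, since
   [- sin u = cos (u + pi / 2)]. *)
Definition ktr j th f x : R := \int[mu]_t (f (upd x j t) * cos (t * x 0 j + th)).

Lemma upd_continuous x j f : smooth f -> continuous (fun t => f (upd x j t)).
Proof.
move=> sf t; apply/differentiable_continuous/derivable1_diffP.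
by case: (is_derive_upd (is_derive_pd j (upd x j t) (smooth_derivable sf))).
Qed.

Lemma line_decay x j f B t : bnd 0 2 B f -> `|f (upd x j t)| <= B * (oneDsqr t)^-1.
Proof.
move=> hf; rewrite ler_pdivlMr ?oneDsqr_pos // mulrC.
apply: le_trans (hf [::] isT (upd x j t)); apply: ler_wpM2r => //.
have := coord_le (upd x j t) j; rewrite updE /oneDsqr /wt => tx.
rewrite -(real_normK (num_real t)).
have : 0 <= `|t| by [].
nra.
Qed.

Lemma cos_line_continuous (a b : R) : continuous (fun t : R => cos (t * a + b)).
Proof.
move=> t; apply: (@continuous_comp _ _ _ (fun t : R => t * a + b) cos).
  by apply: cvgD; [apply: cvgMr_tmp; exact: cvg_id|exact: cvg_cst].
exact: continuous_cos.
Qed.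

Lemma cos_norm_le1 (a : R) : `|cos a| <= 1.
Proof. by rewrite ler_norml cos_geN1 cos_le1. Qed.

Lemma ktr_decays x j th (a : R) f B : smooth f -> bnd 0 2 B f ->
  decays B (fun t => f (upd x j t) * cos (t * a + th)).
Proof.
move=> sf hf; split.
  exact: (continuous_mul (upd_continuous sf) (@cos_line_continuous a th)).
move=> t; rewrite normrM; apply: le_trans (line_decay x j t hf).
by rewrite ler_piMr // cos_norm_le1.
Qed.

Lemma ktr_lin j th (a b : R) f g x : rschwartz f -> rschwartz g ->
  ktr j th (fun x => a * f x + b * g x) x = a * ktr j th f x + b * ktr j th g x.
Proof.
move=> rf rg; have [B hB] := rschwartz_bnd 0 2 rf.
have [C hC] := rschwartz_bnd 0 2 rg.
rewrite /ktr -(decays_integral_lin _ _ (ktr_decays x j th (x 0 j) rf.1 hB)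
  (ktr_decays x j th (x 0 j) rg.1 hC)).
by apply: eq_Rintegral => t _; ring.
Qed.

Lemma is_derive_cos_line (a b t : R) :
  is_derive t (1 : R) (fun t : R => cos (t * a + b)) (- sin (t * a + b) * a).
Proof.
have h1 : is_derive t (1 : R) (fun t : R => t * a + b) a.
  have h := is_deriveD (is_deriveM (is_derive_id t (1:R)) (is_derive_cst a t (1:R)))
    (is_derive_cst b t (1 : R)).
  by apply: is_derive_eq; rewrite addr0 scaler0 add0r [_ *: _]mulr1.
exact: (@is_derive1_comp R cos (fun t : R => t * a + b) t _ _ (is_derive_cos _) h1).
Qed.

Lemma is_derive_sin_line (a b t : R) :
  is_derive t (1 : R) (fun t : R => sin (t * a + b)) (cos (t * a + b) * a).
Proof.
have h1 : is_derive t (1 : R) (fun t : R => t * a + b) a.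
  have h := is_deriveD (is_deriveM (is_derive_id t (1:R)) (is_derive_cst a t (1:R)))
    (is_derive_cst b t (1 : R)).
  by apply: is_derive_eq; rewrite addr0 scaler0 add0r [_ *: _]mulr1.
exact: (@is_derive1_comp R sin (fun t : R => t * a + b) t _ _ (is_derive_sin _) h1).
Qed.

Lemma ktr_derive_other i j th f x : i != j -> rschwartz f ->
  is_derive x (evec i) (ktr j th f) (ktr j th (pd i f) x).
Proof.
move=> ij rf; have [B hB] := rschwartz_bnd 0 2 rf.
have rfi := rschwartz_pd i rf; have [C hC] := rschwartz_bnd 0 2 rfi.
have C0 := bnd_ge0 hC.
have coord y s : (y + s *: evec i) 0 j = y 0 j :> R.
  by rewrite !mxE eqxx /= eq_sym (negbTE ij) mulr0 addr0.
apply: (@is_derive_integral R 'rV[R]_d setT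
  (fun x t => f (upd x j t) * cos (t * x 0 j + th))
  (fun x t => pd i f (upd x j t) * cos (t * x 0 j + th))
  (fun t => C * (oneDsqr t)^-1)).
- exact: measurableT.
- by move=> s; exact: (decays_integrable (ktr_decays _ j th _ rf.1 hB)).
- move=> s t _; set y := x + s *: evec i.
  apply/is_derive_line0.
  have -> : (fun u => f (upd (y + u *: evec i) j t) *
        cos (t * (y + u *: evec i) 0 j + th)) =
      (fun u => f (upd y j t + u *: evec i) * cos (t * y 0 j + th)).
    by apply/funext => u; rewrite upd_add // coord.
  have h := (is_derive_line0 f (upd y j t) (evec i) _).1
    (is_derive_pd i _ (smooth_derivable rf.1)).
  have h' := is_deriveM h (is_derive_cst (cos (t * y 0 j + th)) (0 : R) (1 : R)).
  by apply: is_derive_eq; rewrite scaler0 add0r [_ *: _]mulrC.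
- by move=> t; rewrite mulr_ge0 // oneDsqrV_ge0.
- exact: oneDsqr_integrable.
- by move=> s t _; exact: (ktr_decays _ j th _ rfi.1 hC).2.
Qed.

(** Differentiating a cosine advances its phase by [pi / 2]. Recording the phase in [th] makes the
    family of transforms stable under all partial derivatives. *)
Lemma ktr_derive_same j th f x : rschwartz f ->
  is_derive x (evec j) (ktr j th f) (ktr j (th + pi / 2) (fun x => x 0 j * f x) x).
Proof.
move=> rf; have [B hB] := rschwartz_bnd 0 2 rf.
have rfi := rschwartz_coord j rf; have [C hC] := rschwartz_bnd 0 2 rfi.
have C0 := bnd_ge0 hC.
apply: (@is_derive_integral R 'rV[R]_d setT
  (fun x t => f (upd x j t) * cos (t * x 0 j + th))
  (fun x t => (upd x j t 0 j * f (upd x j t)) * cos (t * x 0 j + (th + pi / 2)))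
  (fun t => C * (oneDsqr t)^-1)).
- exact: measurableT.
- by move=> s; exact: (decays_integrable (ktr_decays _ j th _ rf.1 hB)).
- move=> s t _; set y := x + s *: evec j.
  apply/is_derive_line0.
  have -> : (fun u => f (upd (y + u *: evec j) j t) *
        cos (t * (y + u *: evec j) 0 j + th)) =
      (fun u => f (upd y j t) * cos (u * t + (t * y 0 j + th))).
    apply/funext => u; rewrite upd_add_same !mxE !eqxx /= mulr1.
    by congr (_ * cos _); ring.
  have h := is_deriveM (is_derive_cst (f (upd y j t)) (0 : R) (1 : R))
    (is_derive_cos_line t (t * y 0 j + th) 0).
  apply: is_derive_eq; rewrite scaler0 addr0 mul0r add0r [_ *: _]mulrC.
  by rewrite updE addrA cosDpihalf /cst; ring.
- by move=> t; rewrite mulr_ge0 // oneDsqrV_ge0.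
- exact: oneDsqr_integrable.
- by move=> s t _; exact: (ktr_decays _ j _ _ rfi.1 hC).2.
Qed.

(** Integration by parts: the derivative of [f] times the sine of the same phase has integral
    zero. *)
Lemma ktr_coord j th f x : rschwartz f ->
  x 0 j * ktr j th f x = ktr j (th + pi / 2) (pd j f) x.
Proof.
move=> rf; have [B hB] := rschwartz_bnd 0 2 rf.
have rfi := rschwartz_pd j rf; have [C hC] := rschwartz_bnd 0 2 rfi.
pose a := x 0 j.
have h1 := ktr_decays x j th a rf.1 hB.
have h2 := ktr_decays x j (th + pi / 2) a rfi.1 hC.
have D1 t : is_derive t (1 : R) (fun t => f (upd x j t) * sin (t * a + th))
    (a * (f (upd x j t) * cos (t * a + th)) +
     (-1) * (pd j f (upd x j t) * cos (t * a + (th + pi / 2)))).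
  have hf := is_derive_upd (is_derive_pd j (upd x j t) (smooth_derivable rf.1)).
  have h := is_deriveM hf (is_derive_sin_line a th t).
  apply: is_derive_eq; rewrite addrA cosDpihalf /GRing.scale /=; ring.
have dec1 : decays B (fun t => f (upd x j t) * sin (t * a + th)).
  have -> : (fun t => f (upd x j t) * sin (t * a + th)) =
      (fun t => f (upd x j t) * cos (t * a + (th - pi / 2))).
    apply/funext => t; congr (_ * _).
    by rewrite -[in LHS](subrK (pi / 2) th) addrA sinDpihalf.
  exact: (ktr_decays x j (th - pi / 2) a rf.1 hB).
have dec2 : decays (`|a| * B + C) (fun t => a * (f (upd x j t) * cos (t * a + th)) +
     (-1) * (pd j f (upd x j t) * cos (t * a + (th + pi / 2)))).
  split.
    move=> t; apply: cvgD; apply: cvgMl_tmp; [exact: h1.1|exact: h2.1].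
  move=> t; apply: (le_trans (ler_normD _ _)); rewrite [leRHS]mulrDl; apply: lerD.
    by rewrite normrM -mulrA; apply: ler_wpM2l => //; exact: h1.2.
  by rewrite mulN1r normrN; exact: h2.2.
have := decays_derive_integral0 D1 dec1 dec2.
rewrite (decays_integral_lin _ _ h1 h2) mulN1r => /eqP.
by rewrite subr_eq0 => /eqP.
Qed.

End PartialFourier.

Section PartialFourierBounds.
Context {R : realType} {d : nat}.
Implicit Types (f g h : 'rV[R]_d -> R) (x : 'rV[R]_d) (i j : 'I_d) (th : R).

Lemma pd_ktr_other i j th f : i != j -> rschwartz f ->
  pd i (ktr j th f) = ktr j th (pd i f).
Proof. by move=> ij rf; apply: pdE => x; exact: ktr_derive_other. Qed.

Lemma pd_ktr_same j th f : rschwartz f ->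
  pd j (ktr j th f) = ktr j (th + pi / 2) (fun x => x 0 j * f x).
Proof. by move=> rf; apply: pdE => x; exact: ktr_derive_same. Qed.

Lemma ktr_bound j th f B x : smooth f -> bnd 0 2 B f ->
  `|ktr j th f x| <= oneDsqr_mass * B.
Proof. by move=> sf hf; exact: decays_bound (ktr_decays x j th _ sf hf). Qed.

Lemma ktr_pderivable j th f : rschwartz f -> pderivable (ktr j th f).
Proof.
move=> rf i x; have [->|ij] := eqVneq i j.
  by case: (ktr_derive_same j th x rf).
by case: (ktr_derive_other th x ij rf).
Qed.

Lemma smooth_ktr j th f : rschwartz f -> smooth (ktr j th f).
Proof.
move=> rf.
apply: (@smooth_coind _ _ (fun u => exists th f, rschwartz f /\ u = ktr j th f));
  last by exists th, f.
move=> _ [{}th [{rf}f [rf ->]]].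
have pdi i : exists th' f', rschwartz f' /\ pd i (ktr j th f) = ktr j th' f'.
  have [->|ij] := eqVneq i j.
    rewrite pd_ktr_same //; exists (th + pi / 2), (fun x => x 0 j * f x).
    by split => //; exact: rschwartz_coord.
  rewrite pd_ktr_other //; exists th, (pd i f); split => //.
  exact: rschwartz_pd.
split; [|exact: ktr_pderivable|exact: pdi].
have /choice[C hC] : forall i, exists C, forall x, `|pd i (ktr j th f) x| <= C.
  move=> i; have [th' [f' [rf' ->]]] := pdi i.
  have [B hB] := rschwartz_bnd 0 2 rf'.
  by exists (oneDsqr_mass * B) => x; exact: ktr_bound rf'.1 hB.
apply: (@bounded_pd_continuous _ _ _ (\sum_i `|C i|)).
  exact: ktr_pderivable.
move=> i x; rewrite (bigD1 i) //= ler_wpDr ?sumr_ge0 //.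
exact: le_trans (hC i x) (ler_norm _).
Qed.

Lemma ktr_coord_exp j th f x N B : rschwartz f -> bnd N 2 B f ->
  `|x 0 j| ^+ N * `|ktr j th f x| <= oneDsqr_mass * B.
Proof.
elim: N th f => [|N IH] th f rf hf.
  by rewrite mul1r; exact: ktr_bound rf.1 hf.
rewrite exprSr -mulrA -normrM ktr_coord //.
by apply: IH; [exact: rschwartz_pd|exact: bnd_pd].
Qed.

(** A coordinate other than the [j]-th is constant under the integral sign, so its power is absorbed
    by [N] extra powers of the weight; the remaining two make the integrand integrable. *)
Lemma ktr_other_exp i j th f x N B : i != j -> rschwartz f ->
  bnd 0 (N + 2) B f -> `|x 0 i| ^+ N * `|ktr j th f x| <= oneDsqr_mass * B.
Proof.
move=> ij rf hf.
have hf2 : bnd 0 2 B f by apply: bnd_mono hf => //; exact: leq_addl.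
have h := ktr_decays x j th (x 0 j) rf.1 hf2.
rewrite -[X in X * _]ger0_norm ?exprn_ge0 // -normrM.
(* A second term with coefficient 0 gives the product the shape of a linear combination, so
   linearity of the integral moves the power of the coordinate inside. *)
rewrite -[X in `|X|]addr0 -[X in _ + X](mul0r (ktr j th f x)).
rewrite /ktr -(decays_integral_lin _ _ h h).
apply: decays_bound; split.
  move=> t; apply: cvgD; apply: cvgMl_tmp; exact: h.1.
move=> t; rewrite mul0r addr0 !normrM [`| `|_| ^+ N|]ger0_norm ?exprn_ge0 //.
apply: (@le_trans _ _ (`|x 0 i| ^+ N * `|f (upd x j t)|)).
  by apply: ler_wpM2l; rewrite ?exprn_ge0 // ler_piMr // cos_norm_le1.
rewrite ler_pdivlMr ?oneDsqr_pos //.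
apply: le_trans (hf [::] isT (upd x j t)); rewrite /partial /= wtD.
rewrite mulrAC; apply: ler_wpM2r => //; apply: ler_pM => //.
- apply: lerXn2r; rewrite ?nnegrE ?addr_ge0 //.
  have := coord_le (upd x j t) i; rewrite mxE (negbTE ij) => /le_trans; apply.
  by rewrite lerDr.
- have := coord_le (upd x j t) j; rewrite updE /oneDsqr /wt => tx.
  rewrite -(real_normK (num_real t)).
  have : 0 <= `|t| by [].
  nra.
Qed.

(** The constants must not depend on [th]: the induction on the order differentiates in the [j]-th
    direction, which shifts the phase. *)
Lemma ktr_tame j n N : exists n' N' C, 0 <= C /\
  forall th f B, rschwartz f -> bnd n' N' B f -> bnd n N (C * B) (ktr j th f).
Proof.
elim: n => [|n IH].
  have [C hC] := @wt_coord R d N.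
  exists N, (N + 2)%N, (`|C| * oneDsqr_mass).
  split; first by rewrite mulr_ge0 // oneDsqr_mass_ge0.
  move=> th f B rf hf; have B0 := bnd_ge0 hf.
  apply: bnd0 => x.
  apply: (@le_trans _ _ (C * (oneDsqr_mass * B))).
    apply: hC => //.
    - apply: ktr_bound rf.1 _; apply: bnd_mono hf => //; exact: leq_addl.
    - move=> i; have [->|ij] := eqVneq i j.
        apply: ktr_coord_exp rf _; apply: bnd_mono hf => //; exact: leq_addl.
      apply: ktr_other_exp ij rf _; exact: bnd_mono hf.
  rewrite -mulrA; apply: ler_wpM2r; last exact: ler_norm.
  by rewrite mulr_ge0 // oneDsqr_mass_ge0.
have [n1 [N1 [C1 [C10 h1]]]] := IH.
have [n2 [N2 [C2 [C20 h2]]]] := bnd_mul (@moderate_coord R d j) n1 N1.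
exists (maxn n1.+1 n2), (maxn N1 N2), (C1 + C1 * C2).
split; first by rewrite addr_ge0 // mulr_ge0.
move=> th f B rf hf; have B0 := bnd_ge0 hf.
have hf1 : bnd n1.+1 N1 B f by apply: bnd_mono hf; rewrite ?leq_maxl.
have hf2 : bnd n2 N2 B f by apply: bnd_mono hf; rewrite ?leq_maxr.
have CC : C1 * B <= (C1 + C1 * C2) * B.
  by apply: ler_wpM2r => //; rewrite lerDl mulr_ge0.
apply: bndS.
  apply: (bnd_mono (n:=n) (N:=N) (B:=C1 * B)) => //.
  by apply: h1 => //; exact: bnd_mono hf1.
move=> i; have [->|ij] := eqVneq i j.
  rewrite pd_ktr_same //.
  apply: (bnd_mono (n:=n) (N:=N) (B:=C1 * (C2 * B))) => //.
    by rewrite mulrA; apply: ler_wpM2r => //; rewrite lerDr.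
  apply: h1; first exact: rschwartz_coord.
  have -> : (fun x => x 0 j * f x) = (fun x => f x * x 0 j).
    by apply/funext => x; rewrite mulrC.
  exact: h2 rf.1 hf2.
rewrite pd_ktr_other //.
apply: (bnd_mono (n:=n) (N:=N) (B:=C1 * B)) => //.
by apply: h1; [exact: rschwartz_pd|exact: bnd_pd].
Qed.

Lemma rschwartz_ktr j th f : rschwartz f -> rschwartz (ktr j th f).
Proof.
move=> rf; split; first exact: smooth_ktr.
move=> n N; have [n' [N' [C [_ h]]]] := ktr_tame j n N.
by have [B hB] := rschwartz_bnd n' N' rf; exists (C * B); exact: h.
Qed.

End PartialFourierBounds.

(** * Fourier inversion in one variable *)

Section Hadamard.
Context {R : realType}.
Implicit Types (f g F : 'rV[R]_1 -> R) (a x : 'rV[R]_1).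
Local Notation mu := (@lebesgue_measure R).

Definition shrink a (t : R) x : 'rV[R]_1 := a + t *: (x - a).

Lemma shrink_affine a t : coord_affine (shrink a t) (fun i : 'I_1 => i) t.
Proof. by move=> x i s; rewrite /shrink addrAC scalerDr scalerA addrA. Qed.

(** The integral remainder of Hadamard's lemma. The exponent [k] counts the derivatives taken so
    far, each of which brings out one factor [t]. *)
Definition ray_avg a k F x : R :=
  \int[mu]_(t in `[0, 1]) (t ^+ k * F (shrink a t x)).

Lemma unit_integrable (u : R -> R) : continuous u ->
  mu.-integrable `[0, 1] (EFin \o u).
Proof.
move=> cu; apply: continuous_compact_integrable; first exact: segment_compact.
exact: continuous_subspaceT.
Qed.

Lemma ray_continuous a k F x : smooth F ->
  continuous (fun t : R => t ^+ k * F (shrink a t x)).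
Proof.
move=> sF; apply: continuous_mul; first exact: exprn_continuous.
move=> t; apply: (@continuous_comp _ _ _ (fun t : R => shrink a t x) F).
  apply: cvgD; first exact: cvg_cst.
  by apply: cvgZr_tmp; exact: cvg_id.
exact: smooth_continuous.
Qed.

Lemma ray_avg_bound a k F x B : smooth F -> (forall y, `|F y| <= B) ->
  `|ray_avg a k F x| <= B.
Proof.
move=> sF hB.
have iu := unit_integrable (@ray_continuous a k F x sF).
apply: (@le_trans _ _ (\int[mu]_(t in `[0, 1]) `|t ^+ k * F (shrink a t x)|)).
  exact: le_normr_Rintegral.
apply: (@le_trans _ _ (\int[mu]_(t in `[0, 1]) B)).
  apply: le_Rintegral => //.
  - exact: integrable_norm iu.
  - exact: unit_integrable (@cst_continuous _ _ B).
  - move=> t /=; rewrite in_itv /= => /andP[t0 t1].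
    rewrite normrM ger0_norm ?exprn_ge0 //.
    apply: le_trans (hB (shrink a t x)).
    by rewrite ler_piMl // exprn_ile1.
rewrite Rintegral_cst //.
change (B * fine (lebesgue_measure (`[0, 1]%classic : set R)) <= B).
by rewrite lebesgue_measure_itv /= lte01 sube0 mulr1.
Qed.

Lemma ray_avg_derive a k F i x B : smooth F -> (forall y, `|pd i F y| <= B) ->
  is_derive x (evec i) (ray_avg a k F) (ray_avg a k.+1 (pd i F) x).
Proof.
move=> sF hB.
have B0 : 0 <= B by exact: le_trans (hB 0).
have sFi := smooth_pd i sF.
apply: (@is_derive_integral R 'rV[R]_1 `[0, 1]
  (fun x t => t ^+ k * F (shrink a t x))
  (fun x t => t ^+ k.+1 * pd i F (shrink a t x)) (fun=> B)).
- exact: measurable_itv.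
- by move=> s; exact: unit_integrable (@ray_continuous a k F _ sF).
- move=> s t _.
  have h := coord_affine_pd i (shrink_affine a t) (smooth_derivable sF)
    (x + s *: evec i).
  have h' := is_deriveZ (t ^+ k : R) h.
  by apply: is_derive_eq; rewrite exprSr -mulrA.
- by [].
- exact: unit_integrable (@cst_continuous _ _ B).
- move=> s t /=; rewrite in_itv /= => /andP[t0 t1].
  rewrite normrM ger0_norm ?exprn_ge0 //.
  apply: le_trans (hB (shrink a t (x + s *: evec i))).
  by rewrite ler_piMl // exprn_ile1.
Qed.

Lemma rschwartz_bounded f : rschwartz f -> exists B, forall x, `|f x| <= B.
Proof.
move=> rf; have [B hB] := rschwartz_bnd 0 0 rf.
by exists B => x; have := hB [::] isT x; rewrite /wt mul1r.
Qed.

Lemma smooth_ray_avg a k F : rschwartz F -> smooth (ray_avg a k F).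
Proof.
move=> rF.
apply: (@smooth_coind _ _ (fun u => exists k F, rschwartz F /\ u = ray_avg a k F));
  last by exists k, F.
move=> _ [{}k [{rF}F [rF ->]]].
have D i x : is_derive x (evec i) (ray_avg a k F) (ray_avg a k.+1 (pd i F) x).
  have [B hB] := rschwartz_bounded (rschwartz_pd i rF).
  exact: ray_avg_derive rF.1 hB.
have dF : pderivable (ray_avg a k F) by move=> i x; case: (D i x).
split => //; last first.
  move=> i; exists k.+1, (pd i F); split; first exact: rschwartz_pd.
  exact: pdE (D i).
have [B hB] := rschwartz_bounded (rschwartz_pd 0 rF).
apply: (@bounded_pd_continuous _ _ _ B) => // i x.
rewrite (pdE (D i)) (ord1 i).
exact: (ray_avg_bound _ _ _ (rschwartz_pd 0 rF).1 hB).
Qed.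

Lemma partial_ray_avg a k F s : rschwartz F ->
  partial s (ray_avg a k F) = ray_avg a (k + size s) (partial s F).
Proof.
move=> rF; elim/last_ind: s k F rF => [|s i IH] k F rF; first by rewrite addn0.
rewrite partial_rcons size_rcons.
have [B hB] := rschwartz_bounded (rschwartz_pd i rF).
rewrite (pdE (fun x => ray_avg_derive a k x rF.1 hB)).
by rewrite IH ?addSnnS ?partial_rcons //; exact: rschwartz_pd.
Qed.

Lemma ray_avg_FTC a f x : rschwartz f ->
  f x - f a = (x 0 0 - a 0 0) * ray_avg a 0 (pd 0 f) x.
Proof.
move=> rf; pose h := x 0 0 - a 0 0.
have sE (t : R) : shrink a t x = a + (t * h) *: evec 0.
  apply/rowP => k; rewrite (ord1 k) !mxE eqxx /= mulr1 /h; ring.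
pose g (t : R) := h * pd 0 f (shrink a t x).
pose G (t : R) := f (shrink a t x).
have DG t : is_derive t (1 : R) G (g t).
  have -> : G = (fun s => f (a + s *: evec 0)) \o (fun t => t * h).
    by apply/funext => s; rewrite /G sE.
  have h1 : is_derive t (1 : R) (fun t => t * h) h.
    have h' := is_deriveM (is_derive_id t (1:R)) (is_derive_cst h t (1:R)).
    by apply: is_derive_eq; rewrite scaler0 add0r [_ *: _]mulr1.
  have h2 : is_derive (t * h) (1 : R) (fun s => f (a + s *: evec 0))
      (pd 0 f (a + (t * h) *: evec 0)).
    apply: (is_derive_line f a (evec 0) (t * h) _).1.
    exact: is_derive_pd (smooth_derivable rf.1).
  have h' := @is_derive1_comp R (fun s => f (a + s *: evec 0)) (fun t => t * h)
    t _ _ h2 h1.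
  by apply: is_derive_eq; rewrite /g sE mulrC.
have cray := @ray_continuous a 0 _ x (smooth_pd 0 rf.1).
have cg : continuous g.
  have -> : g = (fun t => h * (t ^+ 0 * pd 0 f (shrink a t x))).
    by apply/funext => t; rewrite mul1r.
  by apply: continuous_mul => //; exact: cst_continuous.
have cG : continuous G.
  by move=> t; apply/differentiable_continuous/derivable1_diffP; case: (DG t).
have := @continuous_FTC2 R g G 0 1 ltr01 (continuous_subspaceT cg).
have -> : G 1 = f x by rewrite /G /shrink scale1r addrC subrK.
have -> : G 0 = f a by rewrite /G /shrink scale0r addr0.
move=> FTC; have {}FTC : \int[mu]_(t in `[0, 1]) g t = f x - f a.
  rewrite /Rintegral FTC //.
    split.
    + by move=> t _; case: (DG t).
    + exact/cvg_at_right_filter/cG.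
    + exact/cvg_at_left_filter/cG.
  by move=> t _; rewrite derive1E; case: (DG t).
rewrite -FTC /ray_avg -RintegralZl //; last exact: unit_integrable.
by apply: eq_Rintegral => t _; rewrite mul1r.
Qed.

(** Leibniz rule for an affine factor: at most one derivative falls on it, in [size s] ways. In
    dimension one all directions coincide, so [behead] may stand for the removal of any of them. *)
Lemma partial_coord_mul a s g : smooth g ->
  partial s (fun x => (x 0 0 - a 0 0) * g x) =
  (fun x => (x 0 0 - a 0 0) * partial s g x +
            (size s)%:R * partial (behead s) g x).
Proof.
move=> sg; elim: s => [|i s IH]; first by apply/funext => x; rewrite /= mul0r addr0.
rewrite partial_cons IH; apply: pdE => x; rewrite (ord1 i).
have D1 : is_derive x (evec 0) (fun x => x 0 0 - a 0 0) 1.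
  have h := is_deriveD (is_derive_coord x 0 0)
    (is_derive_cst (- a 0 0) x (evec 0)).
  by apply: is_derive_eq; rewrite eqxx addr0.
have D2 := is_derive_pd 0 x (smooth_derivable (smooth_partial s sg)).
have D3 := is_derive_pd 0 x (smooth_derivable (smooth_partial (behead s) sg)).
have D4 : is_derive x (evec 0) (fun x => (size s)%:R * partial (behead s) g x)
    ((size s)%:R * pd 0 (partial (behead s) g) x) := is_deriveZ ((size s)%:R : R) D3.
have h := is_deriveDf (is_deriveMf D1 D2) D4.
apply: is_derive_eq; rewrite -!partial_cons /= -natr1.
case: s {IH D2 D3 D4 h} => [|k s] /=; first by ring.
by rewrite (ord1 k); ring.
Qed.

(** The quotient is the average of the derivative along segments issued from [a], which settles
    smoothness. Decay follows by induction on the order, since (x - a) times a derivative of [g] is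
    the same derivative of [f] minus a lower order term. *)
Lemma divide_at_zero a f : rschwartz f -> f a = 0 ->
  exists2 g, rschwartz g & f = (fun x => (x 0 0 - a 0 0) * g x).
Proof.
move=> rf fa; pose g := ray_avg a 0 (pd 0 f).
have fE : f = (fun x => (x 0 0 - a 0 0) * g x).
  by apply/funext => x; rewrite -ray_avg_FTC // fa subr0.
have rf' := rschwartz_pd 0 rf.
have sg : smooth g by exact: smooth_ray_avg.
exists g => //; apply: rschwartzP => //.
suff main : forall n N s, size s = n ->
    exists B, forall x, wt N x * `|partial s g x| <= B.
  by move=> s N; exact: main erefl.
(* Both cases run in parallel: [B1] bounds the derivative of [g] without weight, [B2] the weighted
   derivative of [f], and [B3] the lower order term, which vanishes for [n = 0] and otherwise comes
   from the induction hypothesis. *)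
move=> n N; elim: n => [|n IH] s ss.
  all: have [B1 hB1] : exists B, forall x, `|partial s g x| <= B.
    1,3: have [B0 hB0] := rschwartz_bnd (size s) 0 rf'.
    1,2: exists B0 => x; rewrite partial_ray_avg //; apply: ray_avg_bound.
    1,3: exact: smooth_partial rf'.1.
    1,2: by move=> y; have := hB0 s (leqnn _) y; rewrite /wt mul1r.
  all: have [B2 hB2] := rschwartz_bnd (size s) N rf.
  all: have [B3 hB3] : exists B, forall x,
      wt N x * ((size s)%:R * `|partial (behead s) g x|) <= B.
    1: by exists 0 => x; rewrite ss mul0r mulr0.
    2: have [B hB] := IH (behead s) ltac:(by rewrite size_behead ss).
    2: by exists ((size s)%:R * B) => x; rewrite mulrCA; apply: ler_wpM2l.
  all: have B10 : 0 <= B1 by exact: le_trans (hB1 0).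
  all: have B20 : 0 <= B2 by exact: bnd_ge0 hB2.
  all: have B30 : 0 <= B3 by apply: le_trans (hB3 0); rewrite !mulr_ge0 // wt_ge0.
  all: exists (B2 + B3 + (2 + `|a|) ^+ N * B1) => x.
  (* Within distance 1 of [a] the weight is at most (2 + |a|)^N. Farther away, inserting the factor
     |x - a| > 1 brings back the product whose derivatives are known. *)
  all: have [near|far] := leP `|x 0 0 - a 0 0| 1.
  1,3: apply: (@le_trans _ _ ((2 + `|a|) ^+ N * B1)); last by rewrite lerDr addr_ge0.
  1,2: apply: ler_pM; rewrite ?wt_ge0 //.
  1,2: apply: lerXn2r; rewrite ?nnegrE ?addr_ge0 //.
  1,2: rewrite -(addrA 1 1) lerD2l; apply: norm_le_coord; rewrite ?addr_ge0 // => i.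
  1,2: rewrite (ord1 i) -[x 0 0](subrK (a 0 0)).
  1,2: by apply: (le_trans (ler_normD _ _)); apply: lerD => //; exact: coord_le.
  all: apply: (@le_trans _ _ (B2 + B3));
    last by rewrite lerDl mulr_ge0 // exprn_ge0 // addr_ge0.
  all: apply: le_trans (lerD (hB2 s (leqnn _) x) (hB3 x)).
  all: rewrite -mulrDr; apply: ler_wpM2l; first exact: wt_ge0.
  all: apply: (@le_trans _ _ (`|x 0 0 - a 0 0| * `|partial s g x|)).
  1,3: by rewrite ler_peMl // ltW.
  all: rewrite -normrM -[X in X * `|partial (behead s) g x|]ger0_norm // -normrM.
  all: have -> : (x 0 0 - a 0 0) * partial s g x =
      partial s f x - (size s)%:R * partial (behead s) g x.
  1,3: by rewrite [in RHS]fE partial_coord_mul // addrK.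
  all: exact: ler_normB.
Qed.

End Hadamard.

(** * The Gaussian and its partial transforms *)

Section Gaussian.
Context {R : realType}.
Implicit Types (f g : 'rV[R]_1 -> R) (x : 'rV[R]_1).
Local Notation mu := (@lebesgue_measure R).

Lemma is_derive_comp1 (V : normedModType R) (Phi : R -> R) (l : V -> R) (x v : V)
    (a b : R) :
  is_derive (l x) (1 : R) Phi b -> is_derive x v l a ->
  is_derive x v (Phi \o l) (b * a).
Proof.
move=> hPhi hl; apply/is_derive_line0.
have h1 := (is_derive_line0 l x v a).1 hl.
have h2 : is_derive (l (x + 0 *: v)) (1 : R) Phi b by rewrite scale0r addr0.
exact: (@is_derive1_comp R Phi (fun s => l (x + s *: v)) 0 _ _ h2 h1).
Qed.

Definition gaussian x : R := expR (- (x 0 0 ^+ 2 / 2)).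

Lemma gaussian_gt0 x : 0 < gaussian x.
Proof. exact: expR_gt0. Qed.

Lemma is_derive_expsq (e : R) x :
  is_derive x (evec 0) (fun x : 'rV[R]_1 => expR (e * (x 0 0 * x 0 0)))
    (expR (e * (x 0 0 * x 0 0)) * (e * (x 0 0 * 2))).
Proof.
have h0 := is_derive_coord x 0 0.
have h1 : is_derive x (evec 0) (fun x : 'rV[R]_1 => e * (x 0 0 * x 0 0))
  (e * (1 * x 0 0 + x 0 0 * 1)) := is_deriveZ (e : R) (is_deriveMf h0 h0).
have h2 := is_derive_comp1 (is_derive_expR _) h1.
by apply: is_derive_eq; congr (_ * _); ring.
Qed.

Lemma gaussianE : gaussian = (fun x => expR (- 2^-1 * (x 0 0 * x 0 0))).
Proof. by apply/funext => x; rewrite /gaussian; congr expR; field. Qed.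

Lemma is_derive_gaussian x : is_derive x (evec 0) gaussian (- (x 0 0 * gaussian x)).
Proof.
have h := is_derive_expsq (- 2^-1) x; rewrite -gaussianE in h.
by apply: is_derive_eq; rewrite gaussianE; field.
Qed.

Lemma pd_gaussian : pd 0 gaussian = (fun x => - (x 0 0 * gaussian x)).
Proof. by apply: pdE => x; exact: is_derive_gaussian. Qed.

Lemma gaussian_continuous : continuous gaussian.
Proof.
rewrite gaussianE => x.
apply: (@continuous_comp _ _ _ (fun x : 'rV[R]_1 => - 2^-1 * (x 0 0 * x 0 0)) expR);
  last exact: continuous_expR.
apply: continuous_mul; first exact: cst_continuous.
exact: (continuous_mul (@coord_continuous_pt R 1 0) (@coord_continuous_pt R 1 0)).
Qed.

Lemma gaussian_decay N : exists B, forall x, wt N x * gaussian x <= B.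
Proof.
(* With u = t^2 / 2, the exponential series gives u^N <= N! exp u, and 1 + t <= 4 u as soon as t >
   1. For t <= 1 the weight is at most 4^N. *)
exists (4 ^+ N * N`!%:R) => x; set t := `|x 0 0|.
have t0 : 0 <= t by exact: normr_ge0.
have xt : `|x| <= t by apply: norm_le_coord => // i; rewrite (ord1 i).
have gE : gaussian x = (expR (t ^+ 2 / 2))^-1.
  by rewrite /gaussian expRN real_normK ?num_real.
rewrite gE ler_pdivrMr ?expR_gt0 //.
have u0 : 0 <= t ^+ 2 / 2 by rewrite divr_ge0 // exprn_ge0.
have e1 : (t ^+ 2 / 2) ^+ N <= N`!%:R * expR (t ^+ 2 / 2).
  rewrite -ler_pdivrMl ?ltr0n ?fact_gt0 // mulrC.
  case: N => [|N].
    rewrite expr0 fact0 invr1 mulr1.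
    by apply: le_trans (expR_ge1Dx _); rewrite lerDl.
  by apply: le_trans (expR_ge1Dxn N u0); rewrite lerDr.
apply: (@le_trans _ _ ((1 + t) ^+ N)).
  by apply: lerXn2r; rewrite ?nnegrE ?addr_ge0 // lerD2l.
have [t1|t1] := leP t 1.
  apply: (@le_trans _ _ (4 ^+ N)).
    by apply: lerXn2r; rewrite ?nnegrE ?addr_ge0 //; lra.
  rewrite -mulrA ler_peMr ?exprn_ge0 //; apply: mulr_ege1.
    by rewrite ler1n fact_gt0.
  by apply: le_trans (expR_ge1Dx _); rewrite lerDl.
apply: (@le_trans _ _ ((4 * (t ^+ 2 / 2)) ^+ N)).
  apply: lerXn2r; rewrite ?nnegrE ?addr_ge0 ?mulr_ge0 //.
  by nra.
rewrite exprMn -[leRHS]mulrA.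
by apply: ler_wpM2l; rewrite ?exprn_ge0.
Qed.

(** All derivatives of the Gaussian stay in the class of slowly increasing functions times the
    Gaussian, and the latter beats every power of the weight. *)
Lemma rschwartz_gaussian : rschwartz gaussian.
Proof.
pose Q u := exists2 h, moderate h & u = fun x => h x * gaussian x.
have Qpd h : moderate h -> forall x, is_derive x (evec 0)
    (fun x => h x * gaussian x) ((pd 0 h x + (-1) * (x 0 0 * h x)) * gaussian x).
  move=> mh x.
  have h1 := is_derive_pd 0 x (smooth_derivable mh.1).
  have h2 := is_deriveMf h1 (is_derive_gaussian x).
  by apply: is_derive_eq; ring.
have mpd h : moderate h -> moderate (fun x : 'rV[R]_1 => pd 0 h x + (-1) * (x 0 0 * h x)).
  move=> mh; apply: moderate_add; first exact: moderate_pd.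
  apply: (moderate_mul (moderate_cst _)).
  exact: (moderate_mul (moderate_coord 0) mh).
have Qc : iter_closed Q.
  move=> _ [h mh ->]; split.
  - apply: continuous_mul; first exact: smooth_continuous mh.1.
    exact: gaussian_continuous.
  - by move=> i x; rewrite (ord1 i); case: (Qpd h mh x).
  - move=> i; rewrite (ord1 i) (pdE (Qpd h mh)).
    by exists (fun x => pd 0 h x + (-1) * (x 0 0 * h x)) => //; exact: mpd.
have Q1 : Q gaussian.
  exists (fun=> 1); first exact: moderate_cst.
  by apply/funext => x; rewrite mul1r.
apply: rschwartzP; first exact: smooth_coind Qc Q1.
move=> s N.
have [h mh ->] : Q (partial s gaussian).
  by elim: s => [//|i s IH]; have [_ _ hp] := Qc _ IH; exact: hp.
have [M [C hC]] := mh.2 [::].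
have [B hB] := gaussian_decay (N + M).
exists (`|C| * B) => x.
rewrite normrM (ger0_norm (ltW (gaussian_gt0 x))).
apply: (@le_trans _ _ (wt N x * ((`|C| * wt M x) * gaussian x))).
  apply: ler_wpM2l; first exact: wt_ge0.
  apply: ler_wpM2r; first exact: ltW (gaussian_gt0 x).
  apply: (le_trans (hC x)); apply: ler_wpM2r; first exact: wt_ge0.
  exact: ler_norm.
have -> : wt N x * (`|C| * wt M x * gaussian x) = `|C| * (wt (N + M) x * gaussian x).
  by rewrite wtD; ring.
exact: ler_wpM2l.
Qed.

Lemma zero_derive_const (u : 'rV[R]_1 -> R) :
  (forall x, is_derive x (evec 0) u 0) -> forall x, u x = u 0.
Proof.
move=> hu x.
have xE (y : 'rV[R]_1) : y = upd 0 0 (y 0 0).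
  by apply/rowP => k; rewrite (ord1 k) updE.
have h s : is_derive s (1 : R) (fun s => u (upd 0 0 s)) 0.
  exact: is_derive_upd.
have z (s : R) : `|0 : R| <= 0 by rewrite normr0.
have := line_lipschitz 0 (x 0 0) h z.
rewrite mul0r -xE normr_le0 subr_eq0 => /eqP ->.
by rewrite [in RHS](xE 0) mxE.
Qed.

(** Uniqueness for u' = - x u: the product of [u] with the inverse Gaussian has zero derivative. *)
Lemma gaussian_ode (u : 'rV[R]_1 -> R) :
  (forall x, is_derive x (evec 0) u (- (x 0 0 * u x))) ->
  forall x, u x = u 0 * gaussian x.
Proof.
move=> hu x.
pose e x := expR (2^-1 * ((x : 'rV[R]_1) 0 0 * x 0 0)).
have h y : is_derive y (evec 0) (fun y => u y * e y) 0.
  have h1 := is_deriveMf (hu y) (is_derive_expsq 2^-1 y).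
  by apply: is_derive_eq; rewrite /e; field.
have := zero_derive_const h x.
have -> : e 0 = 1 by rewrite /e mxE mul0r mulr0 expR0.
have -> : gaussian x = (e x)^-1.
  by rewrite gaussianE /e -expRN; congr expR; field.
by rewrite mulr1 => <-; rewrite mulfK // gt_eqF // expR_gt0.
Qed.

(** Differentiation and integration by parts exchange x and d/dx, so the transform satisfies the
    same differential equation as the Gaussian. *)
Lemma ktr_gaussian th x : ktr 0 th gaussian x = ktr 0 th gaussian 0 * gaussian x.
Proof.
apply: gaussian_ode => {}x.
have h := ktr_derive_same 0 th x rschwartz_gaussian.
apply: is_derive_eq.
rewrite (ktr_coord 0 th x rschwartz_gaussian) pd_gaussian.
have rx := rschwartz_coord 0 rschwartz_gaussian.
have := ktr_lin 0 (th + pi / 2) (-1) 0 x rx rx.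
rewrite mul0r addr0 mulN1r => /(congr1 -%R); rewrite opprK => <-.
by congr (- ktr _ _ _ _); apply/funext => y; rewrite mul0r addr0 mulN1r.
Qed.

(** The number sqrt (2 pi); its square is the constant of the inversion formula in one variable. *)
Definition gaussian_mass : R := ktr 0 0 gaussian 0.

Lemma gaussian_mass_gt0 : 0 < gaussian_mass.
Proof.
have gE : (fun t : R => gaussian (upd 0 0 t) * cos (t * (0 : 'rV[R]_1) 0 0 + 0)) =
    (fun t => expR (- (t ^+ 2 / 2))).
  by apply/funext => t; rewrite /gaussian updE mxE mulr0 addr0 cos0 mulr1.
rewrite /gaussian_mass /ktr gE.
have [B hB] := rschwartz_bnd 0 2 rschwartz_gaussian.
have dec := ktr_decays 0 0 0 ((0 : 'rV[R]_1) 0 0) rschwartz_gaussian.1 hB.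
rewrite gE in dec.
(* The integral of exp (- t^2), whose value is known, is a lower bound. *)
apply: (@lt_le_trans _ _ (\int[mu]_t (gauss_fun t : R))).
  by rewrite /Rintegral integralT_gauss /= sqrtr_gt0 pi_gt0.
apply: le_Rintegral => //.
- exact: integrableT_gauss.
- exact: decays_integrable dec.
- move=> t _; rewrite /gauss_fun ler_expR lerN2 ler_pdivrMr //.
  by rewrite ler_peMr // ?sqr_ge0 // ler1n.
Qed.

(** The transform is its value at the origin times the Gaussian, and at the origin the kernel is cos
    (pi / 2) = 0. *)
Lemma ktr_pihalf_gaussian x : ktr 0 (pi / 2) gaussian x = 0.
Proof.
rewrite ktr_gaussian; apply/eqP; rewrite mulf_eq0; apply/orP; left; apply/eqP.
have [B hB] := rschwartz_bnd 0 2 rschwartz_gaussian.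
have dec := ktr_decays 0 0 0 0 rschwartz_gaussian.1 hB.
have := decays_integral_lin 0 0 dec dec; rewrite !mul0r addr0 => <-.
by apply: eq_Rintegral => t _; rewrite mxE mulr0 add0r cos_pihalf mulr0 !mul0r addr0.
Qed.

End Gaussian.

(** * A partial transform followed by its inverse *)

Section InversionLine.
Context {R : realType} {d : nat}.
Implicit Types (f g : 'rV[R]_d -> R) (x : 'rV[R]_d) (j : 'I_d).

Lemma ktrN_phase j th f x : rschwartz f -> ktr j (th + pi) f x = - ktr j th f x.
Proof.
move=> rf; have [B hB] := rschwartz_bnd 0 2 rf.
have dec := ktr_decays x j th (x 0 j) rf.1 hB.
have := decays_integral_lin (-1) 0 dec dec; rewrite mul0r addr0 mulN1r /ktr => <-.
by apply: eq_Rintegral => t _; rewrite addrA cosDpi mul0r addr0 mulN1r mulrN.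
Qed.

Lemma ktr_zero j th x : ktr j th (fun=> 0) x = 0.
Proof.
rewrite /ktr /Rintegral (_ : integral _ _ _ = 0%E) //.
by rewrite -[RHS](integral0 (@lebesgue_measure R) setT); apply: eq_integral => t _;
  rewrite mul0r.
Qed.

Lemma ktr_half_shift j f x : rschwartz f ->
  ktr j (pi / 2) f x = - ktr j (- (pi / 2)) f x.
Proof.
move=> rf; rewrite -(ktrN_phase j _ x rf).
by rewrite (_ : - (pi / 2) + pi = pi / 2 :> R) //; field.
Qed.

Lemma ktr_coord_in j th f : rschwartz f ->
  ktr j th (fun x => x 0 j * f x) = pd j (ktr j (th - pi / 2) f).
Proof. by move=> rf; rewrite pd_ktr_same // subrK. Qed.

(** The inner transform turns the coordinate into a derivative and the outer one turns it back, each
    retarding its phase by [pi / 2]. *)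
Lemma ktr_coord2 j th th' f x : rschwartz f ->
  ktr j th (ktr j th' (fun x => x 0 j * f x)) x =
  x 0 j * ktr j (th - pi / 2) (ktr j (th' - pi / 2) f) x.
Proof.
move=> rf; rewrite ktr_coord_in // ktr_coord ?subrK //; exact: rschwartz_ktr.
Qed.

Lemma ktr_opp j th f : rschwartz f ->
  ktr j th (fun x => - f x) = (fun x => - ktr j th f x).
Proof.
move=> rf; apply/funext => x; have := ktr_lin j th (-1) 0 x rf rf.
rewrite mul0r addr0 mulN1r => <-; congr (ktr _ _ _ _).
by apply/funext => y; rewrite mul0r addr0 mulN1r.
Qed.

(** Write C and K for the transforms of phase 0 and [pi / 2]. Since (C - i e K) (C + i e K) = C C +
    K K + i e (C K - K C) when e^2 = 1, [ktr_sq] and [ktr_comm] are the parts of the inverse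
    transform applied to the transform. *)
Definition ktr_sq j f x : R :=
  ktr j 0 (ktr j 0 f) x + ktr j (pi / 2) (ktr j (pi / 2) f) x.

Definition ktr_comm j f x : R :=
  ktr j 0 (ktr j (pi / 2) f) x - ktr j (pi / 2) (ktr j 0 f) x.

Lemma ktr_half_shiftE j f : rschwartz f ->
  ktr j (- (pi / 2)) f = (fun x => - ktr j (pi / 2) f x).
Proof. by move=> rf; apply/funext => x; rewrite ktr_half_shift // opprK. Qed.

(** Retarding the phases exchanges the two summands up to two sign changes, which cancel. *)
Lemma ktr_sq_coord j f x : rschwartz f ->
  ktr_sq j (fun x => x 0 j * f x) x = x 0 j * ktr_sq j f x.
Proof.
move=> rf; rewrite /ktr_sq !ktr_coord2 // sub0r subrr (ktr_half_shiftE j rf).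
have rk := rschwartz_ktr j (pi / 2) rf.
by rewrite (ktr_opp j _ rk) (ktr_half_shiftE j rk) opprK; ring.
Qed.

Lemma ktr_comm_coord j f x : rschwartz f ->
  ktr_comm j (fun x => x 0 j * f x) x = x 0 j * ktr_comm j f x.
Proof.
move=> rf; rewrite /ktr_comm !ktr_coord2 // sub0r subrr.
have rk := rschwartz_ktr j (pi / 2) rf; have rk0 := rschwartz_ktr j 0 rf.
rewrite (ktr_half_shiftE j rf) (ktr_half_shiftE j rk0) ktr_opp //; ring.
Qed.

Lemma ktr_linE j th (a b : R) f g : rschwartz f -> rschwartz g ->
  ktr j th (fun x => a * f x + b * g x) =
  (fun x => a * ktr j th f x + b * ktr j th g x).
Proof. by move=> rf rg; apply/funext => x; exact: ktr_lin. Qed.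

Lemma ktr_sq_lin j (a b : R) f g x : rschwartz f -> rschwartz g ->
  ktr_sq j (fun x => a * f x + b * g x) x = a * ktr_sq j f x + b * ktr_sq j g x.
Proof.
move=> rf rg; rewrite /ktr_sq !(ktr_linE _ _ _ _ rf rg).
rewrite (ktr_lin j 0 a b x (rschwartz_ktr j 0 rf) (rschwartz_ktr j 0 rg)).
rewrite (ktr_lin j _ a b x (rschwartz_ktr j (pi / 2) rf) (rschwartz_ktr j (pi / 2) rg)).
by rewrite !mulrDr addrACA.
Qed.

Lemma ktr_comm_lin j (a b : R) f g x : rschwartz f -> rschwartz g ->
  ktr_comm j (fun x => a * f x + b * g x) x = a * ktr_comm j f x + b * ktr_comm j g x.
Proof.
move=> rf rg; rewrite /ktr_comm !(ktr_linE _ _ _ _ rf rg).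
rewrite (ktr_lin j _ a b x (rschwartz_ktr j (pi / 2) rf) (rschwartz_ktr j (pi / 2) rg)).
rewrite (ktr_lin j _ a b x (rschwartz_ktr j 0 rf) (rschwartz_ktr j 0 rg)).
by rewrite !mulrBr opprD addrACA.
Qed.

End InversionLine.

Section InversionOne.
Context {R : realType}.
Implicit Types (f g : 'rV[R]_1 -> R) (x : 'rV[R]_1).

(* [f - (f a / gaussian a) gaussian] vanishes at [a], hence is [x - a] times a
   Schwartz function (Hadamard), and [P] of such a product vanishes at [a]. *)
Lemma coord_commuting_local (P : ('rV[R]_1 -> R) -> 'rV[R]_1 -> R) f a :
  (forall (a b : R) f g x, rschwartz f -> rschwartz g ->
    P (fun x => a * f x + b * g x) x = a * P f x + b * P g x) ->
  (forall f x, rschwartz f -> P (fun x => x 0 0 * f x) x = x 0 0 * P f x) ->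
  rschwartz f -> P f a = f a / gaussian a * P gaussian a.
Proof.
move=> Plin PX rf; pose c := f a / gaussian a.
pose f0 x := 1 * f x + (- c) * gaussian x.
have rg := @rschwartz_gaussian R.
have rf0 : rschwartz f0.
  by apply: rschwartz_add; exact: rschwartz_scale.
have f0a : f0 a = 0.
  by rewrite /f0 mul1r /c mulNr divfK ?subrr // gt_eqF // gaussian_gt0.
have [g rg' fE] := divide_at_zero rf0 f0a.
have Pf0 : P f0 a = 0.
  have -> : f0 = fun x => 1 * (x 0 0 * g x) + (- a 0 0) * g x.
    by rewrite fE; apply/funext => x; ring.
  rewrite Plin //; last exact: rschwartz_coord.
  by rewrite PX //; ring.
move: Pf0; rewrite Plin // mul1r mulNr => /eqP.
by rewrite subr_eq0 => /eqP.
Qed.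

Lemma ktr_sq_line f x : rschwartz f ->
  ktr_sq 0 f x = gaussian_mass ^+ 2 * f x.
Proof.
move=> rf; have rg := @rschwartz_gaussian R.
rewrite (@coord_commuting_local (ktr_sq 0) f x
  (@ktr_sq_lin R 1 0) (@ktr_sq_coord R 1 0) rf).
have k1 : ktr 0 (pi / 2) gaussian = (fun _ : 'rV[R]_1 => 0 : R).
  by apply/funext => y; exact: ktr_pihalf_gaussian.
have k0 : ktr 0 0 gaussian =
    (fun y : 'rV[R]_1 => gaussian_mass * gaussian y + 0 * gaussian y).
  by apply/funext => y; rewrite [LHS]ktr_gaussian mul0r addr0.
rewrite /ktr_sq k1 k0 ktr_lin // k0.
by rewrite ktr_zero; field; rewrite gt_eqF // gaussian_gt0.
Qed.

Lemma ktr_comm_line f x : rschwartz f -> ktr_comm 0 f x = 0.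
Proof.
move=> rf; have rg := @rschwartz_gaussian R.
rewrite (@coord_commuting_local (ktr_comm 0) f x
  (@ktr_comm_lin R 1 0) (@ktr_comm_coord R 1 0) rf).
have k1 : ktr 0 (pi / 2) gaussian = (fun _ : 'rV[R]_1 => 0 : R).
  by apply/funext => y; exact: ktr_pihalf_gaussian.
have k0 : ktr 0 0 gaussian =
    (fun y : 'rV[R]_1 => gaussian_mass * gaussian y + 0 * gaussian y).
  by apply/funext => y; rewrite [LHS]ktr_gaussian mul0r addr0.
rewrite /ktr_comm k1 k0 ktr_lin // k1.
by rewrite ktr_zero !mulr0 addr0 subrr mulr0.
Qed.

End InversionOne.

(** * From one variable to one coordinate among several *)

Section InversionCoordinate.
Context {R : realType} {d : nat}.
Implicit Types (f g : 'rV[R]_d -> R) (x : 'rV[R]_d) (j : 'I_d).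

Definition slice x j (y : 'rV[R]_1) : 'rV[R]_d := upd x j (y 0 0).

Lemma slice_affine x j : coord_affine (slice x j) (fun=> j) 1.
Proof.
by move=> y i s; rewrite /slice upd_line (ord1 i) !mxE eqxx /= mul1r mulr1.
Qed.

Lemma rschwartz_slice x j f : rschwartz f -> rschwartz (f \o slice x j).
Proof.
move=> rf; apply: (rschwartz_affine (slice_affine x j) _ _ rf).1.
  move=> y; apply: norm_le_coord => // i; rewrite (ord1 i).
  by have := coord_le (slice x j y) j; rewrite updE.
by rewrite normr1.
Qed.

(** A partial transform does not mix values with different remaining coordinates, so it commutes
    with freezing them; inversion on the line then applies on every slice. *)
Lemma ktr_slice x j th f : ktr j th f \o slice x j = ktr 0 th (f \o slice x j).
Proof.
apply/funext => y; apply: eq_Rintegral => t _ /=.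
by rewrite /slice upd_upd !updE.
Qed.

Lemma slice_at x j : x = slice x j (const_mx (x 0 j)).
Proof. by rewrite /slice mxE upd_id. Qed.

Lemma ktr_sqE j f x : rschwartz f -> ktr_sq j f x = gaussian_mass ^+ 2 * f x.
Proof.
move=> rf; have := ktr_sq_line (const_mx (x 0 j)) (rschwartz_slice x j rf).
by rewrite /ktr_sq -!ktr_slice /= -slice_at.
Qed.

Lemma ktr_commE j f x : rschwartz f ->
  ktr j 0 (ktr j (pi / 2) f) x = ktr j (pi / 2) (ktr j 0 f) x.
Proof.
move=> rf; have := ktr_comm_line (const_mx (x 0 j)) (rschwartz_slice x j rf).
by rewrite /ktr_comm -!ktr_slice /= -slice_at => /eqP; rewrite subr_eq0 => /eqP.
Qed.

End InversionCoordinate.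

#[local] Opaque ktr.

(** * The Fourier transform of Schwartz functions *)

Section ComplexParts.
Context {R : realType} {d : nat}.
Local Notation S := (schwartz R d).
Implicit Types (f g : S) (u v : 'rV[R]_d -> R).

Lemma normc_re (z : R[i]) : `|complex.Re z| <= normc z.
Proof.
by case: z => a b /=; rewrite -sqrtr_sqr ler_wsqrtr // lerDl sqr_ge0.
Qed.

Lemma normc_im (z : R[i]) : `|complex.Im z| <= normc z.
Proof.
by case: z => a b /=; rewrite -sqrtr_sqr ler_wsqrtr // lerDr sqr_ge0.
Qed.

Lemma normc_le (z : R[i]) : normc z <= `|complex.Re z| + `|complex.Im z|.
Proof.
case: z => a b /=; rewrite -[leRHS]ger0_norm ?addr_ge0 // -sqrtr_sqr ler_wsqrtr //.
rewrite sqrrD !real_normK ?num_real // lerD2r lerDl.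
by rewrite mulrn_wge0 // mulr_ge0.
Qed.

Definition rpart f : 'rV[R]_d -> R := fun x => complex.Re (f x).
Definition ipart f : 'rV[R]_d -> R := fun x => complex.Im (f x).

Lemma schwartz_is f : is_schwartz f.
Proof. by have := valP f; rewrite inE. Qed.

Lemma rpart_rschwartz f : rschwartz (rpart f).
Proof.
have [[sr _] h] := schwartz_is f; apply: rschwartzP => // s N.
have [B hB] := h N s; exists B => x; apply: le_trans (hB x).
by apply: ler_wpM2l; [exact: wt_ge0|exact: (normc_re (cpartial s f x))].
Qed.

Lemma ipart_rschwartz f : rschwartz (ipart f).
Proof.
have [[_ si] h] := schwartz_is f; apply: rschwartzP => // s N.
have [B hB] := h N s; exists B => x; apply: le_trans (hB x).
by apply: ler_wpM2l; [exact: wt_ge0|exact: (normc_im (cpartial s f x))].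
Qed.

Lemma is_schwartz_parts u v : rschwartz u -> rschwartz v ->
  is_schwartz (fun x => u x +i* v x : R[i]^o).
Proof.
move=> ru rv; split; first by split; [exact: ru.1|exact: rv.1].
move=> N s; have [B hB] := rschwartz_bnd (size s) N ru.
have [C hC] := rschwartz_bnd (size s) N rv.
exists (B + C) => x; rewrite /weighted.
apply: le_trans (lerD (hB s (leqnn _) x) (hC s (leqnn _) x)).
rewrite -mulrDr; apply: ler_wpM2l; first exact: wt_ge0.
exact: (normc_le (cpartial s (fun x => u x +i* v x : R[i]^o) x)).
Qed.

Lemma mem_schwartz (f : 'rV[R]_d -> R[i]^o) : is_schwartz f -> f \in @schwartz_pred R d.
Proof. by rewrite inE. Qed.

Definition schwartz_of_parts (u v : 'rV[R]_d -> R) (ru : rschwartz u) (rv : rschwartz v) : S :=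
  Schwartz (mem_schwartz (is_schwartz_parts ru rv)).

Lemma schwartz_eq f g : (forall x, rpart f x = rpart g x) ->
  (forall x, ipart f x = ipart g x) -> f = g.
Proof.
move=> hr hi; apply: val_inj; apply/funext => x.
have := hr x; have := hi x; rewrite /rpart /ipart /=.
by case: (schwartz_fun f x) (schwartz_fun g x) => [a b] [c e] /= -> ->.
Qed.

Lemma rpart_lin (a : R[i]) f g x : rpart (a *: f + g) x =
  complex.Re a * rpart f x - complex.Im a * ipart f x + rpart g x.
Proof.
rewrite /rpart /ipart; have -> : (a *: f + g : S) x = a *: (f x) + g x by [].
by case: a (f x) (g x) => [a1 a2] [b1 b2] [c1 c2].
Qed.

Lemma ipart_lin (a : R[i]) f g x : ipart (a *: f + g) x =
  complex.Re a * ipart f x + complex.Im a * rpart f x + ipart g x.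
Proof.
rewrite /rpart /ipart; have -> : (a *: f + g : S) x = a *: (f x) + g x by [].
by case: a (f x) (g x) => [a1 a2] [b1 b2] [c1 c2].
Qed.

Definition cbnd (n N : nat) (B : R) f := bnd n N B (rpart f) /\ bnd n N B (ipart f).

(** For linear operators this expresses continuity for the topology of the Schwartz space, in a form
    that composes by chaining bounds. *)
Definition tame (Op : S -> S) := forall n N, exists n' N' C, 0 <= C /\
  forall f B, cbnd n' N' B f -> cbnd n N (C * B) (Op f).

Lemma tame_comp Op Op' : tame Op -> tame Op' -> tame (Op \o Op').
Proof.
move=> h h' n N; have [n1 [N1 [C1 [C10 h1]]]] := h n N.
have [n2 [N2 [C2 [C20 h2]]]] := h' n1 N1.
exists n2, N2, (C1 * C2); split; first exact: mulr_ge0.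
by move=> f B fB /=; rewrite -mulrA; apply: h1; exact: h2.
Qed.

Lemma tame_id : tame id.
Proof. by move=> n N; exists n, N, 1; split => // f B; rewrite mul1r. Qed.

End ComplexParts.

Section PartialTransform.
Context {R : realType} {d : nat}.
Local Notation S := (schwartz R d).
Implicit Types (f g : S) (u v : 'rV[R]_d -> R) (j : 'I_d).

Definition pft_re j (e : R) u v : 'rV[R]_d -> R :=
  fun x => 1 * ktr j 0 u x + (- e) * ktr j (pi / 2) v x.
Definition pft_im j (e : R) u v : 'rV[R]_d -> R :=
  fun x => e * ktr j (pi / 2) u x + 1 * ktr j 0 v x.

Lemma rschwartz_lin (a b : R) u v : rschwartz u -> rschwartz v ->
  rschwartz (fun x => a * u x + b * v x).
Proof. by move=> ru rv; apply: rschwartz_add; exact: rschwartz_scale. Qed.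

Lemma rschwartz_pft_re j e u v : rschwartz u -> rschwartz v ->
  rschwartz (pft_re j e u v).
Proof. by move=> ru rv; apply: rschwartz_lin; exact: rschwartz_ktr. Qed.

Lemma rschwartz_pft_im j e u v : rschwartz u -> rschwartz v ->
  rschwartz (pft_im j e u v).
Proof. by move=> ru rv; apply: rschwartz_lin; exact: rschwartz_ktr. Qed.

(* The partial Fourier transform in the [j]-th variable for [e = 1], and, up to
   a constant factor, its inverse for [e = - 1]. *)
Definition pft j e f : S := schwartz_of_parts
  (rschwartz_pft_re j e (rpart_rschwartz f) (ipart_rschwartz f))
  (rschwartz_pft_im j e (rpart_rschwartz f) (ipart_rschwartz f)).

Lemma rpart_pft j e f : rpart (pft j e f) = pft_re j e (rpart f) (ipart f).
Proof. by []. Qed.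

Lemma ipart_pft j e f : ipart (pft j e f) = pft_im j e (rpart f) (ipart f).
Proof. by []. Qed.

Lemma ktr_lin3 j th (a b : R) u v w x : rschwartz u -> rschwartz v -> rschwartz w ->
  ktr j th (fun x => a * u x + b * v x + w x) x =
  a * ktr j th u x + b * ktr j th v x + ktr j th w x.
Proof.
move=> ru rv rw; rewrite -(ktr_lin j th a b x ru rv).
have := ktr_lin j th 1 1 x (rschwartz_lin a b ru rv) rw.
rewrite !mul1r => <-.
rewrite (_ : (fun x => 1 * (a * u x + b * v x) + 1 * w x) =
  (fun x => a * u x + b * v x + w x)) //.
by apply/funext => y; rewrite !mul1r.
Qed.

Lemma pft_linear j e : linear (pft j e).
Proof.
move=> a f g.
have rf := rpart_rschwartz f; have mf := ipart_rschwartz f.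
have rg := rpart_rschwartz g; have mg := ipart_rschwartz g.
have er : rpart (a *: f + g) = (fun x => complex.Re a * rpart f x +
    (- complex.Im a) * ipart f x + rpart g x).
  by apply/funext => x; rewrite rpart_lin mulNr.
have ei : ipart (a *: f + g) = (fun x => complex.Re a * ipart f x +
    complex.Im a * rpart f x + ipart g x).
  by apply/funext => x; rewrite ipart_lin.
apply: schwartz_eq => x.
  rewrite rpart_lin !rpart_pft ipart_pft er ei /pft_re /pft_im.
  rewrite (ktr_lin3 j 0 _ _ x rf mf rg) (ktr_lin3 j (pi / 2) _ _ x mf rf mg).
  ring.
rewrite ipart_lin !ipart_pft rpart_pft er ei /pft_re /pft_im.
rewrite (ktr_lin3 j (pi / 2) _ _ x rf mf rg) (ktr_lin3 j 0 _ _ x mf rf mg).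
ring.
Qed.

(** The diagonal terms add up to [ktr_sq], and the cross terms cancel because the transforms of
    phase 0 and [pi / 2] commute. *)
Lemma pft_inv j e f : e ^+ 2 = 1 ->
  pft j (- e) (pft j e f) = (gaussian_mass ^+ 2)%:C *: f.
Proof.
move=> e2; rewrite -[RHS]addr0.
have rf := rpart_rschwartz f; have mf := ipart_rschwartz f.
have k0r := rschwartz_ktr j 0 rf; have k0i := rschwartz_ktr j 0 mf.
have k1r := rschwartz_ktr j (pi / 2) rf; have k1i := rschwartz_ktr j (pi / 2) mf.
have alg_re (p q r : R) : 1 * (1 * p + - e * r) + - - e * (e * q + 1 * r) = p + q.
  by transitivity (p + e ^+ 2 * q); [ring|rewrite e2 mul1r].
have alg_im (p q r : R) : - e * (1 * r + - e * q) + 1 * (e * r + 1 * p) = p + q.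
  by transitivity (p + e ^+ 2 * q); [ring|rewrite e2 mul1r].
have z x : rpart (0 : S) x = 0 /\ ipart (0 : S) x = 0 by [].
apply: schwartz_eq => x.
  rewrite rpart_lin rpart_pft ipart_pft (z x).1 addr0 mul0r subr0 /= -(ktr_sqE j x rf).
  by rewrite /pft_re /pft_im /= !ktr_lin // ktr_commE.
rewrite ipart_lin !ipart_pft rpart_pft (z x).2 addr0 mul0r addr0 /= -(ktr_sqE j x mf).
by rewrite /pft_re /pft_im /= !ktr_lin // ktr_commE.
Qed.

Lemma pft_tame j e : tame (pft j e).
Proof.
move=> n N; have [n' [N' [C [C0 h]]]] := @ktr_tame R d j n N.
exists n', N', (C + `|e| * C); split; first by rewrite addr_ge0 // mulr_ge0.
move=> f B [hr hi].
have rf := rpart_rschwartz f; have mf := ipart_rschwartz f.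
have s0r := (rschwartz_ktr j 0 rf).1; have s0i := (rschwartz_ktr j 0 mf).1.
have s1r := (rschwartz_ktr j (pi / 2) rf).1.
have s1i := (rschwartz_ktr j (pi / 2) mf).1.
rewrite mulrDl -mulrA; split.
  have := bnd_add (smooth_scale 1 s0r) (smooth_scale (- e) s1i)
    (bnd_scale 1 s0r (h 0 _ _ rf hr)) (bnd_scale (- e) s1i (h (pi / 2) _ _ mf hi)).
  by rewrite normr1 mul1r normrN.
have := bnd_add (smooth_scale e s1r) (smooth_scale 1 s0i)
  (bnd_scale e s1r (h (pi / 2) _ _ rf hr)) (bnd_scale 1 s0i (h 0 _ _ mf hi)).
by rewrite normr1 mul1r addrC.
Qed.

End PartialTransform.

Section FullTransform.
Context {R : realType} {d : nat}.
Local Notation S := (schwartz R d).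
Implicit Types (f g : S) (j : 'I_d) (s : seq 'I_d).

Definition ipft j f : S := ((gaussian_mass ^+ 2)%:C : R[i])^-1 *: pft j (- 1) f.

Lemma gaussian_mass_neq0 : ((gaussian_mass ^+ 2)%:C : R[i]) != 0.
Proof.
apply/eqP => -[] /eqP; rewrite sqrf_eq0; apply/negP.
by rewrite gt_eqF // gaussian_mass_gt0.
Qed.

Lemma pft_ipftK j : cancel (pft j 1) (ipft j).
Proof.
move=> f; rewrite /ipft pft_inv ?expr1n // scalerA mulVf ?scale1r //.
exact: gaussian_mass_neq0.
Qed.

Lemma ipft_pftK j : cancel (ipft j) (pft j 1).
Proof.
move=> f; rewrite /ipft.
have lin a (g : S) : pft j 1 (a *: g) = a *: pft j 1 g.
  have h0 : pft j 1 (0 : S) = 0.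
    have := @pft_linear R d j 1 (-1) 0 0.
    by rewrite scaler0 addr0 scaleN1r addNr.
  by have := @pft_linear R d j 1 a g 0; rewrite h0 !addr0.
rewrite lin -[X in pft j X _](opprK 1) pft_inv ?sqrrN ?expr1n //.
by rewrite scalerA mulVf ?scale1r //; exact: gaussian_mass_neq0.
Qed.

Definition ftr_seq s f : S := foldr (fun j g => pft j 1 g) f s.
(** Folding from the other side undoes the partial transforms in the reverse order. *)
Definition iftr_seq s f : S := foldl (fun g j => ipft j g) f s.

Lemma ftr_seqK s : cancel (ftr_seq s) (iftr_seq s).
Proof. by elim: s => [//|j s IH] f /=; rewrite pft_ipftK; exact: IH. Qed.

Lemma iftr_seqK s : cancel (iftr_seq s) (ftr_seq s).
Proof. by elim: s => [//|j s IH] f /=; rewrite IH ipft_pftK. Qed.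

Lemma ftr_seq_linear s : linear (ftr_seq s).
Proof.
elim: s => [//|j s IH] a f g /=.
by rewrite IH; exact: pft_linear.
Qed.

Lemma tame_scale (a : R[i]) : tame (fun f : S => a *: f).
Proof.
move=> n N; exists n, N, (`|complex.Re a| + `|complex.Im a|).
split; first exact: addr_ge0.
move=> f B [hr hi]; rewrite -[a *: f]addr0 /cbnd.
have rf := rpart_rschwartz f; have mf := ipart_rschwartz f.
have -> : rpart (a *: f + 0) =
    (fun x => complex.Re a * rpart f x + (- complex.Im a) * ipart f x).
  by apply/funext => x; rewrite rpart_lin mulNr addr0.
have -> : ipart (a *: f + 0) =
    (fun x => complex.Re a * ipart f x + complex.Im a * rpart f x).
  by apply/funext => x; rewrite ipart_lin addr0.
rewrite mulrDl; split.
  rewrite -(normrN (complex.Im a)).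
  exact: (bnd_add (smooth_scale _ rf.1) (smooth_scale _ mf.1)
    (bnd_scale _ rf.1 hr) (bnd_scale _ mf.1 hi)).
exact: (bnd_add (smooth_scale _ mf.1) (smooth_scale _ rf.1)
    (bnd_scale _ mf.1 hi) (bnd_scale _ rf.1 hr)).
Qed.

Lemma ftr_seq_tame s : tame (ftr_seq s).
Proof.
elim: s => [|j s IH]; first exact: tame_id.
exact: (tame_comp (pft_tame j 1) IH).
Qed.

Lemma iftr_seq_tame s : tame (iftr_seq s).
Proof.
elim: s => [|j s IH]; first exact: tame_id.
exact: (tame_comp IH (tame_comp (tame_scale _) (pft_tame j (- 1)))).
Qed.

Definition ftr : S -> S := ftr_seq (enum 'I_d).
Definition iftr : S -> S := iftr_seq (enum 'I_d).

Lemma ftrK : cancel ftr iftr. Proof. exact: ftr_seqK. Qed.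
Lemma iftrK : cancel iftr ftr. Proof. exact: iftr_seqK. Qed.
Lemma ftr_tame : tame ftr. Proof. exact: ftr_seq_tame. Qed.
Lemma iftr_tame : tame iftr. Proof. exact: iftr_seq_tame. Qed.
Lemma ftr_linear : linear ftr. Proof. exact: ftr_seq_linear. Qed.

Lemma iftr_linear : linear iftr.
Proof.
move=> a f g; apply: (can_inj ftrK).
by rewrite iftrK ftr_linear !iftrK.
Qed.

End FullTransform.

(** * Splitting off the first variable, and the iterated integral *)

Lemma upd_entry {R : realType} {d : nat} (x : 'rV[R]_d) j t k :
  upd x j t 0 k = if k == j then t else x 0 k.
Proof. by rewrite mxE. Qed.

Lemma add_evec_entry {R : realType} {d : nat} (x : 'rV[R]_d) i s k :
  (x + s *: evec i) 0 k = x 0 k + s * (k == i)%:R.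
Proof. by rewrite mxE [X in _ + X]mxE [X in _ + _ * X]mxE eqxx. Qed.

Section HeadVariable.
Context {R : realType} {d : nat}.
Implicit Types (t : R) (y : 'rV[R]_d) (u v : 'rV[R]_d.+1 -> R).

(** The row appearing in the recursion of [integral_rV], so that both recursions on the dimension
    match. *)
Definition cons_rV t y : 'rV[R]_d.+1 := row_mx (@const_mx R 1 1 t) y.

Lemma cons_rV0 t y : cons_rV t y 0 ord0 = t.
Proof.
have -> : @ord0 d = lshift d (@ord0 0) by exact/val_inj.
by apply: (etrans (@row_mxEl R 1 1 d (const_mx t) y 0 ord0)); rewrite mxE.
Qed.

Lemma cons_rVS t y j : cons_rV t y 0 (lift ord0 j) = y 0 j.
Proof.
have -> : lift (@ord0 d) j = rshift 1 j by exact/val_inj.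
exact: (@row_mxEr R 1 1 d (const_mx t) y 0 j).
Qed.

Lemma rowP_cons (x x' : 'rV[R]_d.+1) : x 0 ord0 = x' 0 ord0 ->
  (forall j : 'I_d, x 0 (lift ord0 j) = x' 0 (lift ord0 j)) -> x = x'.
Proof. by move=> h0 h; apply/rowP => k; case: (unliftP ord0 k) => [j|] ->. Qed.

Lemma cons_rV_surj (x : 'rV[R]_d.+1) :
  x = cons_rV (x 0 ord0) (\row_j x 0 (lift ord0 j)).
Proof. by apply: rowP_cons => [|j]; rewrite ?cons_rV0 ?cons_rVS ?mxE. Qed.

Lemma upd_cons0 t t' y : upd (cons_rV t y) ord0 t' = cons_rV t' y.
Proof.
apply: rowP_cons => [|j]; first by rewrite updE cons_rV0.
by rewrite upd_entry eq_sym (negbTE (neq_lift _ _)) !cons_rVS.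
Qed.

Lemma upd_consS t t' y j : upd (cons_rV t y) (lift ord0 j) t' = cons_rV t (upd y j t').
Proof.
apply: rowP_cons => [|k].
  by rewrite upd_entry (negbTE (neq_lift _ _)) !cons_rV0.
by rewrite cons_rVS !upd_entry (inj_eq (@lift_inj _ ord0)) cons_rVS.
Qed.

Lemma cons_rV_affine t : coord_affine (cons_rV t) (lift ord0) 1.
Proof.
move=> y j s; apply: rowP_cons => [|k].
  by rewrite add_evec_entry !cons_rV0 (negbTE (neq_lift _ _)) mulr0 addr0.
by rewrite add_evec_entry !cons_rVS add_evec_entry (inj_eq (@lift_inj _ ord0)) mul1r.
Qed.

Lemma rschwartz_cons t u : rschwartz u -> rschwartz (u \o cons_rV t).
Proof.
move=> ru; apply: (rschwartz_affine (cons_rV_affine t) _ _ ru).1.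
  move=> y; apply: norm_le_coord => // j.
  by have := coord_le (cons_rV t y) (lift ord0 j); rewrite cons_rVS.
by rewrite normr1.
Qed.

#[local] Transparent ktr.
Lemma ktr_cons t j th u :
  ktr (lift ord0 j) th u \o cons_rV t = ktr j th (u \o cons_rV t).
Proof.
apply/funext => y; apply: eq_Rintegral => s _ /=.
by rewrite upd_consS cons_rVS.
Qed.

Lemma ktr_head th u x : ktr ord0 th u x =
  \int[lebesgue_measure]_t (u (cons_rV t (\row_j x 0 (lift ord0 j))) *
    cos (t * x 0 ord0 + th)).
Proof.
by apply: eq_Rintegral => t _; rewrite {1}(cons_rV_surj x) upd_cons0.
Qed.
#[local] Opaque ktr.

End HeadVariable.

Section FourierE.
Context {R : realType}.

Definition jint (d : nat) (s : seq 'I_d) (u : 'rV[R]_d -> R) :=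
  foldr (fun j g => ktr j 0 g) u s.

Lemma rschwartz_jint d s (u : 'rV[R]_d -> R) : rschwartz u -> rschwartz (jint s u).
Proof. by move=> ru; elim: s => [//|j s IH] /=; exact: rschwartz_ktr. Qed.

Lemma jint_cons d t s (u : 'rV[R]_d.+1 -> R) :
  jint (map (lift ord0) s) u \o cons_rV t = jint s (u \o cons_rV t).
Proof. by elim: s => [//|j s IH] /=; rewrite ktr_cons IH. Qed.

Lemma enum_ordS' d : enum 'I_d.+1 = ord0 :: map (lift ord0) (enum 'I_d).
Proof. exact: enum_ordSl. Qed.

(** At frequency 0 the kernel of [ktr j 0] is 1, so integrating out a variable is a partial
    transform evaluated at the origin. The intermediate integrands are then Schwartz functions. *)
Lemma integral_rVE d (u : 'rV[R]_d -> R) : rschwartz u ->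
  integral_rV u = jint (enum 'I_d) u 0.
Proof.
elim: d u => [|d IH] u ru.
  by rewrite (size0nil (_ : size (enum 'I_0) = 0%N)) // size_enum_ord.
rewrite enum_ordS' /= ktr_head; apply: eq_Rintegral => t _.
rewrite mxE mulr0 addr0 cos0 mulr1.
rewrite -/(cons_rV t _) (IH _ (rschwartz_cons t ru)) -jint_cons /=.
by congr (jint _ _ (cons_rV t _)); apply/rowP => j; rewrite !mxE.
Qed.

Lemma integral_rV_lin d (a b : R) (u v : 'rV[R]_d -> R) : rschwartz u -> rschwartz v ->
  integral_rV (fun x => a * u x + b * v x) = a * integral_rV u + b * integral_rV v.
Proof.
move=> ru rv; rewrite !integral_rVE //; last exact: rschwartz_lin.
move: (0 : 'rV[R]_d) => x; suff -> : jint (enum 'I_d) (fun x => a * u x + b * v x) =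
  (fun x => a * jint (enum 'I_d) u x + b * jint (enum 'I_d) v x) by [].
elim: (enum 'I_d) => [//|j s IH] /=.
by rewrite IH ktr_linE //; exact: rschwartz_jint.
Qed.

Lemma moderate_cos_linear d (xi : 'rV[R]_d) (th : R) :
  moderate (fun x : 'rV[R]_d => cos (\sum_(j < d) x 0 j * xi 0 j + th)).
Proof.
pose l (x : 'rV[R]_d) := \sum_(j < d) x 0 j * xi 0 j + th.
(* The n-th derivative of the cosine, written as a phase shift. *)
pose Phi (n : nat) (t : R) := cos (t + n%:R * (pi / 2)).
have PhiD n t : is_derive t (1 : R) (Phi n) (Phi n.+1 t).
  have h := is_derive_cos_line 1 (n%:R * (pi / 2)) t.
  have E : (fun t : R => cos (t * 1 + n%:R * (pi / 2))) = Phi n.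
    by apply/funext => s; rewrite mulr1.
  rewrite E in h.
  apply: is_derive_eq; rewrite !mulr1 /Phi -(natr1 n).
  have -> : (n%:R + 1) * (pi / 2) = n%:R * (pi / 2) + pi / 2 :> R by ring.
  rewrite addrA.
  by rewrite cosDpihalf.
have ll x i s : l (x + s *: evec i) = l x + s * xi 0 i.
  rewrite /l addrAC; congr (_ + _).
  have -> : s * xi 0 i = \sum_(j < d) (if j == i then s * xi 0 j else 0).
    by rewrite -big_mkcond big_pred1_eq.
  rewrite -big_split; apply: eq_bigr => j _; rewrite !mxE eqxx /=.
  by case: eqP => _; rewrite ?mulr1 ?mulr0 ?addr0 // mulrDl.
have cl : continuous l.
  have sl : smooth l.
    apply: smooth_add; last exact: smooth_cst.
    apply: smooth_sum => j; apply: smooth_mul; last exact: smooth_cst.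
    exact: smooth_coord.
  exact: smooth_continuous.
have [sm pm] := smooth_comp1 0 PhiD ll cl.
have E : Phi 0%N \o l = (fun x => cos (\sum_(j < d) x 0 j * xi 0 j + th)).
  by apply/funext => x; rewrite /= /Phi mul0r addr0.
rewrite -E; split => // s; have [c ->] := pm s.
exists 0%N, `|c| => x; rewrite /wt expr0 mulr1 normrM ler_piMr //.
exact: cos_norm_le1.
Qed.

(* The real and imaginary parts of [f x * expi (- x . xi)]. *)
Definition fker_re d (u v : 'rV[R]_d -> R) (xi x : 'rV[R]_d) : R :=
  1 * (u x * cos (\sum_(j < d) x 0 j * xi 0 j + 0)) +
  (- 1) * (v x * cos (\sum_(j < d) x 0 j * xi 0 j + pi / 2)).
Definition fker_im d (u v : 'rV[R]_d -> R) (xi x : 'rV[R]_d) : R :=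
  1 * (u x * cos (\sum_(j < d) x 0 j * xi 0 j + pi / 2)) +
  1 * (v x * cos (\sum_(j < d) x 0 j * xi 0 j + 0)).

Lemma fourier_parts d (f : schwartz R d) xi : fourier f xi =
  integral_rV (fker_re (rpart f) (ipart f) xi) +i*
  integral_rV (fker_im (rpart f) (ipart f) xi).
Proof.
rewrite /fourier /cintegral_rV; congr (_ +i* _); congr integral_rV;
  apply/funext => x; rewrite /fker_re /fker_im /rpart /ipart addr0 cosDpihalf
  /expi cosN sinN; case: (f x) => a b /=; ring.
Qed.

Lemma rschwartz_fker_re d (u v : 'rV[R]_d -> R) xi : rschwartz u -> rschwartz v ->
  rschwartz (fker_re u v xi).
Proof.
by move=> ru rv; apply: rschwartz_lin; apply: rschwartz_mul => //;
  exact: moderate_cos_linear.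
Qed.

Lemma rschwartz_fker_im d (u v : 'rV[R]_d -> R) xi : rschwartz u -> rschwartz v ->
  rschwartz (fker_im u v xi).
Proof.
by move=> ru rv; apply: rschwartz_lin; apply: rschwartz_mul => //;
  exact: moderate_cos_linear.
Qed.

End FourierE.

Section FourierTransform.
Context {R : realType}.

Definition cslice d (t : R) (f : schwartz R d.+1) : schwartz R d := schwartz_of_parts
  (rschwartz_cons t (rpart_rschwartz f)) (rschwartz_cons t (ipart_rschwartz f)).

Lemma ftr_seq_cons d (t : R) s (f : schwartz R d.+1) :
  rpart (ftr_seq (map (lift ord0) s) f) \o cons_rV t = rpart (ftr_seq s (cslice t f)) /\
  ipart (ftr_seq (map (lift ord0) s) f) \o cons_rV t = ipart (ftr_seq s (cslice t f)).
Proof.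
elim: s => [//|j s [IHr IHi]] /=.
rewrite !rpart_pft !ipart_pft /pft_re /pft_im -IHr -IHi -!ktr_cons.
by split.
Qed.

(** The kernel factors: exp (- i t a) for the first variable times the kernel of the remaining ones,
    in real and imaginary parts. *)
Lemma fker_cons d (u v : 'rV[R]_d.+1 -> R) a xi t y :
  fker_re u v (cons_rV a xi) (cons_rV t y) =
    cos (t * a) * fker_re (u \o cons_rV t) (v \o cons_rV t) xi y +
    sin (t * a) * fker_im (u \o cons_rV t) (v \o cons_rV t) xi y /\
  fker_im u v (cons_rV a xi) (cons_rV t y) =
    - sin (t * a) * fker_re (u \o cons_rV t) (v \o cons_rV t) xi y +
    cos (t * a) * fker_im (u \o cons_rV t) (v \o cons_rV t) xi y.
Proof.
have sE : \sum_(j < d.+1) cons_rV t y 0 j * cons_rV a xi 0 j =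
    t * a + \sum_(j < d) y 0 j * xi 0 j.
  rewrite big_ord_recl !cons_rV0; congr (_ + _).
  by apply: eq_bigr => j _; rewrite !cons_rVS.
rewrite /fker_re /fker_im /= sE !addr0 !cosDpihalf cosD sinD.
by split; ring.
Qed.

(** By induction on the dimension: the inner integrals compute the transform of a slice in the
    remaining variables, and the outer integral is the partial transform in the first one. *)
Lemma fourier_ftr_parts d (f : schwartz R d) xi :
  integral_rV (fker_re (rpart f) (ipart f) xi) = rpart (ftr f) xi /\
  integral_rV (fker_im (rpart f) (ipart f) xi) = ipart (ftr f) xi.
Proof.
elim: d f xi => [|d IH] f xi.
  rewrite /ftr (size0nil (_ : size (enum 'I_0) = 0%N)) ?size_enum_ord //.
  rewrite /= /fker_re /fker_im !big_ord0 !add0r cos0 cos_pihalf.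
  rewrite (_ : 0 = xi); first by split; ring.
  by apply/rowP => -[].
have rf := rpart_rschwartz f; have mf := ipart_rschwartz f.
rewrite (cons_rV_surj xi).
move: (xi 0 ord0) (\row_j xi 0 (lift ord0 j)) => a xi'.
pose G := ftr_seq (map (lift ord0) (enum 'I_d)) f.
have GE : ftr f = pft ord0 1 G by rewrite /ftr enum_ordS'.
have rG := rpart_rschwartz G; have mG := ipart_rschwartz G.
have [B hB] := rschwartz_bnd 0 2 rG; have [C hC] := rschwartz_bnd 0 2 mG.
have updE' (t : R) : upd (cons_rV a xi') ord0 t = cons_rV t xi' by rewrite upd_cons0.
have dec u D th : rschwartz u -> bnd 0 2 D u ->
    decays D (fun t => u (cons_rV t xi') * cos (t * a + th)).
  move=> ru hu; have := ktr_decays (cons_rV a xi') ord0 th a ru.1 hu.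
  by under eq_fun do rewrite updE'.
have kE u th : ktr ord0 th u (cons_rV a xi') = \int[lebesgue_measure]_t
    (u (cons_rV t xi') * cos (t * a + th)).
  by rewrite ktr_head cons_rV0; apply: eq_Rintegral => t _; congr (u (cons_rV t _) * _);
    apply/rowP => j; rewrite mxE cons_rVS.
have slE t : integral_rV (fker_re (rpart f \o cons_rV t) (ipart f \o cons_rV t) xi') =
      rpart G (cons_rV t xi') /\
    integral_rV (fker_im (rpart f \o cons_rV t) (ipart f \o cons_rV t) xi') =
      ipart G (cons_rV t xi').
  have [h1 h2] := IH (cslice t f) xi'.
  have [e1 e2] := ftr_seq_cons t (enum 'I_d) f.
  split; first by rewrite [RHS](congr1 (fun w => w xi') e1).
  by rewrite [RHS](congr1 (fun w => w xi') e2).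
have fre t := rschwartz_fker_re xi' (rschwartz_cons t rf) (rschwartz_cons t mf).
have fim t := rschwartz_fker_im xi' (rschwartz_cons t rf) (rschwartz_cons t mf).
have e1 t : integral_rV (fun y => fker_re (rpart f) (ipart f) (cons_rV a xi') (cons_rV t y)) =
    cos (t * a) * rpart G (cons_rV t xi') + sin (t * a) * ipart G (cons_rV t xi').
  rewrite -(slE t).1 -(slE t).2 -integral_rV_lin //; congr integral_rV.
  by apply/funext => y; exact: (fker_cons _ _ _ _ _ _).1.
have e2 t : integral_rV (fun y => fker_im (rpart f) (ipart f) (cons_rV a xi') (cons_rV t y)) =
    - sin (t * a) * rpart G (cons_rV t xi') + cos (t * a) * ipart G (cons_rV t xi').
  rewrite -(slE t).1 -(slE t).2 -integral_rV_lin //; congr integral_rV.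
  by apply/funext => y; exact: (fker_cons _ _ _ _ _ _).2.
rewrite GE rpart_pft ipart_pft /pft_re /pft_im !kE; split.
  rewrite -(decays_integral_lin _ _ (dec _ _ 0 rG hB) (dec _ _ (pi / 2) mG hC)).
  apply: eq_Rintegral => t _.
  by apply: (etrans (e1 t)); rewrite addr0 cosDpihalf; ring.
rewrite -(decays_integral_lin _ _ (dec _ _ (pi / 2) rG hB) (dec _ _ 0 mG hC)).
apply: eq_Rintegral => t _.
by apply: (etrans (e2 t)); rewrite addr0 cosDpihalf; ring.
Qed.

(** The integral transform in the definition of a multiplier thereby becomes a bijection of the
    Schwartz space with inverse [iftr]. *)
Theorem fourierE d (f : schwartz R d) : fourier f = ftr f.
Proof.
apply/funext => xi; have [h1 h2] := fourier_ftr_parts f xi.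
rewrite fourier_parts h1 h2 /rpart /ipart.
by case: (schwartz_fun (ftr f) xi).
Qed.

End FourierTransform.

(** * Multiplication operators on Schwartz functions *)

Section SchwartzMultipliers.
Context {R : realType} {d : nat}.
Implicit Types (f g h c : 'rV[R]_d -> R) (x : 'rV[R]_d) (i j : 'I_d).

(** Stated through the action on Schwartz functions rather than by growth of derivatives, because
    the action is what a multiplier operator reveals about its symbol. *)
Definition smult h := smooth h /\
  forall g, rschwartz g -> rschwartz (fun x => h x * g x).

Lemma smult_mul h h' : smult h -> smult h' -> smult (fun x => h x * h' x).
Proof.
move=> [sh mh] [sh' mh']; split; first exact: smooth_mul.
move=> g rg; have := mh _ (mh' _ rg); congr rschwartz.
by apply/funext => x; rewrite mulrA.
Qed.

Lemma smult_cst (a : R) : smult (fun=> a).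
Proof. by split; [exact: smooth_cst|move=> g; exact: rschwartz_scale]. Qed.

Lemma smult_add h h' : smult h -> smult h' -> smult (fun x => h x + h' x).
Proof.
move=> [sh mh] [sh' mh']; split; first exact: smooth_add.
move=> g rg; have := rschwartz_add (mh _ rg) (mh' _ rg); congr rschwartz.
by apply/funext => x; rewrite mulrDl.
Qed.

Lemma smult_exp h n : smult h -> smult (fun x => h x ^+ n).
Proof.
move=> mh; elim: n => [|n IH]; first exact: smult_cst.
rewrite (_ : (fun x => h x ^+ n.+1) = (fun x => h x * h x ^+ n)).
  exact: smult_mul.
by apply/funext => x; rewrite exprS.
Qed.

Lemma rschwartz_sub f g : rschwartz f -> rschwartz g ->
  rschwartz (fun x => f x - g x).
Proof.
move=> rf rg; have := rschwartz_add rf (rschwartz_scale (- 1) rg).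
by congr rschwartz; apply/funext => x; rewrite mulN1r.
Qed.

(** The product rule read backwards: h' g = (h g)' - h g'. *)
Lemma smult_pd h i : smult h -> smult (pd i h).
Proof.
move=> [sh mh]; split; first exact: smooth_pd.
move=> g rg; have := rschwartz_sub (rschwartz_pd i (mh g rg)) (mh _ (rschwartz_pd i rg)).
rewrite pd_mul; [|exact: smooth_derivable|exact: smooth_derivable rg.1].
by congr rschwartz; apply/funext => x; rewrite addrK.
Qed.

Lemma pd_exp h i k : smooth h ->
  pd i (fun x => h x ^+ k) = (fun x => k%:R * h x ^+ k.-1 * pd i h x).
Proof.
move=> sh; apply: pdE => x.
exact: is_derive_exp (is_derive_pd i x (smooth_derivable sh)).
Qed.

(** The bounds are proved for all powers [k] and all [g] at once. A derivative of h^(-k) g yields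
    h^(-k) g' and - k h^(-k-1) (h' g), where h' g is again Schwartz, and 1 / h is bounded by 1. *)
Lemma smult_inv h : smult h -> (forall x, 1 <= h x) -> smult (fun x => (h x)^-1).
Proof.
move=> [sh mh] h1.
have h0 x : h x != 0 by rewrite gt_eqF // (lt_le_trans ltr01).
have sr := smooth_inv sh h0.
have r1 x : `|(h x)^-1| <= 1.
  by rewrite ger0_norm ?invr_ge0 ?(le_trans ler01) // invf_le1 // (lt_le_trans ltr01).
have pdr i : pd i (fun x => (h x)^-1) = (fun x => - pd i h x * (h x)^-1 ^+ 2).
  by apply: pdE => x; apply: is_deriveVf => //; exact: is_derive_pd (smooth_derivable sh).
have main n N : forall k g, rschwartz g -> exists B,
    bnd n N B (fun x => (h x)^-1 ^+ k * g x).
  elim: n => [|n IH] k g rg.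
    have [B hB] := rg.2 0%N N; exists B; apply: bnd0 => x.
    apply: le_trans (hB [::] isT x); apply: ler_wpM2l; first exact: wt_ge0.
    by rewrite normrM ler_piMl // normrX exprn_ile1.
  have [B0 hB0] : exists B, bnd 0 N B (fun x => (h x)^-1 ^+ k * g x).
    have [B hB] := IH k g rg.
    by exists B; apply: bnd_mono hB.
  have mhi i := (smult_pd i (conj sh mh)).2.
  have /choice[B hB] : forall i, exists B, bnd n N B
      (pd i (fun x => (h x)^-1 ^+ k * g x)).
    move=> i; have [B1 hB1] := IH k _ (rschwartz_pd i rg).
    have rg' := rschwartz_scale (- k%:R) (mhi i g rg).
    have [B2 hB2] := IH k.+1 _ rg'.
    have sk m : smooth (fun x => (h x)^-1 ^+ m) := smooth_exp m sr.
    exists (B1 + B2).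
    rewrite pd_mul; [|exact: smooth_derivable (sk k)|exact: smooth_derivable rg.1].
    rewrite pd_exp // pdr.
    have := bnd_add (smooth_mul (sk k) (smooth_pd i rg.1)) (smooth_mul (sk k.+1) rg'.1) hB1 hB2.
    congr bnd; apply/funext => x; rewrite addrC; congr (_ + _).
    by case: k {IH hB0 hB1 hB2 rg'} => [|k] /=; rewrite ?mul0r ?mulr0 ?oppr0 ?mul0r ?mulr0 // !exprS; ring.
  have Bi0 i : 0 <= B i by exact: bnd_ge0 (hB i).
  have B00 := bnd_ge0 hB0.
  exists (B0 + \sum_i B i); apply: bndS.
    apply: (bnd_mono _ _ _ hB0) => //.
    by rewrite lerDl sumr_ge0.
  move=> i; apply: (bnd_mono _ _ _ (hB i)) => //.
  by rewrite (bigD1 i) //= addrCA lerDl addr_ge0 // sumr_ge0.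
split; first exact: sr.
move=> g rg; split; first exact: (smooth_mul sr rg.1).
by move=> n N; have := main n N 1%N g rg.
Qed.

(* Each derivative falling on [c ^+ k] costs one factor [k]. *)
Lemma smult_pow_growth c n N : smult c -> (forall x, `|c x| <= 1) ->
  forall g, rschwartz g -> exists2 B, 0 <= B &
    forall k, bnd n N (B * k.+1%:R ^+ n) (fun x => c x ^+ k * g x).
Proof.
move=> [sc mc] c1; elim: n => [|n IH] g rg.
  have [B hB] := rg.2 0%N N; exists B; first exact: bnd_ge0 hB.
  move=> k; rewrite expr0 mulr1; apply: bnd0 => x.
  apply: le_trans (hB [::] isT x); apply: ler_wpM2l; first exact: wt_ge0.
  by rewrite normrM ler_piMl // normrX exprn_ile1.
have [B0 B00 hB0] := IH g rg.
have /choice[B hB] : forall i, exists B, 0 <= B /\ forall k,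
    bnd n N (B * k.+1%:R ^+ n.+1) (pd i (fun x => c x ^+ k * g x)).
  move=> i; have [B1 B10 hB1] := IH _ (rschwartz_pd i rg).
  have rg' := (smult_pd i (conj sc mc)).2 g rg.
  have [B2 B20 hB2] := IH _ rg'.
  exists (B1 + B2); split=> [|k]; first exact: addr_ge0.
  have sk m : smooth (fun x => c x ^+ m) := smooth_exp m sc.
  have s2 := smooth_mul (sk k.-1) rg'.1.
  rewrite pd_mul; [|exact: smooth_derivable (sk k)|exact: smooth_derivable rg.1].
  rewrite pd_exp //.
  (* For [k = 0] the truncated predecessor does no harm, the factor [k] being 0. *)
  have h2 := bnd_scale k%:R s2 (hB2 k.-1).
  have h3 := bnd_add (smooth_mul (sk k) (smooth_pd i rg.1)) (smooth_scale k%:R s2) (hB1 k) h2.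
  have -> : (fun x => k%:R * c x ^+ k.-1 * pd i c x * g x + c x ^+ k * pd i g x) =
    (fun x => c x ^+ k * pd i g x + k%:R * (c x ^+ k.-1 * (pd i c x * g x))).
    by apply/funext => x; ring.
  apply: bnd_mono h3 => //; rewrite mulrDl; apply: lerD.
    by apply: ler_wpM2l => //; apply: ler_weXn2l => //; rewrite ler1n.
  rewrite normr_nat mulrCA; apply: ler_wpM2l => //.
  rewrite exprS; apply: ler_pM => //; rewrite ?exprn_ge0 // ?ler_nat //.
  by apply: lerXn2r; rewrite ?nnegrE // ler_nat; case: (k).
have Bi0 i : 0 <= B i by case: (hB i).
exists (B0 + \sum_i B i); first by rewrite addr_ge0 // sumr_ge0.
move=> k; have k0 : 0 <= k.+1%:R ^+ n.+1 :> R by rewrite exprn_ge0.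
apply: bndS.
  apply: (@bnd_mono _ _ n N (B0 * k.+1%:R ^+ n)) => //.
  apply: (@le_trans _ _ (B0 * k.+1%:R ^+ n.+1)).
    by apply: ler_wpM2l => //; apply: ler_weXn2l => //; rewrite ler1n.
  by apply: ler_wpM2r => //; rewrite lerDl sumr_ge0.
move=> i; apply: (bnd_mono _ _ _ ((hB i).2 k)) => //.
apply: ler_wpM2r => //.
by rewrite (bigD1 i) //= addrCA lerDl addr_ge0 // sumr_ge0.
Qed.

End SchwartzMultipliers.

(** * Averages of bounded sequences *)

Section CentralBinomial.

Lemma central_binS n : (n.+1 * 'C(n.+1.*2, n.+1) = 2 * (n.*2.+1 * 'C(n.*2, n)))%N.
Proof.
rewrite doubleS binS.
have -> : 'C(n.*2.+1, n) = 'C(n.*2.+1, n.+1).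
  rewrite -[RHS]bin_sub; last by rewrite -addnn; lia.
  by congr 'C(_, _); rewrite -addnn; lia.
have := mul_bin_diag n.*2.+1 n; rewrite [n.*2.+1.-1]/= => ->.
by rewrite mulnDr addnn -mul2n.
Qed.

(** The squared form of C(2n,n) / 4^n <= (2n+1)^(-1/2), the decay gained by one difference of an
    average. The induction rests on (2n+1) (2n+3) <= 4 (n+1)^2. *)
Lemma central_bin_bound n : (n.*2.+1 * 'C(n.*2, n) ^ 2 <= 16 ^ n)%N.
Proof.
elim: n => [//|n IH].
have n0 : (0 < n.+1 ^ 2)%N by rewrite expn_gt0.
rewrite -(leq_pmul2r n0) -mulnA -expnMn [('C(_, _) * _)%N]mulnC central_binS.
have h : (n.+1.*2.+1 * n.*2.+1 <= 4 * n.+1 ^ 2)%N by rewrite -!muln2; lia.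
rewrite [(16 ^ n.+1)%N]expnS.
move: h IH; move: ('C(_, _)) (16 ^ n)%N => b e h IH.
rewrite -!mulnn in h IH *.
have -> : (n.+1.*2.+1 * (2 * (n.*2.+1 * b) * (2 * (n.*2.+1 * b))) =
  4 * ((n.+1.*2.+1 * n.*2.+1) * (n.*2.+1 * (b * b))))%N by lia.
have -> : (16 * e * (n.+1 * n.+1) = 4 * ((4 * (n.+1 * n.+1)) * e))%N by lia.
by rewrite leq_mul2l /=; apply: leq_mul.
Qed.

End CentralBinomial.

Section Averages.
Context {R : realType}.
Implicit Types (z : int -> R) (k : int).

Definition fdiff z : int -> R := fun k => z (k + 1) - z k.
Definition favg z : int -> R := fun k => (z k + z (k + 1)) / 2.

Lemma fdiff_favg z : fdiff (favg z) = favg (fdiff z).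
Proof. by apply/funext => k; rewrite /fdiff /favg; field. Qed.

Lemma iter_favgE N z k :
  iter N favg z k = (2 ^+ N)^-1 * \sum_(0 <= j < N.+1) 'C(N, j)%:R * z (k + j%:Z).
Proof.
elim: N k => [|N IH] k.
  by rewrite big_nat1 bin0 expr0 invr1 !mul1r addr0.
rewrite iterS /favg !IH.
have -> : \sum_(0 <= j < N.+2) 'C(N.+1, j)%:R * z (k + j%:Z) =
    \sum_(0 <= j < N.+1) 'C(N, j)%:R * z (k + j%:Z) +
    \sum_(0 <= j < N.+1) 'C(N, j)%:R * z (k + 1 + j%:Z).
  rewrite [LHS]big_nat_recl // bin0.
  under eq_bigr do rewrite binS natrD mulrDl.
  rewrite big_split /= [X in _ + (X + _)]big_nat_recr //= bin_small // mul0r addr0.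
  rewrite addrA; congr (_ + _).
    by rewrite [RHS]big_nat_recl // bin0 !addr0.
  by apply: eq_bigr => j _; rewrite -addrA.
by rewrite exprS; field; rewrite expf_neq0.
Qed.

Lemma harmonic_squeeze (a C : R) : 0 <= a -> (forall n, a <= C / n.*2.+1%:R) -> a = 0.
Proof.
move=> a0 h; apply/le_anti; rewrite a0 andbT leNgt; apply/negP => a1.
have C0 : 0 <= C by have := h 0%N; rewrite divr1; exact: le_trans.
have := archi_boundP (divr_ge0 C0 a0).
set n := Num.bound _; rewrite ltr_pdivrMr // => lt.
have := h n; rewrite ler_pdivlMr ?ltr0n // mulrC => le.
have : n%:R * a <= n.*2.+1%:R * a.
  by apply: ler_wpM2r => //; rewrite ler_nat -addnn; lia.
by move=> /(lt_le_trans lt) /lt_le_trans /(_ le); rewrite ltxx.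
Qed.

(* Summation by parts. *)
Lemma abel_monotone (b a : nat -> R) n Y : (forall j, `|a j| <= Y) -> 0 <= b 0%N ->
  (forall j, (j < n)%N -> b j <= b j.+1) ->
  `|\sum_(0 <= j < n) b j * (a j.+1 - a j) - b n * a n| <= b n * Y.
Proof.
move=> aY b0; elim: n => [_|n IH bm].
  by rewrite big_nil sub0r normrN normrM ger0_norm // ler_wpM2l.
have {}IH := IH (fun j jn => bm j (ltnW jn)).
rewrite big_nat_recr //=.
have -> : \sum_(0 <= i < n) b i * (a i.+1 - a i) + b n * (a n.+1 - a n) -
    b n.+1 * a n.+1 = (\sum_(0 <= i < n) b i * (a i.+1 - a i) - b n * a n) -
    (b n.+1 - b n) * a n.+1 by ring.
apply: (le_trans (ler_normB _ _)).
have -> : b n.+1 * Y = b n * Y + (b n.+1 - b n) * Y by ring.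
apply: lerD => //; rewrite normrM ger0_norm ?subr_ge0 ?bm //.
by apply: ler_wpM2l; rewrite ?subr_ge0 ?bm.
Qed.

(** A sequence that rises to its peak and falls symmetrically has total variation at most twice the
    peak; the falling half is read in reverse and treated as a rising one. *)
Lemma abel_unimodal (b a : nat -> R) n Y : (forall j, `|a j| <= Y) -> 0 <= b 0%N ->
  (forall j, (j < n)%N -> b j <= b j.+1) ->
  (forall j, (j <= n.*2)%N -> b (n.*2 - j)%N = b j) ->
  `|\sum_(0 <= j < n.*2.+1) b j * (a j.+1 - a j)| <= 2 * b n * Y.
Proof.
move=> aY b0 bm bs.
have h1 := abel_monotone aY b0 bm.
pose a' j := a (n.*2.+1 - j)%N.
have h2 := abel_monotone (fun j => aY _ : `|a' j| <= Y) b0 bm.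
have nn : (n <= n.*2.+1)%N by rewrite -addnn; lia.
rewrite (big_cat_nat (n:=n)) //=.
have -> : \sum_(n <= j < n.*2.+1) b j * (a j.+1 - a j) =
    - \sum_(0 <= j < n.+1) b j * (a' j.+1 - a' j).
  rewrite big_nat_rev /= -{1}(add0n n) big_addn.
  have -> : (n.*2.+1 - n = n.+1)%N by rewrite -addnn; lia.
  rewrite -sumrN [LHS]big_nat [RHS]big_nat; apply: eq_bigr => j /andP[_ jn].
  have -> : (n + n.*2.+1 - (j + n).+1 = n.*2 - j)%N by lia.
  rewrite bs; last by rewrite -addnn; lia.
  rewrite /a' subSS -mulrN opprB.
  by rewrite subSn // -addnn; lia.
(* The term at the peak supplies exactly the boundary terms of both summations by parts. *)
rewrite big_nat_recr //= opprD.
have -> : a' n.+1 = a n by rewrite /a' subSS; congr a; rewrite -addnn; lia.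
set s1 := \sum_(0 <= i < n) b i * (a i.+1 - a i) in h1 *.
set s2 := \sum_(0 <= i < n) b i * (a' i.+1 - a' i) in h2 *.
have -> : s1 + (- s2 - b n * (a n - a' n)) =
  (s1 - b n * a n) - (s2 - b n * a' n) by ring.
apply: (le_trans (ler_normB _ _)).
have -> : 2 * b n * Y = b n * Y + b n * Y by ring.
exact: lerD.
Qed.

(** The average has binomial weights, which increase up to C(2n,n) and then decrease symmetrically,
    so summation by parts moves the difference onto them. *)
Lemma fdiff_iter_favg n z Y : (forall k, `|z k| <= Y) ->
  forall k, `|fdiff (iter n.*2 favg z) k| <= 2 * ('C(n.*2, n)%:R / 4 ^+ n) * Y.
Proof.
move=> zY k; rewrite /fdiff !iter_favgE -mulrBr -sumrB.
have -> : (2 : R) ^+ n.*2 = 4 ^+ n by rewrite -mul2n exprM; congr (_ ^+ _); ring.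
rewrite normrM normfV [`|4 ^+ n|]ger0_norm ?exprn_ge0 // mulrC ler_pdivrMr ?exprn_gt0 //.
have -> : 2 * ('C(n.*2, n)%:R / 4 ^+ n) * Y * 4 ^+ n = 2 * 'C(n.*2, n)%:R * Y :> R.
  by field; rewrite expf_neq0.
have inc j : (j < n)%N -> 'C(n.*2, j)%:R <= 'C(n.*2, j.+1)%:R :> R.
  move=> jn; rewrite ler_nat; have := mul_bin_left n.*2 j; rewrite -addnn.
  move: ('C(_, j.+1)) ('C(_, j)) => p q e.
  by rewrite -(leq_pmul2l (ltn0Sn j)) e leq_mul2r; apply/orP; right; lia.
have sym j : (j <= n.*2)%N -> 'C(n.*2, n.*2 - j)%:R = 'C(n.*2, j)%:R :> R.
  by move=> jn; rewrite bin_sub.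
have := @abel_unimodal (fun j => 'C(n.*2, j)%:R) (fun j => z (k + j%:Z)) n Y
  (fun j => zY _) (ler0n _ _) inc sym.
apply: le_trans; rewrite le_eqVlt; apply/orP; left; apply/eqP.
congr (`| _ |); apply: eq_bigr => j _; rewrite mulrBr.
by congr (_ * z _ - _); rewrite -addrA; congr (k + _); rewrite addrC.
Qed.

Lemma central_ratio n : (('C(n.*2, n)%:R / 4 ^+ n) ^+ 2 : R) <= (n.*2.+1%:R)^-1.
Proof.
rewrite expr_div_n -exprM mulnC exprM (_ : 4 ^+ 2 = 16 :> R); last by ring.
rewrite ler_pdivrMr ?exprn_gt0 // mulrC ler_pdivlMr ?ltr0n // mulrC.
by rewrite -!natrX -natrM ler_nat central_bin_bound.
Qed.

Lemma iter_fdiff_favg z n K : iter K fdiff (iter n favg z) = iter n favg (iter K fdiff z).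
Proof.
have c1 m w : fdiff (iter m favg w) = iter m favg (fdiff w).
  by elim: m => [//|m IH] /=; rewrite fdiff_favg IH.
by elim: K => [//|K IH] /=; rewrite IH c1.
Qed.

(** Differences commute with averages, so the averages are dealt out in [K] blocks of length 2n, one
    for each difference. *)
Lemma iter_fdiff_bound n K z Y : (forall k, `|z k| <= Y) ->
  forall k, `|iter K fdiff (iter (K * n.*2) favg z) k| <=
    (2 * ('C(n.*2, n)%:R / 4 ^+ n)) ^+ K * Y.
Proof.
move=> zY; elim: K => [|K IH] k; first by rewrite mul1r.
rewrite iterS iter_fdiff_favg mulSn iterD -iter_fdiff_favg.
by rewrite exprS -mulrA mulrA -[leRHS]mulrA; apply: fdiff_iter_favg.
Qed.

(** Differences are removed one at a time: a bounded sequence with constant difference is an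
    arithmetic progression, hence constant. *)
Lemma fdiff_bounded_zero z Y K : (forall k, `|z k| <= Y) ->
  iter K.+1 fdiff z = (fun=> 0) -> fdiff z = (fun=> 0).
Proof.
move=> zY; elim: K => [//|K IH] h; apply: IH.
set w := iter K fdiff z.
have [W wW] : exists W, forall k, `|w k| <= W.
  rewrite /w; elim: (K) => [|L [W hW]]; first by exists Y.
  exists (W + W) => k /=; apply: (le_trans (ler_normB _ _)).
  exact: lerD.
have hc k : fdiff w (k + 1) = fdiff w k.
  by apply/eqP; rewrite -subr_eq0; apply/eqP; exact: (congr1 (fun u => u k) h).
have wE k (n : nat) : w (k + n%:Z) = w k + n%:R * fdiff w k.
  elim: n => [|n IHn]; first by rewrite addr0 mul0r addr0.
  have cst m : fdiff w (k + m%:Z) = fdiff w k.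
    elim: m => [|m IHm]; first by rewrite addr0.
    by rewrite intS (addrC 1) addrA hc.
  have -> : w (k + n.+1%:Z) = w (k + n%:Z) + fdiff w (k + n%:Z).
    by rewrite /fdiff intS (addrC 1) addrA [RHS]addrCA subrr addr0.
  by rewrite cst IHn -natr1; ring.
apply/funext => k /=; rewrite -/w; apply/normr0_eq0.
apply: (@harmonic_squeeze _ (W + W)) => // n; rewrite ler_pdivlMr ?ltr0n // mulrC.
have -> : n.*2.+1%:R * `|fdiff w k| = `|w (k + n.*2.+1%:Z) - w k|.
  by rewrite wE addrC addKr normrM normr_nat.
by apply: (le_trans (ler_normB _ _)); exact: lerD.
Qed.

(* [y 0] is, up to a shift, a [2 n]-fold average of [y n]: taking [2 K] differences
   gains a factor of order [n ^- K], which beats the growth of [y n], so that some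
   difference of [y 0] vanishes; as [y 0] is bounded, already the first one does. *)
Lemma averaged_constant (y : nat -> int -> R) (B : R) (D : nat) :
  (forall n k, y n (k + 1) = favg (favg (y n.+1)) k) ->
  (forall n k, `|y n k| <= B * n.+1%:R ^+ D) ->
  forall k, y 0%N (k + 1) = y 0%N k.
Proof.
move=> yE yB.
have B0 : 0 <= B by have := yB 0%N 0; rewrite expr1n mulr1; exact: le_trans.
have yn n k : y 0%N (k + n%:Z) = iter n.*2 favg (y n) k.
  elim: n k => [|n IH] k; first by rewrite addr0.
  rewrite intS (addrC 1) addrA [k + _ + _]addrAC IH.
  have -> : (y n) = fun l => favg (favg (y n.+1)) (l - 1).
    by apply/funext => l; rewrite -yE subrK.
  have shift m (w : int -> R) l : iter m favg (fun l => w (l - 1)) l = iter m favg w (l - 1).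
    by elim: m l => [//|m IHm] l /=; rewrite /favg !IHm addrAC.
  by rewrite shift addrK doubleS -iterSr -iterSr.
(* Each difference gains a square root, so [K] of them gain the power D + 1 of 2n + 1, one more than
   the growth of [y]. *)
pose K := D.+1.*2.
have main k n : `|iter K fdiff (y 0%N) k| <= B * 4 ^+ D.+1 * K%:R ^+ D / n.*2.+1%:R.
  (* The sequence [y 0] is written as an average of length 2Kn of [y (K n)], which leaves 2n
     averages for each of the [K] differences. *)
  have -> : iter K fdiff (y 0%N) k =
      iter K fdiff (iter (K * n.*2) favg (y (K * n)%N)) (k - (K * n)%N%:Z).
    have sh m (w : int -> R) a l : iter m fdiff (fun l => w (l + a)) l = iter m fdiff w (l + a).
      by elim: m l => [//|m IHm] l /=; rewrite /fdiff !IHm addrAC.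
    rewrite -{1}(subrK ((K * n)%N%:Z) k) -(sh K (y 0%N) (K * n)%N%:Z).
    have -> // : (fun l => y 0%N (l + (K * n)%N%:Z)) = iter (K * n.*2) favg (y (K * n)%N).
    by apply/funext => l; rewrite yn doubleMr.
  apply: (le_trans (iter_fdiff_bound n K (yB _) _)).
  have -> : (2 * ('C(n.*2, n)%:R / 4 ^+ n)) ^+ K =
      4 ^+ D.+1 * (('C(n.*2, n)%:R / 4 ^+ n) ^+ 2) ^+ D.+1 :> R.
    move: ('C(n.*2, n)%:R / 4 ^+ n) => r.
    by rewrite /K -(mul2n D.+1) exprM -exprMn; congr (_ ^+ _); ring.
  have nn0 : 0 < n.*2.+1%:R :> R by rewrite ltr0n.
  apply: (@le_trans _ _ (4 ^+ D.+1 * (n.*2.+1%:R)^-1 ^+ D.+1 *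
      (B * (K%:R * n.*2.+1%:R) ^+ D))).
    apply: ler_pM.
    - by rewrite mulr_ge0 ?exprn_ge0 // sqr_ge0.
    - by rewrite mulr_ge0 ?exprn_ge0.
    - apply: ler_wpM2l; rewrite ?exprn_ge0 //.
      apply: lerXn2r; rewrite ?nnegrE ?sqr_ge0 ?invr_ge0 //.
      exact: central_ratio.
    - apply: ler_wpM2l => //; apply: lerXn2r; rewrite ?nnegrE ?mulr_ge0 //.
      by rewrite -natrM ler_nat /K -addnn; nia.
  rewrite exprMn [_ ^-1 ^+ _.+1]exprS exprVn le_eqVlt; apply/orP; left; apply/eqP.
  by field; rewrite expf_neq0 ?gt_eqF //=.
have zero : iter K fdiff (y 0%N) = (fun=> 0).
  by apply/funext => k; apply/normr0_eq0; exact: harmonic_squeeze (main k).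
move=> k; apply/eqP; rewrite -subr_eq0; apply/eqP.
have y0B l : `|y 0%N l| <= B by have := yB 0%N l; rewrite expr1n mulr1.
exact: (congr1 (fun u => u k) (fdiff_bounded_zero y0B zero)).
Qed.

End Averages.

(** * Period two of the functionals *)

Section Periodicity.
Context {R : realType} {d : nat}.
Implicit Types (f g h p : 'rV[R]_d -> R) (x : 'rV[R]_d).

Definition linear_on_schwartz (U : ('rV[R]_d -> R) -> R) :=
  forall (a b : R) f g, rschwartz f -> rschwartz g ->
    U (fun x => a * f x + b * g x) = a * U f + b * U g.

Lemma shifted_period2 p (tau : int -> ('rV[R]_d -> R) -> R) (n N : nat) (C : R) :
  smult p -> (forall k, linear_on_schwartz (tau k)) ->
  (forall k g, rschwartz g -> tau k (fun x => p x * g x) = tau (k + 1) g) ->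
  (forall k g B, rschwartz g -> bnd n N B g -> `|tau k g| <= C * B) ->
  forall k g, rschwartz g -> tau (k + 2) g = tau k g.
Proof.
move=> mp tau_lin tau_shift tau_bnd k0 g rg.
pose r x := (1 + p x ^+ 2)^-1.
pose c x := 4 * p x ^+ 2 * r x ^+ 2.
have q1 x : 1 <= 1 + p x ^+ 2 by rewrite lerDl sqr_ge0.
have mp2 : smult (fun x => p x ^+ 2) := smult_exp 2 mp.
have mr : smult r by apply: smult_inv => //; apply: smult_add => //; exact: smult_cst.
have mc : smult c.
  by apply: smult_mul; [exact: (smult_mul (smult_cst 4) mp2)|exact: smult_exp].
have c1 x : `|c x| <= 1.
  have r0 : 0 <= r x by rewrite invr_ge0 (le_trans ler01).
  rewrite ger0_norm; last exact: mulr_ge0 (mulr_ge0 (ler0n _ 4) (sqr_ge0 _)) (sqr_ge0 _).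
  rewrite /c /r exprVn ler_pdivrMr ?exprn_gt0 ?(lt_le_trans ltr01) // mul1r.
  (* This is (1 + p^2)^2 - 4 p^2 = (p^2 - 1)^2. *)
  by have := sqr_ge0 (p x ^+ 2 - 1); nra.
have cE x : c x * (1 + p x ^+ 2) ^+ 2 = 4 * p x ^+ 2.
  by rewrite /c /r; field; rewrite gt_eqF // (lt_le_trans ltr01).
have rc m : rschwartz (fun x => c x ^+ m * g x) by exact: (smult_exp m mc).2.
have [B B0 hB] := smult_pow_growth n N mc c1 rg.
pose y m (k : int) : R := tau (k0 + k *+ 2) (fun x => c x ^+ m * g x).
have shift2 k f : rschwartz f -> tau k (fun x => p x ^+ 2 * f x) = tau (k + 2) f.
  move=> rf; have := tau_shift k _ (mp.2 f rf).
  rewrite (tau_shift (k + 1) f rf) -addrA (_ : 1 + 1 = 2 :> int) // => <-.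
  by congr (tau _ _); apply/funext => x; rewrite expr2 mulrA.
have yE m k : y m (k + 1) = favg (favg (y m.+1)) k.
  rewrite /favg /y; set f := fun x => c x ^+ m.+1 * g x.
  have rf : rschwartz f := rc m.+1.
  have -> : tau (k0 + (k + 1) *+ 2) (fun x => c x ^+ m * g x) =
      4^-1 * (4 * tau (k0 + k *+ 2) (fun x => p x ^+ 2 * (c x ^+ m * g x))).
    rewrite mulKf // (shift2 _ _ (rc m)) mulrnDl addrA; congr (tau _ _).
  have r2 := mp2.2 f rf; have r4 := mp2.2 _ r2.
  (* With f = c^(m+1) g, the definition of c gives 4 p^2 c^m g = (1 + p^2)^2 f = f + 2 p^2 f + p^4
     f; each factor p^2 is one step of the shift. *)
  have -> : 4 * tau (k0 + k *+ 2) (fun x => p x ^+ 2 * (c x ^+ m * g x)) =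
      tau (k0 + k *+ 2) f + 2 * tau (k0 + k *+ 2) (fun x => p x ^+ 2 * f x) +
      tau (k0 + k *+ 2) (fun x => p x ^+ 2 * (p x ^+ 2 * f x)).
    have rm := mp2.2 _ (rc m).
    have e1 := tau_lin (k0 + k *+ 2) 4 0 _ _ rm rm.
    have rf2 : rschwartz (fun x => 1 * f x + 2 * (p x ^+ 2 * f x)).
      by apply: rschwartz_add; exact: rschwartz_scale.
    have e2 := tau_lin (k0 + k *+ 2) 1 1 _ _ rf2 r4.
    have e3 := tau_lin (k0 + k *+ 2) 1 2 _ _ rf r2.
    rewrite mul0r addr0 in e1; rewrite -e1.
    rewrite e3 !mul1r in e2; rewrite -e2; congr (tau _ _); apply/funext => x.
    rewrite /f (exprS (c x) m); transitivity ((c x * (1 + p x ^+ 2) ^+ 2) * c x ^+ m * g x).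
      by rewrite cE; ring.
    ring.
  rewrite !(shift2 _ _ rf) (shift2 _ _ r2) (shift2 _ _ rf).
  have -> : k0 + k *+ 2 + 2 = k0 + (k + 1) *+ 2 by rewrite mulrnDl -addrA.
  have -> : k0 + (k + 1) *+ 2 + 2 = k0 + (k + 1 + 1) *+ 2.
    by rewrite [in RHS]mulrnDl -addrA.
  by field.
have yB m k : `|y m k| <= (C * B) * m.+1%:R ^+ n.
  by rewrite -mulrA; apply: tau_bnd; [exact: rc|exact: hB].
have := averaged_constant yE yB 0.
rewrite /y mul0rn addr0 add0r.
rewrite (_ : (fun x => c x ^+ 0 * g x) = g) //.
by apply/funext => x; rewrite mul1r.
Qed.

End Periodicity.

(** * Cutoff functions *)

Section FlatFunction.
Context {R : realType}.

(** The classical exp (- 1 / t), extended by 0, together with its products by powers of 1 / t: the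
    extra index makes the linear span stable under derivatives. *)
Definition flat (m : nat) (t : R) : R := if 0 < t then t^-1 ^+ m * expR (- t^-1) else 0.

Lemma flat_ge0 m t : 0 <= flat m t.
Proof.
rewrite /flat; case: ifP => // t0.
by rewrite mulr_ge0 ?expR_ge0 // exprn_ge0 // invr_ge0 ltW.
Qed.

(** The term of order m + 2 in the series of exp (1 / t) dominates. A quadratic bound is what makes
    the derivative at 0 exist and vanish. *)
Lemma flat_le m t : flat m t <= m.+2`!%:R * t ^+ 2.
Proof.
rewrite /flat; case: ifPn => [t0|_]; last by rewrite mulr_ge0 ?sqr_ge0.
rewrite expRN ler_pdivrMr ?expR_gt0 //.
have ti0 : 0 <= t^-1 by rewrite invr_ge0 ltW.
have h : t^-1 ^+ m.+2 / m.+2`!%:R <= expR t^-1.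
  by apply: le_trans (expR_ge1Dxn m.+1 ti0); rewrite lerDr.
have f0 : (0 : R) < m.+2`!%:R by rewrite ltr0n fact_gt0.
rewrite ler_pdivrMr // in h.
have -> : t^-1 ^+ m = t^-1 ^+ m.+2 * t ^+ 2.
  by rewrite !exprS; field; rewrite gt_eqF.
have := ler_wpM2r (sqr_ge0 t) h; rewrite -mulrA [_ * t ^+ 2]mulrC.
by move=> /le_trans; apply; rewrite le_eqVlt; apply/orP; left; apply/eqP; ring.
Qed.

Lemma is_derive_quadratic0 (f : R -> R) C : f 0 = 0 ->
  (forall t, `|f t| <= C * t ^+ 2) -> is_derive (0 : R) (1 : R) f 0.
Proof.
move=> f0 hf.
have lim : h^-1 *: ((f \o shift 0) (h *: (1 : R)) - f 0) @[h --> 0^'] --> (0 : R).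
  apply/cvgrPdist_lt => e e0.
  have C0 : 0 < `|C| + 1 by rewrite ltr_wpDl.
  near=> h.
  have h0 : h != 0 by near: h; exact: nbhs_dnbhs_neq.
  rewrite sub0r normrN f0 subr0 /= addr0 [h *: 1]mulr1 [_ *: _]/(_ * _).
  rewrite normrM normfV mulrC ltr_pdivrMr ?normr_gt0 //.
  apply: le_lt_trans (hf h) _; rewrite -(real_normK (num_real h)) expr2 mulrA.
  rewrite ltr_pM2r ?normr_gt0 //.
  apply: (@le_lt_trans _ _ ((`|C| + 1) * `|h|)).
    by apply: ler_wpM2r => //; apply: le_trans (ler_norm _) _; rewrite lerDl.
  rewrite mulrC -ltr_pdivlMr //.
  near: h; apply: nbhs_dnbhs; apply/nbhs_normP.
  exists (e / (`|C| + 1)); first exact: divr_gt0.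
  by move=> y /=; rewrite sub0r normrN.
split; first by apply/cvg_ex; exists 0.
exact/cvg_lim.
Unshelve. all: by end_near. Qed.

Lemma is_derive_flat m (t : R) :
  is_derive t (1 : R) (flat m) (1 * flat m.+2 t + (- m%:R) * flat m.+1 t).
Proof.
have [t0|t0|->] := ltgtP t 0.
- have e : \near t, cst 0 t = flat m t.
    near=> s; rewrite /flat ltNge le_eqVlt.
    suff -> : s < 0 by rewrite orbT.
    by near: s; exact: lt_nbhsl.
  apply: (near_eq_is_derive e).
  rewrite /flat ltNge ltW //= !mulr0 addr0; exact: is_derive_cst.
- have e : \near t, t^-1 ^+ m * expR (- t^-1) = flat m t.
    near=> s; rewrite /flat.
    suff -> : 0 < s by [].
    by near: s; exact: lt_nbhsr.
  apply: (near_eq_is_derive e).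
  have tn0 : t != 0 by rewrite gt_eqF.
  have h1 := is_deriveVf tn0 (is_derive_id t (1 : R)).
  have h2 : is_derive t (1 : R) (fun t : R => - t^-1) (t^-1 ^+ 2).
    have h := is_deriveN h1.
    by apply: is_derive_eq; rewrite mulN1r opprK.
  have h3 := @is_derive1_comp R expR (fun t => - t^-1) t _ _ (is_derive_expR _) h2.
  have h4 := is_deriveMf (is_derive_exp m h1) h3.
  apply: is_derive_eq; rewrite /flat t0 /=.
  by case: m {e h4} => [|m] /=; rewrite !exprS; ring.
- rewrite /flat ltxx !mulr0 addr0.
  apply: (@is_derive_quadratic0 (flat m) m.+2`!%:R).
    by rewrite /flat ltxx.
  by move=> s; rewrite ger0_norm ?flat_ge0 ?flat_le.
Unshelve. all: by end_near. Qed.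

End FlatFunction.

Lemma derive_locally0 {R : realType} (V : normedModType R) (f : V -> R) (x v : V) (e : R) :
  0 < e -> (forall y, `|x - y| < e -> f y = 0) -> 'D_v f x = 0.
Proof.
move=> e0 h; have near0 : \forall y \near x, f y = cst 0 y.
  by apply/nbhs_normP; exists e => // y /=; exact: h.
by rewrite (near_eq_derive _ near0); exact: derive_cst.
Qed.

Section Bump.
Context {R : realType} {d : nat}.
Implicit Types (f g h : 'rV[R]_d -> R) (x : 'rV[R]_d) (i j : 'I_d).

Inductive flat_span (l : 'rV[R]_d -> R) : ('rV[R]_d -> R) -> Prop :=
| FlatSpan1 m : flat_span l (fun x => flat m (l x))
| FlatSpanL (a b : R) u v : flat_span l u -> flat_span l v ->
    flat_span l (fun x => a * u x + b * v x).

Lemma smooth_flat (e : R) j : smooth (fun x => flat 0 (1 + e * x 0 j)).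
Proof.
pose l x := 1 + e * x 0 j.
have cl : continuous l.
  by apply: smooth_continuous; apply: smooth_add; [exact: smooth_cst|
    apply: smooth_scale; exact: smooth_coord].
have Dl i x : is_derive x (evec i) l (e * (i == j)%:R).
  have h1 : is_derive x (evec i) (fun x => e * x 0 j) (e * (i == j)%:R)
    := is_deriveZ (e : R) (is_derive_coord x i j).
  have h := is_deriveDf (is_derive_cst (1 : R) x (evec i)) h1.
  by apply: is_derive_eq; rewrite add0r.
have Df m i x : is_derive x (evec i) (fun x => flat m (l x))
    ((1 * flat m.+2 (l x) + (- m%:R) * flat m.+1 (l x)) * (e * (i == j)%:R)).
  exact: (is_derive_comp1 (is_derive_flat m (l x)) (Dl i x)).
apply: (@smooth_coind _ _ (flat_span l)); last exact: FlatSpan1.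
move=> u; elim=> {u} [m|a b u v _ [cu du pu] _ [cv dv pv]].
- split.
  + move=> x; apply: (@continuous_comp _ _ _ l (flat m)); first exact: cl.
    apply/differentiable_continuous/derivable1_diffP.
    by case: (is_derive_flat m (l x)).
  + by move=> i x; case: (Df m i x).
  + move=> i; rewrite (pdE (Df m i)).
    have := FlatSpanL (e * (i == j)%:R) (- (m%:R * (e * (i == j)%:R)))
      (FlatSpan1 l m.+2) (FlatSpan1 l m.+1).
    by congr flat_span; apply/funext => x; ring.
- split.
  + have ca := continuous_mul (@cst_continuous _ _ a) cu.
    have cb := continuous_mul (@cst_continuous _ _ b) cv.
    by move=> x; exact: (cvgD (ca x) (cb x)).
  + move=> i x.
    by case: (is_derive_lin a b (is_derive_pd i x du) (is_derive_pd i x dv)).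
  + by move=> i; rewrite pd_lin //; exact: FlatSpanL.
Qed.

(** For the maximum norm the unit ball is a cube, so a product over the coordinates is supported in
    it; the prefactors normalise the value at the origin to 1. *)
Definition bump x : R :=
  \prod_j ((flat 0 1)^-1 ^+ 2 * (flat 0 (1 + 1 * x 0 j) * flat 0 (1 + (- 1) * x 0 j))).

Lemma smooth_bump : smooth bump.
Proof.
apply: smooth_prod => j; apply: smooth_scale.
exact: (smooth_mul (smooth_flat 1 j) (smooth_flat (- 1) j)).
Qed.

Lemma bump0 : bump 0 = 1.
Proof.
rewrite /bump big1 // => j _; rewrite mxE !mulr0 addr0.
have : flat 0 1 != 0 :> R by rewrite /flat ltr01 expr0 mul1r gt_eqF // expR_gt0.
by move=> h; field.
Qed.

Lemma bump_support x : 1 <= `|x| -> bump x = 0.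
Proof.
move=> x1; have [x0|[j xj]] := norm_coord x; first by rewrite x0 ler10 in x1.
rewrite /bump (bigD1 j) //=.
have [xp|xn] := leP 0 (x 0 j).
  have h : (0 < 1 + (- 1) * x 0 j) = false.
    by rewrite xj ger0_norm // in x1; apply/negbTE; rewrite -leNgt; lra.
  by rewrite [flat 0 (1 + -1 * _)]/flat h !mulr0 mul0r.
have h : (0 < 1 + 1 * x 0 j) = false.
  by rewrite xj ltr0_norm // in x1; apply/negbTE; rewrite -leNgt; lra.
by rewrite [flat 0 (1 + 1 * _)]/flat h mul0r mulr0 mul0r.
Qed.

(** Derivatives vanish on the open set where [f] vanishes identically, and on a compact ball the
    weighted derivatives attain their maximum. *)
Lemma rschwartz_compact f (K : R) : smooth f ->
  (forall x, K < `|x| -> f x = 0) -> rschwartz f.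
Proof.
move=> sf f0.
have fs s x : K < `|x| -> partial s f x = 0.
  elim: s x => [|i s IH] x Kx; first exact: f0.
  rewrite partial_cons /pd.
  have K0 : 0 < `|x| - K by rewrite subr_gt0.
  apply: (@derive_locally0 R 'rV[R]_d (partial s f) x (evec i) _ K0) => y yx; apply: IH.
  by have := ler_normD (x - y) y; rewrite subrK; lra.
apply: rschwartzP => // s N.
pose A : set 'rV[R]_d := [set x | `|x| <= `|K|].
have A0 : A 0 by rewrite /A /= normr0.
have cA : compact A.
  apply: bounded_closed_compact.
    exists `|K|; split; first exact: num_real.
    by move=> M KM x /= xK; apply: le_trans xK (ltW KM).
  apply: (closed_comp _ (@closed_le R `|K|)) => x _.
  exact: norm_continuous.
pose g x := wt N x * `|partial s f x|.
have cg : continuous g.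
  apply: continuous_mul; last first.
    have cs := smooth_continuous (smooth_partial s sf).
    move=> x; apply: (@continuous_comp _ _ _ (partial s f) (fun y : R => `|y|)).
      exact: cs.
    exact: norm_continuous.
  elim: (N) => [|M IH]; first exact: cst_continuous.
  rewrite (_ : wt M.+1 = fun x => (1 + `|x|) * wt M x); last first.
    by apply/funext => x; rewrite wtS.
  apply: continuous_mul => //.
  apply: (@lipschitz_continuousf _ _ _ _ 1) => x y.
  by rewrite mul1r opprD addrACA subrr add0r; exact: ler_dist_dist.
have [c cin cmax] := EVT_max_rV (ex_intro _ 0 A0) cA (continuous_subspaceT cg).
exists (g c) => x; have [xK|Kx] := leP `|x| `|K|.
  by apply: cmax; rewrite inE.
rewrite fs ?normr0 ?mulr0; first by rewrite mulr_ge0 ?wt_ge0.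
exact: le_lt_trans (ler_norm _) Kx.
Qed.

Lemma dilate_affine (e : R) : coord_affine (fun x : 'rV[R]_d => e *: x) (fun i => i) e.
Proof. by move=> x i s; rewrite scalerDr scalerA. Qed.

Lemma smooth_dilate (e : R) h : smooth h -> smooth (fun x => h (e *: x)).
Proof. by move=> sh; exact: (smooth_affine (dilate_affine e) sh).1. Qed.

Lemma pd_dilate (e : R) h i : smooth h ->
  pd i (fun x => h (e *: x)) = fun x => e * pd i h (e *: x).
Proof.
move=> sh; apply: pdE => x.
exact: (coord_affine_pd i (dilate_affine e) (smooth_derivable sh) x).
Qed.

Lemma rschwartz_sup h : rschwartz h -> exists2 B, 0 <= B & forall x, `|h x| <= B.
Proof.
move=> rh; have [B hB] := rschwartz_bnd 0 0 rh.
exists B; first exact: bnd_ge0 hB.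
by move=> x; have := hB [::] isT x; rewrite /wt mul1r.
Qed.

(** The decay is provided by [g] alone, and each derivative falling on the dilated factor costs
    [e <= 1]; hence a bound uniform in [e], including [e = 0]. *)
Lemma bnd_dilate n N g h : rschwartz g -> rschwartz h ->
  exists2 B, 0 <= B & forall e : R, 0 <= e <= 1 ->
    bnd n N B (fun x => g x * h (e *: x)).
Proof.
elim: n g h => [|n IH] g h rg rh.
  have [B hB] := rschwartz_bnd 0 N rg; have [C C0 hC] := rschwartz_sup rh.
  exists (B * C); first exact: mulr_ge0 (bnd_ge0 hB) C0.
  move=> e _; apply: bnd0 => x; rewrite normrM mulrA.
  apply: ler_pM => //; first by rewrite mulr_ge0 // wt_ge0.
  exact: (hB [::]).
have [B0 B00 hB0] := IH g h rg rh.
have /choice[B hB] : forall i, exists B, 0 <= B /\ forall e : R, 0 <= e <= 1 ->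
    bnd n N B (pd i (fun x => g x * h (e *: x))).
  move=> i; have rgi := rschwartz_pd i rg; have rhi := rschwartz_pd i rh.
  have [B1 B10 hB1] := IH _ _ rgi rh; have [B2 B20 hB2] := IH _ _ rg rhi.
  exists (B1 + B2); split; first exact: addr_ge0.
  move=> e e01; have /andP[e0 e1] := e01.
  have se := smooth_dilate e rh.1; have sei := smooth_dilate e rhi.1.
  rewrite pd_mul; [|exact: smooth_derivable rg.1|exact: smooth_derivable se].
  rewrite (pd_dilate e i rh.1).
  have h2 := bnd_scale e (smooth_mul rg.1 sei) (hB2 e e01).
  have h3 := bnd_add (smooth_mul rgi.1 se) (smooth_scale e (smooth_mul rg.1 sei))
    (hB1 e e01) h2.
  have -> : (fun x => pd i g x * h (e *: x) + g x * (e * pd i h (e *: x))) =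
      (fun x => pd i g x * h (e *: x) + e * (g x * pd i h (e *: x))).
    by apply/funext => x; rewrite mulrCA.
  apply: bnd_mono h3 => //; rewrite lerD2l ger0_norm //.
  by rewrite ler_piMl.
exists (B0 + \sum_i B i).
  by rewrite addr_ge0 // sumr_ge0 // => i _; case: (hB i).
move=> e e01; apply: bnd_unif => [|i]; last exact: (hB i).2.
by apply: bnd_mono (hB0 e e01).
Qed.

(** Since [chi 0 = 1], the Lipschitz estimate bounds 1 - chi (e x) by a multiple of e |x|, and |x|
    is paid for by one more power of the weight. A derivative falling on the cutoff brings the
    factor [e] by itself. *)
Lemma bnd_cutoff n N g chi : rschwartz g -> rschwartz chi -> chi 0 = 1 ->
  exists2 B, 0 <= B & forall e : R, 0 <= e <= 1 ->
    bnd n N (e * B) (fun x => g x * (1 - chi (e *: x))).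
Proof.
move=> rg rchi chi0.
have /choice[L hL] : forall i, exists B, 0 <= B /\ forall x, `|pd i chi x| <= B.
  by move=> i; have [B B0 hB] := rschwartz_sup (rschwartz_pd i rchi); exists B.
have L0 : 0 <= \sum_i L i by rewrite sumr_ge0 // => i _; case: (hL i).
have hsum i x : `|pd i chi x| <= \sum_i L i.
  apply: (le_trans ((hL i).2 x)).
  by rewrite (bigD1 i) //= lerDl sumr_ge0 // => k _; case: (hL k).
have lip x : `|1 - chi x| <= (d%:R * \sum_i L i) * `|x|.
  have := bounded_pd_lipschitz (smooth_derivable rchi.1) hsum 0 x.
  by rewrite chi0 subr0 distrC.
elim: n g rg => [|n IH] g rg.
  have [B hB] := rschwartz_bnd 0 N.+1 rg; have B0 := bnd_ge0 hB.
  exists ((d%:R * \sum_i L i) * B); first by rewrite !mulr_ge0.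
  move=> e /andP[e0 e1]; apply: bnd0 => x.
  rewrite normrM.
  apply: (@le_trans _ _ (wt N x * (`|g x| * ((d%:R * \sum_i L i) * (e * (1 + `|x|)))))).
    apply: ler_wpM2l; first exact: wt_ge0.
    apply: ler_wpM2l => //; apply: (le_trans (lip _)).
    rewrite normrZ ger0_norm //; apply: ler_wpM2l; first by rewrite mulr_ge0.
    by apply: ler_wpM2l => //; rewrite lerDr.
  have -> : wt N x * (`|g x| * ((d%:R * \sum_i L i) * (e * (1 + `|x|)))) =
      e * ((d%:R * \sum_i L i) * (wt N.+1 x * `|g x|)) by rewrite wtS; ring.
  apply: ler_wpM2l => //; apply: ler_wpM2l; first by rewrite mulr_ge0.
  exact: (hB [::]).
have schi (e : R) : smooth (fun x => 1 - chi (e *: x)).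
  have := smooth_add (smooth_cst 1) (smooth_scale (- 1) (smooth_dilate e rchi.1)).
  by congr smooth; apply/funext => x; rewrite mulN1r.
have [B0 B00 hB0] := IH g rg.
have /choice[B hB] : forall i, exists B, 0 <= B /\ forall e : R, 0 <= e <= 1 ->
    bnd n N (e * B) (pd i (fun x => g x * (1 - chi (e *: x)))).
  move=> i; have rgi := rschwartz_pd i rg; have rci := rschwartz_pd i rchi.
  have [B1 B10 hB1] := IH _ rgi; have [B2 B20 hB2] := bnd_dilate n N rg rci.
  exists (B1 + B2); split; first exact: addr_ge0.
  move=> e e01; have /andP[e0 e1] := e01.
  have sei := smooth_dilate e rci.1.
  have pdc : pd i (fun x => 1 - chi (e *: x)) = fun x => - (e * pd i chi (e *: x)).
    have := pd_lin i 1 (- 1) (smooth_derivable (smooth_cst 1))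
      (smooth_derivable (smooth_dilate e rchi.1)).
    rewrite pd_cst (pd_dilate e i rchi.1).
    rewrite (_ : (fun x => 1 * 1 + -1 * chi (e *: x)) = (fun x => 1 - chi (e *: x))).
      by move=> ->; apply/funext => x; ring.
    by apply/funext => x; ring.
  rewrite pd_mul; [|exact: smooth_derivable rg.1|exact: smooth_derivable (schi e)].
  rewrite pdc.
  have h2 := bnd_scale (- e) (smooth_mul rg.1 sei) (hB2 e e01).
  have h3 := bnd_add (smooth_mul rgi.1 (schi e)) (smooth_scale (- e) (smooth_mul rg.1 sei))
    (hB1 e e01) h2.
  have -> : (fun x => pd i g x * (1 - chi (e *: x)) + g x * - (e * pd i chi (e *: x))) =
      (fun x => pd i g x * (1 - chi (e *: x)) + - e * (g x * pd i chi (e *: x))).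
    by apply/funext => x; ring.
  by apply: bnd_mono h3 => //; rewrite normrN ger0_norm // mulrDr.
exists (B0 + \sum_i B i).
  by rewrite addr_ge0 // sumr_ge0 // => i _; case: (hB i).
move=> e e01; rewrite mulrDr mulr_sumr.
apply: bnd_unif => [|i]; last exact: (hB i).2.
by apply: bnd_mono (hB0 e e01).
Qed.

Lemma rschwartz_bump : rschwartz bump.
Proof.
apply: (@rschwartz_compact _ 1); first exact: smooth_bump.
by move=> x x1; apply: bump_support; exact: ltW.
Qed.

(** The inverse of [h] may grow arbitrarily at infinity, so [g] is cut off at radius 1 / e before
    the division. The functional kills the truncated part, and the remainder has size O(e). *)
Lemma nonvanishing_annihilator (U : ('rV[R]_d -> R) -> R) h n N C :
  linear_on_schwartz U ->
  (forall g B, rschwartz g -> bnd n N B g -> `|U g| <= C * B) ->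
  smooth h -> (forall x, h x != 0) ->
  (forall g, rschwartz g -> U (fun x => h x * g x) = 0) ->
  forall g, rschwartz g -> U g = 0.
Proof.
move=> Ulin Ubnd sh h0 Uh g rg.
have [B B0 hB] := bnd_cutoff n N rg rschwartz_bump bump0.
have C0 (e : R) : 0 < e <= 1 -> `|U g| <= e * (C * B).
  move=> /andP[e0 e1]; have sb := smooth_dilate e smooth_bump.
  pose g1 x := g x * bump (e *: x) * (h x)^-1.
  have rg1 : rschwartz g1.
    apply: (@rschwartz_compact _ e^-1).
      exact: smooth_mul (smooth_mul rg.1 sb) (smooth_inv sh h0).
    move=> x xe; rewrite /g1 bump_support ?mulr0 ?mul0r //.
    by rewrite normrZ gtr0_norm // -ler_pdivrMl // mulr1 ltW.
  have rg2 : rschwartz (fun x => h x * g1 x).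
    have -> : (fun x => h x * g1 x) = (fun x => g x * bump (e *: x)).
      by apply/funext => x; rewrite /g1 mulrC divfK.
    split; first exact: smooth_mul rg.1 sb.
    move=> n' N'; have [B' _ hB'] := bnd_dilate n' N' rg rschwartz_bump.
    by exists B'; apply: hB'; rewrite ltW.
  have := Ulin 1 (- 1) _ _ rg rg2; rewrite (Uh _ rg1) mulr0 addr0 mul1r => <-.
  have -> : (fun x => 1 * g x + -1 * (h x * g1 x)) = (fun x => g x * (1 - bump (e *: x))).
    by apply/funext => x; rewrite /g1; field.
  rewrite mulrCA; apply: Ubnd; last by apply: hB; rewrite ltW.
  have := rschwartz_add (rschwartz_scale 1 rg) (rschwartz_scale (- 1) rg2).
  by congr rschwartz; apply/funext => x; rewrite /g1; field.
apply/normr0_eq0; apply: (@harmonic_squeeze _ _ (C * B)) => // k.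
rewrite mulrC; apply: C0; rewrite invr_gt0 ltr0n /=.
by rewrite invf_le1 ?ltr0n // ler1n.
Qed.

End Bump.

(** * Continuity by seminorm bounds and the adjoint multiplier *)

Section TameContinuity.
Context {R : realType} {d : nat}.
Local Notation S := (schwartz R d).
Implicit Types (f g : S).

Lemma cbnd_seminorm n N B f s : cbnd n N B f -> (size s <= n)%N ->
  seminorm N s f <= 2 * B.
Proof.
move=> [hr hi] ss; apply: seminorm_le => x.
have -> : 2 * B = B + B by ring.
apply: le_trans (lerD (hr s ss x) (hi s ss x)).
rewrite -mulrDr; apply: ler_wpM2l; first exact: wt_ge0.
exact: (normc_le (cpartial s f x)).
Qed.

Lemma seminorm_cbnd n N B f :
  (forall s, (size s <= n)%N -> seminorm N s f <= B) -> cbnd n N B f.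
Proof.
move=> h; split=> s ss x; apply: le_trans (h s ss);
  apply: le_trans (seminorm_ub N s f x); apply: ler_wpM2l; try exact: wt_ge0.
  exact: (normc_re (cpartial s f x)).
exact: (normc_im (cpartial s f x)).
Qed.

Lemma cbnd_ge0 n N B f : cbnd n N B f -> 0 <= B.
Proof. by case=> /bnd_ge0. Qed.

Lemma cbnd_mono n N B n' N' B' f : (n' <= n)%N -> (N' <= N)%N -> B <= B' ->
  cbnd n N B f -> cbnd n' N' B' f.
Proof. by move=> nn NN BB [hr hi]; split; apply: bnd_mono; eassumption. Qed.

Lemma cbnd_scale n N B (c : R) f : 0 <= c -> cbnd n N B f -> cbnd n N (c * B) (c%:C *: f).
Proof.
move=> c0 [hr hi]; rewrite -[_ *: f]addr0 /cbnd.
have -> : rpart (c%:C *: f + 0) = (fun x => c * rpart f x).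
  by apply/funext => x; rewrite rpart_lin mul0r subr0 addr0.
have -> : ipart (c%:C *: f + 0) = (fun x => c * ipart f x).
  by apply/funext => x; rewrite ipart_lin mul0r !addr0.
split; rewrite -[X in bnd _ _ (X * _)](ger0_norm c0).
  exact: bnd_scale (rpart_rschwartz f).1 hr.
exact: bnd_scale (ipart_rschwartz f).1 hi.
Qed.

Lemma nbhs_ball0 N (e : R) : 0 < e -> nbhs (0 : S) (schwartz_ball 0 N e).
Proof. by move=> e0; exists N, e; split. Qed.

(** The slack [t] covers the case [B = 0], where dividing by [B] is impossible; it is sent to 0
    afterwards. *)
Lemma ball_absorb N (e t B : R) f : 0 < e -> 0 < t -> cbnd N N B f ->
  exists2 c, 0 < c & schwartz_ball 0 N e (c%:C *: f) /\ c^-1 = 2 / e * B + t.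
Proof.
move=> e0 t0 hf; have B0 := cbnd_ge0 hf.
have den : 0 < 2 * B + e * t by rewrite ltr_wpDl ?mulr_ge0 // mulr_gt0.
have c0 : 0 < e / (2 * B + e * t) by exact: divr_gt0.
exists (e / (2 * B + e * t)) => //; split.
  move=> s ss; rewrite subr0.
  apply: le_lt_trans (cbnd_seminorm (cbnd_scale (ltW c0) hf) ss) _.
  have -> : 2 * (e / (2 * B + e * t) * B) = e * (2 * B / (2 * B + e * t)) by ring.
  by rewrite gtr_pMr // ltr_pdivrMr // mul1r ltrDl mulr_gt0.
by rewrite invf_div; field; rewrite gt_eqF.
Qed.

Lemma homogeneous_bound (gamma : S -> R) :
  (forall (c : R) f, 0 <= c -> gamma (c%:C *: f) = c * gamma f) ->
  nbhs (0 : S) [set f | gamma f <= 1] ->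
  exists n N C, 0 <= C /\ forall f B, cbnd n N B f -> gamma f <= C * B.
Proof.
move=> hom [N [e [e0 sub]]].
exists N, N, (2 / e); split; first by rewrite divr_ge0 // ltW.
move=> f B hf; apply/ler_addgt0Pr => t t0.
have [c c0 [cf <-]] := ball_absorb e0 t0 hf.
have := sub _ cf; rewrite /= (hom _ _ (ltW c0)) => h1.
by rewrite -[c^-1]mulr1 ler_pdivlMl.
Qed.

Lemma continuous_seminorm_bound (gamma : S -> R) : continuous_seminorm gamma ->
  exists n N C, 0 <= C /\ forall f B, cbnd n N B f -> gamma f <= C * B.
Proof.
move=> [_ hom ct]; apply: homogeneous_bound.
  move=> c f c0; rewrite hom /=; congr (_ * _).
  by rewrite expr0n addr0 sqrtr_sqr ger0_norm.
have g0 : gamma 0 = 0.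
  by have := hom 0 0; rewrite scaler0 => ->; rewrite normc0 mul0r.
have : nbhs (gamma 0) [set t | t <= 1].
  rewrite g0; apply/nbhs_normP; exists 1; first exact: ltr01.
  move=> t /=; rewrite sub0r normrN => /ltW.
  exact: le_trans (ler_norm _).
exact: (ct 0).
Qed.

Lemma linear_combination (Op : S -> S) (a : R[i]) f g : linear Op ->
  Op (a *: f + g : S) = a *: Op f + Op g :> S.
Proof. exact. Qed.

Lemma linear_zero (Op : S -> S) : linear Op -> Op 0 = 0.
Proof.
move=> /(linear_combination (-1) 0 0).
by rewrite scaler0 addr0 scaleN1r addNr.
Qed.

Lemma linear_scale (Op : S -> S) (a : R[i]) f : linear Op -> Op (a *: f) = a *: Op f.
Proof.
by move=> lin; have := linear_combination a f 0 lin; rewrite (linear_zero lin) !addr0.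
Qed.

Lemma linear_sub (Op : S -> S) f g : linear Op -> Op (f - g) = Op f - Op g.
Proof.
move=> /(linear_combination (-1) g f); rewrite !scaleN1r => e.
by rewrite addrC e addrC.
Qed.

Lemma continuous_tame (Op : S -> S) : linear Op -> continuous Op -> tame Op.
Proof.
move=> lin ct n N.
(* A ball uses one index for both the order and the weight, hence the maximum. *)
pose M := maxn n N.
have ball1 : nbhs (Op 0) (schwartz_ball 0 M (1 : R)).
  by rewrite linear_zero //; exact: nbhs_ball0.
have [N' [e [e0 sub]]] := ct 0 _ ball1.
exists N', N', (2 / e); split; first by rewrite divr_ge0 // ltW.
move=> f B hf.
have main t : 0 < t -> cbnd n N (2 / e * B + t) (Op f).
  move=> t0; have [c c0 [cf <-]] := ball_absorb e0 t0 hf.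
  have h1 : cbnd M M 1 (c%:C *: Op f).
    rewrite -linear_scale //; apply: seminorm_cbnd => s ss; apply: ltW.
    by have := sub _ cf s ss; rewrite subr0.
  have := cbnd_scale (ltW (_ : 0 < c^-1)) h1.
  rewrite invr_gt0 => /(_ c0).
  rewrite mulr1 scalerA -rmorphM /= mulVf ?gt_eqF // scale1r.
  by apply: cbnd_mono; rewrite ?leq_maxl ?leq_maxr.
split=> s ss x; apply/ler_addgt0Pr => t t0; have [hr hi] := main t t0;
  [exact: hr|exact: hi].
Qed.

Lemma tame_continuous (Op : S -> S) : linear Op -> tame Op -> continuous Op.
Proof.
move=> lin tm f A [M [e [e0 sub]]].
have [n' [N' [C [C0 hC]]]] := tm M M.
pose K := maxn n' N'.
have C1 : 0 < 2 * C + 1 by rewrite ltr_wpDl // mulr_ge0.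
exists K, (e / (2 * C + 1)); split; first exact: divr_gt0.
move=> g hg; apply: sub => s ss.
have h : cbnd n' N' (e / (2 * C + 1)) (g - f).
  apply: (@cbnd_mono K K (e / (2 * C + 1))); rewrite ?leq_maxl ?leq_maxr //.
  by apply: seminorm_cbnd => s' ss'; apply: ltW; exact: hg.
rewrite -linear_sub //; apply: le_lt_trans (cbnd_seminorm (hC _ _ h) ss) _.
have -> : 2 * (C * (e / (2 * C + 1))) = e * (2 * C / (2 * C + 1)) by ring.
by rewrite gtr_pMr // ltr_pdivrMr // mul1r ltrDl.
Qed.

End TameContinuity.

Section Reflection.
Context {R : realType} {d : nat}.
Local Notation S := (schwartz R d).
Implicit Types (f g : S) (u v : 'rV[R]_d -> R).

Lemma neg_affine : coord_affine (fun x : 'rV[R]_d => - x) (fun i => i) (- 1).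
Proof. by move=> x i s; rewrite opprD mulN1r scaleNr. Qed.

Lemma rschwartz_neg u : rschwartz u -> rschwartz (u \o -%R) /\
  forall n N B, bnd n N B u -> bnd n N B (u \o -%R).
Proof.
move=> ru; apply: (rschwartz_affine neg_affine _ _ ru).
  by move=> x; rewrite normrN.
by rewrite normrN1.
Qed.

Definition refl f : S := schwartz_of_parts
  (rschwartz_neg (rpart_rschwartz f)).1 (rschwartz_neg (ipart_rschwartz f)).1.

Lemma reflE f x : refl f x = f (- x).
Proof. by rewrite /= /rpart /ipart; case: (schwartz_fun f (- x)). Qed.

Lemma schwartz_ext f g : (forall x, f x = g x) -> f = g.
Proof. by move=> h; apply: val_inj; exact: funext. Qed.

Lemma schwartz_linE (a : R[i]) f g x : (a *: f + g : S) x = a *: (f x) + g x.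
Proof. by []. Qed.

Lemma refl_linear : linear refl.
Proof. by move=> a f g; apply: schwartz_ext => x; rewrite schwartz_linE !reflE. Qed.

Lemma refl_tame : tame refl.
Proof.
move=> n N; exists n, N, 1; split => // f B [hr hi]; rewrite mul1r.
by split; apply: (rschwartz_neg _).2; [exact: rpart_rschwartz|exact: hr|
  exact: ipart_rschwartz|exact: hi].
Qed.

End Reflection.

Section AdjointMultiplier.
Context {R : realType} {d : nat}.
Local Notation S := (schwartz R d).
Variables (m : 'rV[R]_d -> R) (Theta : S -> S).
Hypothesis hTheta : multiplier (fun xi => (m xi)%:C) Theta.

Let mult g : S := ftr (Theta (iftr g)).

Let multE g x : mult g x = (m x)%:C * g x.
Proof.
have [_ _ _ h] := hTheta.
by rewrite /mult -fourierE h fourierE iftrK.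
Qed.

Let neg_mult g : S := refl (mult (refl g)).

Let neg_multE g x : neg_mult g x = (m (- x))%:C * g x.
Proof. by rewrite /neg_mult reflE multE reflE opprK. Qed.

Lemma symbol_smooth : smooth m.
Proof. by have [[h _] _ _ _] := hTheta. Qed.

(** Conjugating Theta by the Fourier transform and the reflection gives an operator on Schwartz
    functions that multiplies by m (- x); its values are therefore Schwartz. *)
Lemma smult_symbol : smult (fun x => m (- x)).
Proof.
split; first exact: (smooth_affine neg_affine symbol_smooth).1.
move=> g rg; have := rpart_rschwartz (neg_mult (schwartz_of_parts rg (@rschwartz0 R d))).
congr rschwartz; apply/funext => x; rewrite /rpart neg_multE /=; ring.
Qed.

Definition adjoint_multiplier : S -> S := fun f => iftr (neg_mult (ftr f)).

Lemma comp_linear (Op Op' : S -> S) : linear Op -> linear Op' -> linear (Op \o Op').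
Proof. by move=> l l' a f g /=; rewrite l' l. Qed.

Lemma adjoint_multiplierP : multiplier (fun xi => (m (- xi))%:C) adjoint_multiplier.
Proof.
have [_ linT ctT _] := hTheta.
have ml : linear mult := comp_linear ftr_linear (comp_linear linT iftr_linear).
have nl : linear neg_mult := comp_linear refl_linear (comp_linear ml refl_linear).
have al : linear adjoint_multiplier :=
  comp_linear iftr_linear (comp_linear nl ftr_linear).
have tT := continuous_tame linT ctT.
have mt : tame mult := tame_comp ftr_tame (tame_comp tT iftr_tame).
have nt : tame neg_mult := tame_comp refl_tame (tame_comp mt refl_tame).
have adjt : tame adjoint_multiplier := tame_comp iftr_tame (tame_comp nt ftr_tame).
split.
- split; first exact: (smooth_affine neg_affine symbol_smooth).1.
  exact: smooth_cst.
- exact: al.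
- exact: tame_continuous.
- by move=> f xi; rewrite !fourierE /adjoint_multiplier iftrK neg_multE.
Qed.

(** The constructed adjoint rules out the default value of [multiplier_of]. *)
Lemma multiplier_ofP :
  multiplier (fun xi => (m (- xi))%:C) (multiplier_of (fun xi => (m (- xi))%:C)).
Proof.
rewrite /multiplier_of; case: pselect => [h|]; first exact: (svalP (cid h)).
by case; exists adjoint_multiplier; exact: adjoint_multiplierP.
Qed.

End AdjointMultiplier.

(** * Functionals on the Fourier side *)

Section RealSymbols.
Context {R : realType} {d : nat}.
Local Notation S := (schwartz R d).
Implicit Types (f : S) (g h : 'rV[R]_d -> R) (V W : S -> R[i]^o).

(** A total function with default value 0, so that functionals can be composed with it on arbitrary
    real functions. *)
Definition ofreal g : S :=
  if pselect (rschwartz g) is left rg then schwartz_of_parts rg (@rschwartz0 R d) else 0.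

Lemma ofrealE g x : rschwartz g -> ofreal g x = (g x)%:C.
Proof. by rewrite /ofreal; case: pselect. Qed.

Lemma ofreal_parts g : rschwartz g ->
  rpart (ofreal g) = g /\ ipart (ofreal g) = (fun=> 0).
Proof. by rewrite /ofreal; case: pselect. Qed.

Lemma ofreal_lin (a b : R) g h : rschwartz g -> rschwartz h ->
  ofreal (fun x => a * g x + b * h x) = a%:C *: ofreal g + b%:C *: ofreal h.
Proof.
move=> rg rh; apply: schwartz_ext => x.
have -> : (a%:C *: ofreal g + b%:C *: ofreal h : S) x =
  a%:C * (ofreal g x) + b%:C * (ofreal h x) :> R[i] by [].
rewrite !ofrealE //; last exact: rschwartz_lin.
by rewrite rmorphD !rmorphM.
Qed.

Lemma ofreal_split f : f = ('i)%C *: ofreal (ipart f) + ofreal (rpart f).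
Proof.
have [rr ri] := (rpart_rschwartz f, ipart_rschwartz f).
have [[er1 er2] [ei1 ei2]] := (ofreal_parts rr, ofreal_parts ri).
apply: schwartz_eq => x.
  by rewrite rpart_lin er1 ei1 ei2 /= mul0r mul1r subr0 add0r.
by rewrite ipart_lin er2 ei1 ei2 /= mul0r mul1r add0r addr0.
Qed.

Lemma cbnd_ofreal n N B g : rschwartz g -> bnd n N B g -> cbnd n N B (ofreal g).
Proof.
move=> rg hg; have [er ei] := ofreal_parts rg; split; first by rewrite er.
rewrite ei; have := bnd_scale 0 rg.1 hg; rewrite normr0 mul0r.
have -> : (fun x => 0 * g x) = (fun=> 0) by apply/funext => x; rewrite mul0r.
by apply: bnd_mono => //; exact: bnd_ge0 hg.
Qed.

Lemma functional_lin V (a : R[i]) f f' : linear V ->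
  V (a *: f + f') = a * V f + V f' :> R[i].
Proof. exact. Qed.

(** Fourier inversion and complex linearity reduce the equality to real Schwartz functions of the
    frequency. *)
Lemma functional_ext V W : linear V -> linear W ->
  (forall g, rschwartz g -> V (iftr (ofreal g)) = W (iftr (ofreal g))) -> V = W.
Proof.
move=> lV lW h; apply/funext => f; rewrite -(ftrK f) (ofreal_split (ftr f)).
rewrite (linear_combination _ _ _ iftr_linear) !functional_lin //.
by rewrite (h _ (ipart_rschwartz _)) (h _ (rpart_rschwartz _)).
Qed.

Lemma iftr_ofreal_bound (gamma : S -> R) : continuous_seminorm gamma ->
  exists n N C, forall g B, rschwartz g -> bnd n N B g ->
    gamma (iftr (ofreal g)) <= C * B.
Proof.
move=> /continuous_seminorm_bound[n [N [C [C0 hC]]]].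
have [n' [N' [C' [C'0 hC']]]] := @iftr_tame R d n N.
exists n', N', (C * C') => g B rg hg; rewrite -mulrA; apply: hC.
by apply: hC'; exact: cbnd_ofreal.
Qed.

(** Stands for the real and the imaginary part; composing with one of them turns complex functionals
    into the real sequences that are averaged. *)
Definition real_form (rho : R[i] -> R) :=
  (forall (a b : R) z z', rho (a%:C * z + b%:C * z') = a * rho z + b * rho z') /\
  forall z, `|rho z| <= normc z.

Lemma real_form_re : real_form (@complex.Re R).
Proof. by split; [move=> a b [u v] [u' v'] /=; ring|exact: normc_re]. Qed.

Lemma real_form_im : real_form (@complex.Im R).
Proof. by split; [move=> a b [u v] [u' v'] /=; ring|exact: normc_im]. Qed.

Lemma real_forms_separate (z z' : R[i]) :
  (forall rho, real_form rho -> rho z = rho z') -> z = z'.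
Proof.
move=> h; have := h _ real_form_re; have := h _ real_form_im.
by case: z z' {h} => [a b] [u v] /= -> ->.
Qed.

Lemma real_form_linear rho (w : R[i]) V : real_form rho -> linear V ->
  linear_on_schwartz (fun g => rho (w * V (iftr (ofreal g)))).
Proof.
move=> [rl _] lV a b g h rg rh; rewrite -rl ofreal_lin //; congr rho.
rewrite (linear_combination _ _ _ iftr_linear) functional_lin //.
rewrite (linear_scale _ _ iftr_linear).
have := functional_lin (b%:C) (iftr (ofreal h)) 0 lV; rewrite addr0 => ->.
have := functional_lin (-1) 0 0 lV; rewrite scaler0 addr0 mulN1r addNr => ->.
by rewrite addr0 mulrDr; congr (_ + _); rewrite mulrCA.
Qed.

Lemma normc_expz (w : R[i]) (k : int) : normc w = 1 -> normc (w ^ k) = 1.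
Proof.
move=> w1.
have pos n : normc (w ^+ n) = 1.
  by elim: n => [|n IH]; [rewrite expr0 normc1|rewrite exprS normcM w1 IH mul1r].
case: k => n; first exact: pos.
have w0 : w ^+ n.+1 != 0.
  by apply/eqP => e; have := pos n.+1; rewrite e normc0 => /esym/eqP; rewrite oner_eq0.
have := normcM (w ^+ n.+1) (w ^- n.+1).
by rewrite mulfV // normc1 pos mul1r => <-.
Qed.

End RealSymbols.

Section BoundedFunctionals.
Context {R : realType} {d : nat}.
Local Notation S := (schwartz R d).
Implicit Types (f : S) (g : 'rV[R]_d -> R) (V : S -> R[i]^o).
Variables (m : 'rV[R]_d -> R) (L : S -> S).
Hypothesis msm : smult (fun x => m (- x)).
Hypothesis hL : multiplier (fun xi => (m (- xi))%:C) L.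
Variables (gamma : S -> R) (M : R).
Hypothesis hgamma : continuous_seminorm gamma.
Hypothesis M0 : 0 <= M.

Lemma multiplier_spectral g : rschwartz g ->
  L (iftr (ofreal g)) = iftr (ofreal (fun x => m (- x) * g x)).
Proof.
move=> rg; have [_ _ _ h] := hL; rewrite -[LHS]ftrK; congr iftr.
apply: schwartz_ext => x; rewrite -fourierE h fourierE iftrK.
by rewrite !ofrealE ?rmorphM //; exact: msm.2.
Qed.

Lemma eigenfunctional_eq0 V (c : R) : linear V ->
  (forall f, normc (V f) <= M * gamma f) ->
  (forall f, V (L f) = c%:C * V f :> R[i]) -> ~ range m c -> forall f, V f = 0.
Proof.
move=> lV bV eV hc f; suff -> : V = (fun=> 0) by [].
apply: functional_ext => //; first by move=> a f1 f2; rewrite scaler0 addr0.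
move=> g rg; apply: real_forms_separate => rho hrho.
have rho0 : rho 0 = 0.
  by have := hrho.1 0 0 0 0; rewrite !mul0r addr0 => ->; rewrite addr0.
have [n [N [C hC]]] := iftr_ofreal_bound hgamma.
rewrite rho0 -[V _]mul1r.
apply: (@nonvanishing_annihilator _ _
  (fun g => rho (1 * V (iftr (ofreal g)))) (fun x => m (- x) - c) n N (M * C)) => //.
- exact: (real_form_linear 1 hrho lV).
- move=> g1 B rg1 hg1; rewrite mul1r; apply: le_trans (hrho.2 _) _.
  apply: le_trans (bV _) _; rewrite -mulrA; apply: ler_wpM2l => //; exact: hC.
- exact: smooth_add msm.1 (smooth_cst (- c)).
- move=> x; apply/eqP => /subr0_eq e; apply: hc; exists (- x) => //.
- move=> g1 rg1.
  have -> : (fun x => (m (- x) - c) * g1 x) =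
      (fun x => 1 * (m (- x) * g1 x) + (- c) * g1 x).
    by apply/funext => x; ring.
  have h := real_form_linear 1 hrho lV 1 (- c) (msm.2 _ rg1) rg1.
  rewrite h -multiplier_spectral // eV.
  have := hrho.1 c 0 (V (iftr (ofreal g1))) 0.
  by rewrite mulr0 addr0 mul0r addr0 !mul1r => ->; ring.
Qed.

Lemma bounded_sequence_period (T : int -> S -> R[i]^o) (A : R[i]) : A != 0 ->
  (forall k, linear (T k)) -> (forall k f, normc (T k f) <= M * gamma f) ->
  (forall k f, T k (L f) = A * T (k + 1) f :> R[i]) ->
  forall f, (A / (normc A)%:C) ^+ 2 * T 2 f = T 0 f :> R[i].
Proof.
move=> A0 lT bT hT.
pose a := normc A; pose w := A / a%:C.
have a0 : a != 0 by apply/eqP => /eq0_normc/eqP; rewrite (negbTE A0).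
have ac0 : a%:C != 0 :> R[i] by rewrite fmorph_eq0.
have w0 : w != 0 by rewrite mulf_neq0 // invr_eq0.
have wn : normc w = 1.
  have := normcM w a%:C; rewrite divfK // /= expr0n addr0 sqrtr_sqr.
  rewrite ger0_norm; last by rewrite /a; case: (A) => ? ?; exact: sqrtr_ge0.
  by move=> h; apply: (mulIf a0); rewrite -h mul1r.
suff h : (fun f => w ^+ 2 * T 2 f : R[i]^o) = T 0.
  by move=> f; exact: (congr1 (fun V => V f) h).
have lw : linear (fun f => w ^+ 2 * T 2 f : R[i]^o).
  by move=> b f f'; rewrite (functional_lin _ _ _ (lT 2)) mulrDr mulrCA.
apply: functional_ext => // g rg; apply: real_forms_separate => rho hrho.
have [n [N [C hC]]] := iftr_ofreal_bound hgamma.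
(* The twist by [w ^ k] replaces the factor [A] of the recursion by its modulus, which [p] then
   absorbs; as |w| = 1, the bounds are unchanged. *)
pose tau k g := rho (w ^ k * T k (iftr (ofreal g))).
pose p x := a^-1 * m (- x).
have := @shifted_period2 R d p tau n N (M * C) _ _ _ _ 0 g rg.
rewrite /tau add0r expr0z mul1r; apply => {g rg}.
- exact: smult_mul (smult_cst _) msm.
- by move=> k; exact: (real_form_linear (w ^ k) hrho (lT k)).
- move=> k g rg; rewrite /tau; congr rho.
  have -> : (fun x => p x * g x) = (fun x => a^-1 * (m (- x) * g x) + 0 * g x).
    by apply/funext => x; rewrite /p; ring.
  rewrite ofreal_lin //; last exact: msm.2.
  rewrite scale0r addr0 (linear_scale _ _ iftr_linear) -multiplier_spectral //.
  have := functional_lin (a^-1)%:C (L (iftr (ofreal g))) 0 (lT k); rewrite addr0 => ->.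
  have := functional_lin (-1) 0 0 (lT k); rewrite scaler0 addr0 mulN1r addNr => ->.
  rewrite addr0 hT expfzDr // expr1z fmorphV /w; ring.
- move=> k g B rg hg; apply: le_trans (hrho.2 _) _.
  rewrite normcM normc_expz // mul1r; apply: le_trans (bT _ _) _.
  rewrite -mulrA; apply: ler_wpM2l => //; exact: hC.
Qed.

End BoundedFunctionals.

(** * Decomposition into eigenvectors *)

Lemma continuous_combination {R : realType} (X : topologicalType) (b c : R[i])
    (V W : X -> R[i]^o) :
  continuous V -> continuous W -> continuous (fun f => b * V f + c * W f : R[i]^o).
Proof.
have cZ (z : R[i]) (U : X -> R[i]^o) f : continuous U ->
    (fun f => z *: U f : R[i]^o) @ f --> (z *: U f : R[i]^o).
  by move=> cU; apply: cvgZl_tmp; exact: cU.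
by move=> cV cW f; exact: (cvgD (cZ b V f cV) (cZ c W f cW)).
Qed.

Lemma tempered_combination {R : realType} {d : nat} (b c : R[i])
    (V W : schwartz R d -> R[i]^o) :
  tempered V -> tempered W -> tempered (fun f => b * V f + c * W f : R[i]^o).
Proof.
move=> [lV cV] [lW cW]; split; last exact: continuous_combination.
move=> z f g; rewrite (functional_lin z f g lV) (functional_lin z f g lW).
have alg (p q r s : R[i]) : b * (z * p + q) + c * (z * r + s) =
  z * (b * p + c * r) + (b * q + c * s) by ring.
exact: alg.
Qed.

Theorem theorem4p2 (R : realType) (d : nat)
  (m : 'rV[R]_d -> R) (Theta : schwartz R d -> schwartz R d)
  (hTheta : multiplier (fun xi => (m xi)%:C) Theta)
  (T : int -> schwartz R d -> R[i]^o) (hT : forall k, tempered (T k))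
  (A : R[i]) (hA : A != 0)
  (hTA : forall k, multiplier_ext (fun xi => (m xi)%:C) (T k) = A *: T (k + 1))
  (gamma : schwartz R d -> R) (hgamma : continuous_seminorm gamma)
  (M : R) (hM : 0 < M)
  (hbound : forall k psi, normc (T k psi) <= M * gamma psi) :
  [/\ range m (normc A) -> ~ range m (- normc A) ->
        multiplier_ext (fun xi => (m xi)%:C) (T 0) = (normc A)%:C *: T 0,
      range m (- normc A) -> ~ range m (normc A) ->
        multiplier_ext (fun xi => (m xi)%:C) (T 0) = - (normc A)%:C *: T 0,
      range m (normc A) -> range m (- normc A) ->
        exists! Tpm : (schwartz R d -> R[i]^o) * (schwartz R d -> R[i]^o),
          [/\ tempered Tpm.1, tempered Tpm.2, T 0 = Tpm.1 + Tpm.2,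
              multiplier_ext (fun xi => (m xi)%:C) Tpm.1
                = (normc A)%:C *: Tpm.1
            & multiplier_ext (fun xi => (m xi)%:C) Tpm.2
                = - (normc A)%:C *: Tpm.2]
    & ~ range m (normc A) -> ~ range m (- normc A) -> T 0 = 0].
Proof.
pose a := normc A; pose w := A / a%:C.
pose L := multiplier_of (fun xi => (m (- xi))%:C) : schwartz R d -> schwartz R d.
have hL : multiplier (fun xi => (m (- xi))%:C) L := multiplier_ofP hTheta.
have msm := smult_symbol hTheta.
have hTL k f : T k (L f) = A * T (k + 1) f :> R[i].
  exact: (congr1 (fun V => V f) (hTA k)).
have lT k : linear (T k) := (hT k).1.
have M0 := ltW hM.
have a0 : a != 0 by apply/eqP => /eq0_normc/eqP; rewrite (negbTE hA).
have ac0 : a%:C != 0 :> R[i] by rewrite fmorph_eq0.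
have Aw : A = a%:C * w by rewrite /w mulrC divfK.
have w2 f : w ^+ 2 * T 2 f = T 0 f :> R[i] :=
  bounded_sequence_period msm hL hgamma M0 hA lT hbound hTL f.
(* Up to the factor |A|, the operator exchanges T_0 and w T_1. The second of these identities is
   where period two enters. *)
have T0L f : T 0 (L f) = a%:C * (w * T 1 f) :> R[i] by rewrite hTL mulrA -Aw.
have T1L f : w * T 1 (L f) = a%:C * T 0 f :> R[i].
  by rewrite hTL -w2 Aw; ring.
have wn : normc w = 1.
  have := normcM w a%:C; rewrite -[w * _]mulrC -Aw /= expr0n addr0 sqrtr_sqr.
  rewrite ger0_norm; last by rewrite /a; case: (A) => ? ?; exact: sqrtr_ge0.
  by move=> h; apply: (mulIf a0); rewrite -h mul1r.
clearbody w.
pose Te (e : R[i]) : schwartz R d -> R[i]^o :=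
  fun f => 2^-1 * T 0 f + e * 2^-1 * w * T 1 f.
have tTe e : tempered (Te e) by exact: tempered_combination.
have TeL e f : e ^+ 2 = 1 -> Te e (L f) = (e * a%:C) * Te e f :> R[i].
  move=> e2; rewrite /Te T0L -mulrA T1L.
  transitivity (2^-1 * a%:C * (e ^+ 2 * w * T 1 f + e * T 0 f)); last by ring.
  by rewrite e2; ring.
have bTe e f : normc e = 1 -> normc (Te e f) <= M * gamma f.
  move=> e1; apply: (le_trans (le_normcD _ _)); rewrite !normcM e1 wn mul1r mulr1.
  have n2 : normc (2^-1 : R[i]) = 2^-1 :> R.
    have -> : (2^-1 : R[i]) = (2^-1)%:C by rewrite fmorphV rmorph_nat.
    by rewrite /= expr0n addr0 sqrtr_sqr ger0_norm ?invr_ge0.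
  rewrite n2 -mulrDr ler_pdivrMl // mulr_natl mulr2n; apply: lerD; exact: hbound.
have T0E : T 0 = Te 1 + Te (-1).
  have alg (p q : R[i]) :
    p = 2^-1 * p + 1 * 2^-1 * w * q + (2^-1 * p + - 1 * 2^-1 * w * q) by field.
  by apply/funext => f; exact: alg.
have e1 : Te 1 \o L = a%:C *: Te 1.
  by apply/funext => f /=; rewrite TeL ?expr1n // mul1r.
have eN1 : Te (-1) \o L = - a%:C *: Te (-1).
  by apply/funext => f /=; rewrite TeL ?sqrrN ?expr1n // mulN1r.
have z1 : ~ range m a -> Te 1 = 0.
  move=> ha; apply/funext => f.
  apply: (eigenfunctional_eq0 msm hL hgamma M0 (tTe 1).1 _ _ ha) => g.
    by apply: bTe; exact: normc1.
  by rewrite TeL ?expr1n // mul1r.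
have zN1 : ~ range m (- a) -> Te (-1) = 0.
  move=> ha; apply/funext => f.
  apply: (eigenfunctional_eq0 msm hL hgamma M0 (tTe (-1)).1 _ _ ha) => g.
    by apply: bTe; rewrite normcN normc1.
  by rewrite TeL ?sqrrN ?expr1n // mulN1r rmorphN.
have extE V : multiplier_ext (fun xi => (m xi)%:C) V = V \o L by [].
rewrite !extE; split.
- by move=> _ /zN1 h; rewrite T0E h addr0.
- by move=> _ /z1 h; rewrite T0E h add0r.
- move=> _ _; exists (Te 1, Te (-1)); split => [|[P Q] /= [_ _ PQ hP hQ]].
    by split => //=; exact: tTe.
  have PQf f : T 0 f = P f + Q f :> R[i] := congr1 (fun V => V f) PQ.
  have Pf f : P (L f) = a%:C * P f :> R[i] := congr1 (fun V => V f) hP.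
  have Qf f : Q (L f) = - a%:C * Q f :> R[i] := congr1 (fun V => V f) hQ.
  (* Uniqueness: applying the operator to T_0 = P + Q gives |A| (P - Q) = |A| w T_1, so the sum and
     the difference of P and Q are both determined. *)
  have wT f : w * T 1 f = P f - Q f :> R[i].
    by apply: (mulfI ac0); rewrite -T0L PQf Pf Qf; ring.
  by congr pair; apply/funext => f; rewrite /Te -mulrA wT PQf; field.
- by move=> /z1 h1 /zN1 h2; rewrite T0E h1 h2 addr0.
Qed.
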